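(* For all integers $k\ge 3$ and $k/2<\ell<k$ such that $(k-\ell)\nmid k$, there exists $\Delta>0$ such that the following holds for all sufficiently large $n\in(k-\ell)\mathbb{N}$, where $s=\lceil \frac{k}{k-\ell}\rceil$. Suppose that $\mathcal{H}=(V,E)$ is an $n$-vertex $k$-graph. If $\mathcal{H}$ is $\Delta$-extremal and either \begin{itemize} \item $k/2<\ell<3k/4$ and $\delta_{k-1}(\mathcal{H})\ge \frac{n}{s(k-\ell)}$, or \item $k/2<\ell<k$ and $\delta_{k-1}(\mathcal{H})\ge \frac{n}{s(k-\ell)}+\frac{k^2}{2}$, \end{itemize} then $\mathcal{H}$ contains a Hamilton $\ell$-cycle.
   Context: A $k$-graph ($k$-uniform hypergraph) $\mathcal{H}=(V,E)$ has a finite vertex set $V$ and edge set $E\subseteq\binom{V}{k}$. For a $(k-1)$-set $S\subseteq V$, $\deg_{\mathcal{H}}(S)$ is the number of vertices $v\in V\setminus S$ with $S\cup\{v\}\in E$, and the minimum co-degree $\delta_{k-1}(\mathcal{H})$ is the minimum of $\deg_{\mathcal{H}}(S)$ over all $(k-1)$-sets $S\subseteq V$. For $B\subseteq V$, $e(B)$ is the number of edges of $\mathcal{H}$ contained in $B$. For $\Delta>0$ (and given $k,\ell$, $s=\lceil \frac{k}{k-\ell}\rceil$), an $n$-vertex $k$-graph $\mathcal{H}$ is called $\Delta$-extremal if there is a set $B\subseteq V(\mathcal{H})$ such that $|B|=\left\lfloor\left(1-\frac{1}{s(k-\ell)}\right)n\right\rfloor$ and $e(B)\le \Delta n^k$.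 A $k$-graph is a ($k$-uniform) $\ell$-cycle if there is a cyclic ordering of its vertices such that every edge consists of $k$ consecutive vertices and two consecutive edges share exactly $\ell$ vertices. $\mathcal{H}$ contains a Hamilton $\ell$-cycle if it contains an $\ell$-cycle as a spanning subhypergraph. *)

(* Defs.v *)
From HB Require Import structures.
From mathcomp Require Import all_boot all_order all_algebra.
From mathcomp Require Export reals.

Set Implicit Arguments.
Unset Strict Implicit.
Unset Printing Implicit Defensive.

Import Order.TTheory GRing.Theory Num.Theory.
Local Open Scope ring_scope.

Record kgraph (k : nat) (V : finType) := KGraph {
  edges : {set {set V}};
  edges_card : forall e : {set V}, e \in edges -> #|e| = k
}.

Section Hypergraphs.
Variables (k : nat) (V : finType).
Implicit Type H C : kgraph k V.

Definition codeg H (S : {set V}) : nat :=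
  #|[set v in ~: S | v |: S \in edges H]|.

(* Codegrees are at most #|V|, so the default value #|V| of the minimum only
   shows up when there is no (k-1)-set at all. *)
Definition min_codeg H : nat :=
  \big[minn/#|V|]_(S : {set V} | #|S| == k.-1) codeg H S.

Definition num_edges_in H (B : {set V}) : nat :=
  #|[set e in edges H | e \subset B]|.

Definition s_param (l : nat) : nat :=
  `|Num.ceil (k%:R / (k - l)%:R : rat)|%N.

Definition extremal (R : realType) (l : nat) (Delta : R) H : Prop :=
  exists B : {set V},
    #|B|%:Z = Num.floor
                ((1 - 1 / (s_param l * (k - l))%:R) * #|V|%:R : R)
    /\ (num_edges_in H B)%:R <= Delta * #|V|%:R ^+ k.

(* The k consecutive vertices starting at position i in the cyclic ordering v
   (for i < size v and k <= size v). *)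
Definition window (v : seq V) (i : nat) : {set V} :=
  [set:: take k (rot i v)].

(* v is the cyclic ordering of the vertices, and p lists, in the order in which
   they are met along v, the positions where the edges start; [cycle] also
   compares the last edge with the first one.  The covering condition says that
   a cycle has no vertices outside its edges: without it, the edgeless graph,
   or just two edges sharing l vertices, would qualify. *)
Definition is_lcycle (l : nat) C : Prop :=
  exists (v : seq V) (p : seq nat),
    [/\ perm_eq v (enum V),
        sorted ltn p /\ all (fun i => i < size v)%N p,
        edges C = [set:: [seq window v i | i <- p]],
        cycle (fun i j => #|window v i :&: window v j| == l) p
      & cover (edges C) = [set: V]].

Definition has_hamilton_lcycle (l : nat) H : Prop :=
  exists C, edges C \subset edges H /\ is_lcycle l C.

End Hypergraphs.

Arguments s_param : clear implicits.

(* Main.v *)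
(* Proof idea. Put d = k - l, n = m d, s = ceil (k / d), A = V \ B. Since
   |A| <= delta, almost every k-set with exactly one vertex in A is an edge. The
   m windows of the cycle are cut into runs of s (or s - 1) consecutive ones, all
   meeting in one vertex of A, and one random bijection places all the remaining
   vertices: a local lemma for permutations makes every window an edge. The few
   exceptions are treated beforehand. A vertex of large degree into B which is
   not typical is surrounded by a tight path in its link. If A is too small, say
   |A| < delta, the missing vertices of A are replaced by disjoint edges inside
   the complement: the codegree provides edges, and an edge containing a set G
   which is bad (too few edges G + A + B^j) is traded for one of the many edges
   of B containing G, with a minimal bad G split between the two ends of the
   window so that the other windows only see good sets. *)
Require Import Defs.
From mathcomp Require Import all_boot all_order all_algebra all_fingroup reals.
From mathcomp Require Import zify ring lra.
Import Order.TTheory GRing.Theory Num.Theory.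
Local Open Scope ring_scope.

Set Implicit Arguments.
Unset Strict Implicit.
Unset Printing Implicit Defensive.


(** * A local lemma for random permutations *)

(** Since (s-1)d < k < sd, a vertex lies in s or s-1 windows, and runs of both lengths tune the
    number of windows to exactly m. The obstacle is a tiny positive deficit q = delta - |A1|, where
    A1 is the set of vertices of large degree into B and B1 its complement: the codegree then only
    guarantees of the order of q n^(k-1) edges inside B1, no positive density, and such an edge may
    contain sets that almost no vertex of A1 completes. The way out is to read the codegree
    condition as follows: a set that misses many edges through A1 lies in many edges inside B1.
    Badness itself supplies the density that counting needs. The local lemma is lopsided: events
    interact when they share a position or a value. Sharing a value couples all windows at once,
    hence the separate bound on the edges missed through each single vertex of B1. The constants
    phi, kap, eta, gam, xi, Delta are chosen in this order, each small in terms of the earlier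
    ones. *)

Section PermLocalLemma.
Variables (T : finType) (Y : {set T}).
Local Notation event := (seq T * seq T)%type.
Implicit Types (e : event) (S : seq event) (s : {perm T}).

(** An event (X, Z) prescribes the images of a tuple. Probabilities under a uniform permutation of Y
    appear below as ratios of cardinalities. *)
Definition holds e s := map s e.1 == e.2.

Definition wf_event e :=
  [&& uniq e.1, uniq e.2, all (mem Y) e.1, all (mem Y) e.2 & size e.1 == size e.2].

Definition conflict e e' :=
  has (mem e.1) e'.1 || has (mem e.2) e'.2.

Definition avoiding S := [set s | perm_on Y s & all (fun e => ~~ holds e s) S].

(** A product of transpositions. Unlike an arbitrary extension of the partial map from X to Z, it
    fixes everything outside both tuples, so it cannot make an event that avoids both of them
    happen. *)
Fixpoint move_perm (X Z : seq T) : {perm T} :=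
  match X, Z with
  | x :: X', z :: Z' => let p := move_perm X' Z' in (p * tperm (p x) z)%g
  | _, _ => 1%g
  end.

Lemma move_perm_out X Z u : size X = size Z ->
  u \notin X -> u \notin Z -> move_perm X Z u = u.
Proof.
elim: X Z u => [|x X IH] [|z Z] //= u; rewrite ?perm1 // => -[sz].
rewrite !inE !negb_or => /andP[ux uX] /andP[uz uZ].
rewrite permM (IH Z u) // tpermD //; last by rewrite eq_sym.
apply: contra ux => /eqP E; rewrite -(inj_eq (@perm_inj _ (move_perm X Z))).
by rewrite E IH.
Qed.

Lemma map_move_perm X Z : uniq X -> uniq Z -> size X = size Z ->
  map (move_perm X Z) X = Z.
Proof.
elim: X Z => [|x X IH] [|z Z] //= /andP[xX uX] /andP[zZ uZ] [sz].
rewrite permM tpermL; congr (_ :: _).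
rewrite -[RHS](IH Z) //; apply/eq_in_map => y yX; rewrite permM tpermD //.
  by rewrite (inj_eq (@perm_inj _ _)); apply: contraNneq xX => ->.
apply: contraNneq zZ => ->; rewrite -[X in _ \in X](IH _ uX uZ sz).
exact: map_f.
Qed.

Lemma move_perm_on X Z : size X = size Z -> all (mem Y) X -> all (mem Y) Z ->
  perm_on Y (move_perm X Z).
Proof.
move=> sz aX aZ; apply/subsetP => u; rewrite inE; apply: contraR => uY.
by rewrite move_perm_out //; apply: contra uY; [apply: (allP aX)|apply: (allP aZ)].
Qed.

(* Negative correlation: composing a permutation that sends e.1 to e.2 with the
   permutation moving e.2 to an arbitrary tuple z stays in [avoiding S], and z is
   recovered as the image of e.1. *)
Lemma card_holds_avoiding e S : wf_event e -> all wf_event S ->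
  all (fun e' => ~~ conflict e e') S ->
  (#|[set s in avoiding S | holds e s]| * (#|Y| ^_ (size e.1)) <= #|avoiding S|)%N.
Proof.
case: e => X Z /and5P[/= uX uZ aX aZ /eqP sz] wfS nc.
rewrite -(card_uniq_tuples _ (mem Y)) -cardsX.
pose f (p : {perm T} * (size X).-tuple T) := (p.1 * move_perm Z p.2)%g.
have fX p : p \in setX [set s in avoiding S | holds (X, Z) s]
                   [set t : (size X).-tuple T | all (mem Y) t & uniq t] ->
    map (f p) X = p.2.
  rewrite !inE => /andP[/andP[_ /eqP/= hX]] /andP[aP uP].
  rewrite -[RHS](@map_move_perm Z) ?size_tuple // -[X in _ = map _ X]hX -map_comp.
  by apply: eq_map => x; rewrite /= permM.
rewrite -(@card_in_imset _ _ f) => [|p q hp hq E].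
  apply: subset_leq_card; apply/subsetP => _ /imsetP[[s t] hp ->].
  have := fX _ hp; move: hp; rewrite !inE => /andP[/andP[/andP[Ys av] /eqP/= hX]] /andP[aP uP].
  move=> hf; rewrite perm_onM ?move_perm_on ?size_tuple //=.
  apply/allP => [[X' Z'] hin]; have := allP av _ hin; apply: contra => /eqP /= E.
  have /and5P[/= uX' uZ' _ _ /eqP sz'] := allP wfS _ hin.
  have := allP nc _ hin; rewrite /conflict negb_or => /andP[/hasPn nX /hasPn nZ].
  apply/eqP => /=; rewrite -[RHS]E; apply/eq_in_map => x xX'.
  have fZ' : f (s, t) x \in Z' by rewrite -E map_f.
  have nt : f (s, t) x \notin tval t.
    by apply: contra (nX _ xX'); rewrite -hf mem_map //; apply: perm_inj.
  apply: (@perm_inj _ (move_perm Z t)); rewrite (move_perm_out _ (nZ _ fZ') nt).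
    by rewrite /f permM.
  by rewrite size_tuple.
case: p q hp hq E => s t [s' t'] hp hq E.
have tt' : t = t' by apply/val_inj; rewrite /= -(fX _ hp) -(fX _ hq) E.
by move: E; rewrite /f /= tt' => /mulIg ->.
Qed.

Lemma card_union_bound (A : {set {perm T}}) S :
  (#|A| <= #|[set s in A | all (fun e => ~~ holds e s) S]|
           + \sum_(e <- S) #|[set s in A | holds e s]|)%N.
Proof.
elim: S => [|e S IH] /=.
  by rewrite big_nil addn0 subset_leq_card //; apply/subsetP => s; rewrite inE andbT.
rewrite big_cons addnA (leq_trans IH) // leq_add2r.
apply: (leq_trans _ (leq_card_setU _ _)).
by apply/subset_leq_card/subsetP => s; rewrite !inE => /andP[-> ->]; case: (holds e s).
Qed.

Variable (R : realFieldType).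

Definition prob e : R := (#|Y| ^_ (size e.1))%:R^-1.

Lemma prob_ge0 e : 0 <= prob e.
Proof. by rewrite invr_ge0 ler0n. Qed.

Lemma ffact_wf_gt0 e : wf_event e -> (0 < #|Y| ^_ (size e.1))%N.
Proof.
case/and5P => ue _ /allP ae _ _; rewrite ffact_gt0 -(card_uniqP ue).
by apply/subset_leq_card/subsetP.
Qed.

Variable (E : seq event).
Hypotheses (wfE : all wf_event E) (posE : all (fun e => e.1 != [::]) E).
Hypothesis sumE : forall e, e \in E -> \sum_(e' <- E | conflict e e') prob e' <= 1 / 4.

Lemma sum_subseq (I : eqType) (F : I -> R) (s t : seq I) :
  subseq s t -> (forall i, 0 <= F i) -> \sum_(i <- s) F i <= \sum_(i <- t) F i.
Proof.
move=> sst F0; elim: t s sst => [|x t IH] [|y s] //= sst.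
- by rewrite big_nil sumr_ge0.
rewrite [leRHS]big_cons; case: eqP sst => [->|_] sst.
  by rewrite big_cons lerD2l IH.
by apply: le_trans (IH _ sst) _; rewrite lerDr.
Qed.

Lemma avoiding_sub S S' : {subset S <= S'} -> avoiding S' \subset avoiding S.
Proof.
move=> sS; apply/subsetP => s; rewrite !inE => /andP[-> /allP aS].
by apply/allP => e /sS /aS.
Qed.

(** Conditioning at most doubles the probability of e. Once the events S1 conflicting with e are
    dropped, e is negatively correlated with the rest S2; by induction S1 removes at most the
    fraction 2 * 1/4 of [avoiding S2]. *)
Lemma card_holds_local n S e : (size S <= n)%N -> subseq S E -> e \in E ->
  #|[set s in avoiding S | holds e s]|%:R <= 2 * prob e * #|avoiding S|%:R.
Proof.
elim: n S e => [|n IH] S e szS sSE eE;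
  set S1 := filter (conflict e) S; set S2 := filter (predC (conflict e)) S.
all: have sS2 : {subset S2 <= S} by move=> x; rewrite mem_filter => /andP[].
all: have sS2E : subseq S2 E by apply: subseq_trans sSE; apply: filter_subseq.
all: have wfe : wf_event e by apply: (allP wfE).
all: have N0 : 0 < (#|Y| ^_ (size e.1))%:R :> R by rewrite ltr0n ffact_wf_gt0.
all: have h1 : (#|[set s in avoiding S | holds e s]| <= #|[set s in avoiding S2 | holds e s]|)%N
  by apply/subset_leq_card/subsetP => s; rewrite in_set [in X in _ -> X]in_set => /andP[sa ->]; rewrite (subsetP (avoiding_sub sS2)).
all: have wf2 : all wf_event S2 by apply/allP => x /(mem_subseq sS2E)/(allP wfE).
all: have h2 : #|[set s in avoiding S2 | holds e s]|%:R <= prob e * #|avoiding S2|%:R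
  by rewrite /prob mulrC ler_pdivlMr // -natrM ler_nat card_holds_avoiding // filter_all.
all: have h3 : #|[set s in avoiding S | holds e s]|%:R <= prob e * #|avoiding S2|%:R
  by apply: le_trans h2; rewrite ler_nat.
all: suff /(ler_wpM2l (prob_ge0 e)) : #|avoiding S2|%:R <= 2 * #|avoiding S|%:R :> R by lra.
  by rewrite /S2; case: (S) szS => // _; have := ler0n R #|avoiding [::]|; rewrite /=; lra.
(* The induction hypothesis is applied to S2, which is shorter than S only if S1 is nonempty. *)
have [S1nil|S1n] := boolP (S1 == [::]).
  have -> : S2 = S.
    apply/all_filterP; have := all_predC (conflict e) S => ->.
    by rewrite has_filter negbK.
  by rewrite ler_peMl ?ler0n // ler1n.
have szS2 : (size S2 <= n)%N.
  rewrite -ltnS (leq_trans _ szS) // -(count_predC (conflict e) S) -!size_filter.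
  by rewrite -add1n leq_add2r lt0n size_eq0.
have h4 : #|avoiding S2|%:R <= #|avoiding S|%:R +
    \sum_(f <- S1) #|[set s in avoiding S2 | holds f s]|%:R :> R.
  rewrite -natr_sum -natrD ler_nat; apply: leq_trans (card_union_bound _ S1) _.
  rewrite leq_add2r; apply/subset_leq_card/subsetP => s.
  rewrite !inE => /andP[/andP[-> /allP a2] /allP a1] /=.
  apply/allP => x xS; have [c|c] := boolP (conflict e x).
    by apply: a1; rewrite mem_filter c.
  by apply: a2; rewrite mem_filter /= c.
have h5 : \sum_(f <- S1) #|[set s in avoiding S2 | holds f s]|%:R
    <= \sum_(f <- S1) (2 * prob f * #|avoiding S2|%:R).
  rewrite !big_seq; apply: ler_sum => f; rewrite mem_filter => /andP[_ fS].
  by apply: IH => //; apply: (mem_subseq sSE).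
have h6 : \sum_(f <- S1) prob f <= 1 / 4.
  apply: le_trans (sumE eE); rewrite -[leRHS]big_filter; apply: sum_subseq.
    by rewrite subseq_filter filter_all (subseq_trans (filter_subseq _ _) sSE).
  exact: prob_ge0.
move: h5; rewrite -mulr_suml -mulr_sumr => h5.
have := ler_wpM2r (ler0n R #|avoiding S2|) h6; lra.
Qed.

Lemma local_lemma : exists s, s \in avoiding E.
Proof.
suff H S : subseq S E -> (0 < #|avoiding S|)%N.
  have /card_gt0P[s sE] := H E (subseq_refl _); by exists s.
elim: S => [|e S IH] sE.
  by apply/card_gt0P; exists 1%g; rewrite inE perm_on1.
have sSE : subseq S E := cons_subseq sE.
have eE : e \in E by apply: (mem_subseq sE); rewrite mem_head.
have := IH sSE; rewrite -!(ltr0n R) => h0.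
have := card_holds_local (leqnn _) sSE eE => h1.
have h2 : #|avoiding S|%:R <= #|avoiding (e :: S)|%:R +
    #|[set s in avoiding S | holds e s]|%:R :> R.
  rewrite -natrD ler_nat; apply: leq_trans (card_union_bound _ [:: e]) _.
  rewrite big_seq1 leq_add2r; apply/subset_leq_card/subsetP => s.
  by rewrite !inE /= andbT => /andP[/andP[-> ->] ->].
(* A nonempty event conflicts with itself, so its own probability is a term of the sum. With the
   doubling, each new event leaves at least half of the permutations. *)
have h3 : prob e <= 1 / 4.
  apply: le_trans (sumE eE); rewrite (perm_big _ (perm_to_rem eE)) big_cons.
  have -> : conflict e e.
    apply/orP; left; apply/hasP; have /= := allP posE _ eE.
    case: (e.1) => [//|x X] _; exists x; exact: mem_head.
  by rewrite lerDl sumr_ge0 // => *; apply: prob_ge0.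
have := ler_wpM2r (ltW h0) h3; lra.
Qed.

End PermLocalLemma.

(** * Counting sequences *)

Section Counting.
Variables (R : realFieldType) (V : finType).
Implicit Types (U : {set V}) (t u w : seq V) (P Q : pred (seq V)).

(** Repetitions are allowed, so that counts factor over concatenation; [cnt_not_uniq] shows that
    tuples with repetitions are of lower order. *)
Fixpoint seqs U j : seq (seq V) :=
  if j is j'.+1 then [seq x :: t | x <- enum U, t <- seqs U j'] else [:: [::]].

Lemma mem_seqs U j t : (t \in seqs U j) = (size t == j) && all (mem U) t.
Proof.
elim: j t => [|j IH] [|x t] //=.
  by apply/negP => /allpairsP[[y s] [_ _]].
rewrite eqSS andbCA -IH.
apply/allpairsP/andP => [[[y s] /= [yU sU [-> ->]]]|[xU tU]].
  by rewrite mem_enum in yU.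
by exists (x, t); rewrite mem_enum.
Qed.

Lemma uniq_seqs U j : uniq (seqs U j).
Proof.
elim: j => [|j IH] //=.
by rewrite allpairs_uniq ?enum_uniq // => -[x s] [y t] _ _ [-> ->].
Qed.

Lemma size_seqs U j : size (seqs U j) = (#|U| ^ j)%N.
Proof. by elim: j => [|j IH] //=; rewrite size_allpairs IH -cardE expnS. Qed.

Lemma sum_seqsS U j (F : seq V -> R) :
  \sum_(t <- seqs U j.+1) F t = \sum_(x in U) \sum_(t <- seqs U j) F (x :: t).
Proof. by rewrite big_allpairs_dep /= big_enum. Qed.

Lemma sum_seqs_cat U i j (F : seq V -> R) :
  \sum_(t <- seqs U (i + j)) F t =
  \sum_(u <- seqs U i) \sum_(t <- seqs U j) F (u ++ t).
Proof.
elim: i F => [|i IH] F; first by rewrite big_seq1.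
by rewrite addSn !sum_seqsS; apply: eq_bigr => x _; rewrite IH.
Qed.

Lemma sum_seqs0 U (F : seq V -> R) : \sum_(t <- seqs U 0) F t = F [::].
Proof. exact: big_seq1. Qed.

Definition cnt U j P : R := \sum_(t <- seqs U j) (P t)%:R.

Lemma cntS U j P : cnt U j.+1 P = \sum_(x in U) cnt U j (fun t => P (x :: t)).
Proof. exact: sum_seqsS. Qed.

Lemma cnt0 U P : cnt U 0 P = (P [::])%:R.
Proof. exact: sum_seqs0. Qed.

Lemma cnt_ge0 U j P : 0 <= cnt U j P.
Proof. by apply: sumr_ge0 => t _; apply: ler0n. Qed.

Lemma cnt_cat U i j P :
  cnt U (i + j) P = \sum_(u <- seqs U i) cnt U j (fun t => P (u ++ t)).
Proof. exact: sum_seqs_cat. Qed.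

Lemma cnt_le U j P Q :
  (forall t, size t = j -> all (mem U) t -> P t -> Q t) -> cnt U j P <= cnt U j Q.
Proof.
move=> PQ; rewrite /cnt !big_seq; apply: ler_sum => t; rewrite mem_seqs.
move=> /andP[/eqP st at_]; rewrite ler_nat; case Pt: (P t) => //.
by rewrite (PQ t).
Qed.

Lemma eq_cnt U j P Q :
  (forall t, size t = j -> all (mem U) t -> P t = Q t) -> cnt U j P = cnt U j Q.
Proof.
by move=> PQ; apply/eqP; rewrite eq_le !cnt_le // => t st at_; rewrite PQ.
Qed.

Lemma cnt_sub U U' j P : U \subset U' -> cnt U j P <= cnt U' j P.
Proof.
move=> sU; elim: j P => [|j IH] P; first by rewrite !cnt0.
rewrite !cntS [leRHS](big_setID U) /= (setIidPr sU).
rewrite -[leLHS]addr0 lerD ?ler_sum //.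
by apply: sumr_ge0 => *; apply: cnt_ge0.
Qed.

Lemma cnt_pow U j P (n : nat) : (#|U| <= n)%N -> cnt U j P <= n%:R ^+ j.
Proof.
move=> Un; apply: le_trans (_ : (\sum_(t <- seqs U j) 1) <= _).
  by apply: ler_sum => t _; case: (P t).
rewrite big_const_seq count_predT size_seqs iter_addr_0 -natrX ler_nat.
by case: j => // j; rewrite leq_exp2r.
Qed.

(** Union bound: each of the j coordinates leaves U' in at most xi n^j tuples. *)
Lemma cnt_almost_sub U U' j P (n : nat) (xi : R) : (#|U| <= n)%N ->
  #|U :\: U'|%:R <= xi * n%:R ->
  cnt U j P <= cnt U' j P + j%:R * xi * n%:R ^+ j.
Proof.
move=> Un Ux; elim: j P => [|j IH] P; first by rewrite !cnt0 mul0r mul0r addr0.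
rewrite !cntS (big_setID U') /=.
have h1 : \sum_(x in U :&: U') cnt U j (fun t => P (x :: t)) <=
   \sum_(x in U :&: U') (cnt U' j (fun t => P (x :: t)) + j%:R * xi * n%:R ^+ j).
  exact: ler_sum.
have h2 : \sum_(x in U :\: U') cnt U j (fun t => P (x :: t)) <=
   \sum_(x in U :\: U') n%:R ^+ j by apply: ler_sum => x _; apply: cnt_pow.
move: h1 h2; rewrite big_split /= !sumr_const => h1 h2.
have h3 : \sum_(x in U :&: U') cnt U' j (fun t => P (x :: t)) <=
          \sum_(x in U') cnt U' j (fun t => P (x :: t)).
  rewrite [leRHS](big_setID U) /= setIC lerDl; apply: sumr_ge0 => *; exact: cnt_ge0.
have xi0 : 0 <= xi * n%:R by apply: le_trans Ux; apply: ler0n.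
have h4 : j%:R * xi * n%:R ^+ j *+ #|U :&: U'| <= j%:R * xi * n%:R ^+ j.+1.
  case: (posnP n) Un xi0 => [->|n0] Un xi0.
    by move: Un; rewrite leqn0 cards_eq0 => /eqP ->; rewrite set0I cards0 mulr0n expr0n mulr0.
  have xi1 : 0 <= xi by move: xi0; rewrite pmulr_lge0 // ltr0n.
  rewrite exprS [n%:R * _]mulrC mulrA -mulr_natr ler_wpM2l ?mulr_ge0 ?exprn_ge0 ?ler0n //.
  by rewrite ler_nat (leq_trans _ Un) // subset_leq_card // subsetIl.
have h5 : n%:R ^+ j *+ #|U :\: U'| <= xi * n%:R ^+ j.+1.
  by rewrite exprS mulrA -mulr_natl ler_wpM2r // exprn_ge0 ?ler0n.
rewrite -[X in _ <= _ + X * _ * _]natr1; lra.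
Qed.

Lemma markov (I : Type) (s : seq I) (F : I -> R) (M : R) :
  (forall i, 0 <= F i) ->
  (\sum_(i <- s) (M < F i)%R%:R) * M <= \sum_(i <- s) F i.
Proof.
move=> F0; rewrite mulr_suml; apply: ler_sum => i _.
by have [/ltW|_] := boolP (M < F i); rewrite ?mul1r ?mul0r.
Qed.

Lemma cnt_mem U j P y : (forall t t', perm_eq t t' -> P t = P t') ->
  cnt U j.+1 (fun t => (y \in t) && P t) <= j.+1%:R * cnt U j (fun t => P (y :: t)).
Proof.
move=> Pp; elim: j P Pp => [|j IH] P Pp.
  rewrite mul1r cntS cnt0; under eq_bigr do rewrite cnt0 inE.
  have [yU|yU] := boolP (y \in U).
    rewrite (bigD1 y) //= eqxx big1 ?addr0 // => i /andP[_ /negbTE].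
    by rewrite eq_sym => ->.
  rewrite big1 ?ler0n // => i iU; case: eqP => // E; by rewrite E iU in yU.
rewrite cntS.
have h : forall x, cnt U j.+1 (fun t => (y \in x :: t) && P (x :: t)) <=
   (x == y)%:R * cnt U j.+1 (fun t => P (y :: t)) +
   j.+1%:R * cnt U j (fun t => P (y :: x :: t)).
  move=> x; have h1 : cnt U j.+1 (fun t => (y \in t) && P (x :: t)) <=
      j.+1%:R * cnt U j (fun t => P (y :: x :: t)).
    apply: le_trans (IH (fun t => P (x :: t)) _) _ => [t t' tt'|].
      by apply: Pp; rewrite perm_cons.
    rewrite ler_wpM2l ?ler0n // cnt_le // => t _ _; rewrite (Pp _ [:: y, x & t]) //.
    exact/permPl/(perm_catCA [:: x] [:: y]).
  case: eqVneq => [->|xy]; last first.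
    by rewrite mul0r add0r; apply: le_trans h1; apply: cnt_le => t _ _; rewrite inE eq_sym (negbTE xy).
  rewrite mul1r -[leLHS]addr0 lerD ?mulr_ge0 ?cnt_ge0 ?ler0n //.
  by apply: cnt_le => t _ _ /andP[].
apply: le_trans (ler_sum _ (fun x _ => h x)) _.
rewrite big_split /= -mulr_sumr -(cntS U j (fun t => P (y :: t))) -mulr_suml -[j.+2%:R]nat1r mulrDl lerD2r.
rewrite ler_wpM2r ?cnt_ge0 // -natr_sum (@ler_nat R _ 1).
rewrite -big_mkcondr sum1_card -(cards1 y); apply: subset_leq_card.
by apply/subsetP => x; rewrite !inE => /andP[].
Qed.

(** Each of the j new entries has fewer than |w| + j earlier entries to collide with. The factor n
    on the left replaces the exponent j - 1 on the right. *)
Lemma cnt_not_uniq U j w (n : nat) : (#|U| <= n)%N -> uniq w ->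
  n%:R * cnt U j (fun t => ~~ uniq (w ++ t)) <= ((size w + j) * j)%:R * n%:R ^+ j.
Proof.
move=> Un; elim: j w => [|j IH] w uw.
  by rewrite cnt0 cats0 uw mulr0 muln0 mul0r.
rewrite cntS (big_setID [set x in w]) mulrDr /=.
have h1 : n%:R * \sum_(x in U :&: [set x in w]) cnt U j (fun t => ~~ uniq (w ++ x :: t))
   <= (size w)%:R * n%:R ^+ j.+1.
  rewrite exprS mulrCA ler_wpM2l ?ler0n //.
  apply: le_trans (ler_sum _ (fun x _ => cnt_pow _ _ Un)) _.
  rewrite sumr_const -[leLHS]mulr_natl ler_wpM2r ?exprn_ge0 ?ler0n // ler_nat.
  apply: leq_trans (subset_leq_card (subsetIr _ _)) _.
  by rewrite cardsE; apply: card_size.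
have h2 : n%:R * \sum_(x in U :\: [set x in w]) cnt U j (fun t => ~~ uniq (w ++ x :: t))
   <= ((size w + j.+1) * j)%:R * n%:R ^+ j.+1.
  rewrite mulr_sumr; apply: le_trans (_ : \sum_(x in U :\: [set x in w]) (((size w + j.+1) * j)%:R * n%:R ^+ j) <= _).
    apply: ler_sum => x; rewrite !inE => /andP[xw xU].
    have := IH (rcons w x); rewrite rcons_uniq xw uw size_rcons addSnnS => /(_ isT).
    by apply: le_trans; rewrite ler_wpM2l ?ler0n // cnt_le // => t _ _; rewrite cat_rcons.
  rewrite sumr_const -[leLHS]mulr_natl exprS mulrCA ler_wpM2l ?ler0n //.
  rewrite ler_wpM2r ?exprn_ge0 ?ler0n // ler_nat (leq_trans _ Un) //.
  by rewrite subset_leq_card // subsetDl.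
apply: le_trans (lerD h1 h2) _; rewrite -mulrDl ler_wpM2r ?exprn_ge0 ?ler0n //.
rewrite -natrD ler_nat; nia.
Qed.

End Counting.

(** * Making all windows good by one permutation of the free vertices *)

Section FillWindows.
Variables (R : realFieldType) (V : finType) (Y : {set V}) (good : pred (seq V)).
Variables (W : seq (seq V)) (k K : nat) (psi : R).
Implicit Types (w t : seq V).
Hypothesis good_perm : forall t t', perm_eq t t' -> good t = good t'.

Definition free_part w := filter (mem Y) w.
Definition fixed_part w := filter (predC (mem Y)) w.

Hypotheses (uW : all uniq W) (szW : all (fun w => size w <= k)%N W).
Hypothesis good_fixed : forall w, w \in W -> free_part w = [::] -> good w.
Hypothesis bad_few : forall w, w \in W -> free_part w != [::] ->
  cnt R Y (size (free_part w)) (fun t => ~~ good (fixed_part w ++ t))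
    <= psi * (#|Y| ^_ (size (free_part w)))%:R.
Hypothesis cover_few : forall x, x \in Y -> (count (fun w => x \in w) W <= K)%N.
Hypotheses (psi_ge0 : 0 <= psi) (psi_small : k%:R * K%:R * psi <= 1 / 8).
Hypothesis value_few : forall y, y \in Y ->
  k%:R * (\sum_(w <- W | free_part w != [::])
    cnt R Y (size (free_part w)) (fun t => (y \in t) && ~~ good (fixed_part w ++ t))
      / (#|Y| ^_ (size (free_part w)))%:R) <= 1 / 8.

Let bad_events := flatten
  [seq [seq (free_part w, t) | t <- seqs Y (size (free_part w))
           & uniq t && ~~ good (fixed_part w ++ t)]
     | w <- W & free_part w != [::]].

Let bad_eventsP e : reflect
  (exists w, [/\ w \in W, free_part w != [::], e.1 = free_part w,
     (size e.2 == size e.1) && all (mem Y) e.2 & uniq e.2 && ~~ good (fixed_part w ++ e.2)])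
  (e \in bad_events).
Proof.
apply: (iffP flatten_mapP) => [[w]|[w [wW fw E1 E2 E3]]].
  rewrite mem_filter => /andP[fw wW] /mapP[t]; rewrite mem_filter mem_seqs.
  by move=> /andP[gt tY] ->; exists w.
exists w; first by rewrite mem_filter fw.
apply/mapP; exists e.2; last by rewrite -E1; case: (e).
by rewrite mem_filter E3 mem_seqs -E1.
Qed.

Let sum_bad_events (F : seq V * seq V -> R) :
  \sum_(e <- bad_events) F e =
  \sum_(w <- W | free_part w != [::]) \sum_(t <- seqs Y (size (free_part w))
     | uniq t && ~~ good (fixed_part w ++ t)) F (free_part w, t).
Proof.
rewrite big_flatten big_map big_filter; apply: eq_bigr => w _.
by rewrite big_map big_filter.
Qed.

Let wf_bad : all (wf_event Y) bad_events.
Proof.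
apply/allP => e /bad_eventsP[w [wW _ E1 /andP[/eqP E2 aY] /andP[ut _]]].
rewrite /wf_event ut aY E2 eqxx E1 filter_uniq ?(allP uW) //=.
by rewrite andbT; apply/allP => x; rewrite mem_filter => /andP[].
Qed.

Let sum_cond_const (c : R) (P : pred (seq V)) (ts : seq (seq V)) :
  \sum_(t <- ts | P t) c = (\sum_(t <- ts) (P t)%:R) * c.
Proof.
rewrite big_mkcond mulr_suml; apply: eq_bigr => t _.
by case: (P t); rewrite ?mul1r ?mul0r.
Qed.

Let prob_sum_pos x : x \in Y ->
  \sum_(e <- bad_events) (x \in e.1)%:R * prob Y R e <= K%:R * psi.
Proof.
move=> xY; rewrite sum_bad_events.
apply: le_trans (_ : \sum_(w <- W) (x \in w)%:R * psi <= _); last first.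
  rewrite -mulr_suml ler_wpM2r // -natr_sum ler_nat.
  by rewrite -big_mkcond sum1_count cover_few.
rewrite big_mkcond !big_seq; apply: ler_sum => w wW.
case: ifP => fw; last by rewrite mulr_ge0 ?ler0n.
rewrite /prob /= sum_cond_const [in X in X%:R * _]/free_part mem_filter /= xY mulrCA ler_wpM2l ?ler0n //.
rewrite ler_pdivrMr ?ltr0n; last first.
  rewrite ffact_gt0 -(card_uniqP (filter_uniq _ (allP uW _ wW))).
  by apply/subset_leq_card/subsetP => z; rewrite mem_filter => /andP[].
apply: le_trans (bad_few wW fw); apply: cnt_le => t _ _ /andP[//].
Qed.

Let prob_sum_val y : y \in Y ->
  k%:R * \sum_(e <- bad_events) (y \in e.2)%:R * prob Y R e <= 1 / 8.
Proof.
move=> yY; rewrite sum_bad_events; apply: le_trans (value_few yY).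
rewrite ler_wpM2l ?ler0n //; apply: ler_sum => w fw.
rewrite /prob /= -mulr_suml ler_wpM2r ?invr_ge0 ?ler0n //.
rewrite /cnt [leLHS]big_mkcond; apply: ler_sum => t _.
by case: (y \in t); case: (good _) => //=; case: (uniq t).
Qed.

(** A bad event sends the free part of a window to a tuple that spoils it. Events sharing a position
    come from the at most K windows through it, each of total probability at most psi. Events
    sharing a value y may come from any window, whence the sum over all of W in [value_few]. Each
    kind of conflict gets 1/8 of the allowed 1/4. *)
Lemma fill_windows :
  exists s : {perm V}, perm_on Y s /\ {in W, forall w, good (map s w)}.
Proof.
have [|e eE|s] := local_lemma (R := R) wf_bad.
- by apply/allP => e /bad_eventsP[w [_ fw -> _ _]].
- have wfe := allP wf_bad _ eE.
  have sze : (size e.1 <= k)%N.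
    have /bad_eventsP[w [wW _ -> _ _]] := eE.
    by rewrite size_filter (leq_trans (count_size _ _)) // (allP szW).
  have /and5P[_ _ a1 a2 /eqP s12] := wfe.
  apply: le_trans (_ : \sum_(e' <- bad_events)
    ((\sum_(x <- e.1) (x \in e'.1)%:R) + (\sum_(y <- e.2) (y \in e'.2)%:R)) * prob Y R e' <= _).
    rewrite big_mkcond; apply: ler_sum => e' _; case: ifP => c; last first.
      by rewrite mulr_ge0 ?prob_ge0 ?addr_ge0 ?sumr_ge0 // => *; apply: ler0n.
    rewrite -[leLHS]mul1r ler_wpM2r ?prob_ge0 // -!natr_sum -natrD (ler_nat R 1).
    rewrite -!big_mkcond !sum1_count.
    have hC (A B : seq V) : has (mem B) A -> (0 < count (mem A) B)%N.
      by rewrite has_sym has_count.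
    by case/orP: c => /hC h; [apply: leq_trans h (leq_addr _ _)|apply: leq_trans h (leq_addl _ _)].
  under eq_bigr do rewrite mulrDl !mulr_suml.
  rewrite big_split /= exchange_big /= [X in _ + X]exchange_big /=.
  have h1 : \sum_(x <- e.1) \sum_(e' <- bad_events) (x \in e'.1)%:R * prob Y R e' <= 1 / 8.
    rewrite big_seq; apply: le_trans (_ : \sum_(x <- e.1) (K%:R * psi) <= _).
      by rewrite [leRHS]big_seq; apply: ler_sum => x xe; apply/prob_sum_pos/(allP a1).
    rewrite big_const_seq count_predT iter_addr_0 -[leLHS]mulr_natl.
    apply: le_trans psi_small; rewrite -mulrA ler_wpM2r ?mulr_ge0 ?ler0n //.
    by rewrite ler_nat.
  have h2 : \sum_(y <- e.2) \sum_(e' <- bad_events) (y \in e'.2)%:R * prob Y R e' <= 1 / 8.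
    have k0 : 0 < k%:R :> R.
      rewrite ltr0n (leq_trans _ sze) //; have := eE => /bad_eventsP[w [_ fw -> _ _]].
      by rewrite lt0n size_eq0.
    rewrite big_seq; apply: le_trans (_ : \sum_(y <- e.2) (1 / 8 / k%:R) <= _).
      rewrite [leRHS]big_seq; apply: ler_sum => y ye.
      by rewrite ler_pdivlMr // mulrC; apply/prob_sum_val/(allP a2).
    rewrite big_const_seq count_predT iter_addr_0 -[leLHS]mulr_natl -s12.
    apply: le_trans (_ : k%:R * (1 / 8 / k%:R) <= _); last by rewrite mulrC divfK ?gt_eqF.
    by rewrite ler_wpM2r ?ler_nat // !divr_ge0 ?ler0n.
  lra.
rewrite inE => /andP[Ys /allP av]; exists s; split=> // w wW.
have pw : perm_eq w (fixed_part w ++ free_part w).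
  by rewrite perm_sym perm_catC perm_filterC.
have fixE : map s (fixed_part w) = fixed_part w.
  rewrite -[RHS]map_id; apply/eq_in_map => x; rewrite mem_filter => /andP[xY _].
  exact: out_perm xY.
rewrite (good_perm (perm_map s pw)) map_cat fixE.
have [f0|fw] := eqVneq (free_part w) [::].
  rewrite f0 cats0; have := good_fixed wW f0.
  by rewrite (good_perm pw) f0 cats0.
apply/negPn/negP => ng.
have: (free_part w, map s (free_part w)) \in bad_events.
  apply/bad_eventsP; exists w; split=> //=.
    rewrite size_map eqxx all_map; apply/allP => x.
    by rewrite mem_filter => /andP[/= xY _]; rewrite perm_closed.
  by rewrite map_inj_uniq ?filter_uniq ?(allP uW) //; apply: perm_inj.
by move=> /av; rewrite /holds /= eqxx.
Qed.

End FillWindows.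

(** * Templates for the cyclic ordering *)

Section Template.
Variables (V : finType) (k d s : nat).
Hypotheses (k_lo : (s.-1 * d < k)%N) (k_hi : (k < s * d)%N).
Local Open Scope nat_scope.
Implicit Types (T X : seq (option V)) (w c : seq V) (a : V).

(** In a template [Some a] is a vertex fixed in advance and [None] a position filled at random.
    Since (s-1)d < k < sd, the s windows starting in [Full] all contain offset (s-1)d, and the s-1
    windows starting in [Short] all contain offset (s-1)d - 1. The core c of a gadget has length
    (h-1)d + k and carries h windows of its own; the s windows before them contain a, the s after
    them a'. A gadget thus spends a and a' on 2s + h windows. *)
Inductive segment := Full of V | Short of V | Gadget of nat & V & seq V & V.

Definition template (sg : segment) : seq (option V) :=
  match sg with
  | Full a => nseq (s.-1 * d) None ++ Some a :: nseq d.-1 None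
  | Short a => nseq (s.-1 * d).-1 None ++ [:: Some a]
  | Gadget h a c a' => nseq (s.-1 * d) None ++ Some a :: nseq d.-1 None ++ map Some c
      ++ nseq (s * d - k) None ++ Some a' :: nseq d.-1 None
  end.

Definition seg_len sg :=
  match sg with Full _ => s | Short _ => s.-1 | Gadget h _ _ _ => s + h + s end.

Definition seg_window sg j : seq V :=
  match sg with
  | Full a | Short a => [:: a]
  | Gadget h a c a' =>
    if j < s then a :: take (k - (s - j) * d) c
    else if j < s + h then take k (drop ((j - s) * d) c)
    else rcons (drop ((j - s) * d) c) a'
  end.

Definition seg_ok sg :=
  if sg is Gadget h _ c _ then (0 < h) && (size c == h.-1 * d + k) else true.

Let d_gt0 : 0 < d. Proof. by case: d k_hi; rewrite // muln0. Qed.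
Let short_gt0 : 1 < s -> 0 < s.-1 * d.
Proof. by move=> s1; rewrite muln_gt0 d_gt0; case: s s1 => [|[]]. Qed.

Hypothesis s_gt1 : 1 < s.

Lemma size_template sg : seg_ok sg -> size (template sg) = seg_len sg * d.
Proof.
have := (d_gt0, short_gt0 s_gt1); have := s_gt1.
case: sg => [a|a|h a c a'] /= s1 [d0 sd0] => [_|_|/andP[h0 /eqP szc]];
  do 4? rewrite ?(size_cat, size_map, size_nseq) /=.
- by rewrite prednK // -mulSnr prednK // ltnW.
- by rewrite addn1 prednK.
rewrite szc; have -> : s = s.-1.+1 by lia.
have -> : h = h.-1.+1 by lia.
move: k_hi; rewrite /=; nia.
Qed.

Lemma pmap_nseqN n : pmap id (nseq n (@None V)) = [::].
Proof. by elim: n. Qed.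

Lemma take_nseq (A : Type) n m (x : A) : take n (nseq m x) = nseq (minn n m) x.
Proof. by elim: n m => [|n IH] [|m] //=; rewrite IH minnSS. Qed.

Lemma drop_nseq (A : Type) n m (x : A) : drop n (nseq m x) = nseq (m - n) x.
Proof. by elim: n m => [|n IH] [|m] //=; rewrite IH. Qed.

Lemma drop_catE (A : Type) n (x y : seq A) : drop n (x ++ y) = drop n x ++ drop (n - size x) y.
Proof.
rewrite drop_cat; case: ltnP => h; first by rewrite (eqP (ltnW h)) drop0.
by rewrite (drop_oversize h).
Qed.

Lemma take_catE (A : Type) n (x y : seq A) : take n (x ++ y) = take n x ++ take (n - size x) y.
Proof.
rewrite take_cat; case: ltnP => h; first by rewrite (eqP (ltnW h)) take0 cats0.
by rewrite (take_oversize h).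
Qed.

Lemma pmap_take_drop1 x y a :
  pmap id (take x (drop y [:: Some a])) = if (0 < x) && (y == 0) then [:: a] else [::].
Proof. by case: y x => [|[|y]] [|[|x]]. Qed.

Lemma pmap_take_drop_some x y c : pmap id (take x (drop y (map Some c))) = take x (drop y c).
Proof. by rewrite -map_drop -map_take; elim: (take x _) => //= z t ->. Qed.

Lemma pmap_window1 i p q a : i <= p < i + k ->
  pmap id (take k (drop i (nseq p None ++ Some a :: nseq q None))) = [:: a].
Proof.
move=> /andP[ip pk]; rewrite drop_cat size_nseq.
have [ip'|pi] := ltnP i p; last first.
  have -> : i - p = 0 by lia.
  rewrite drop0; case: k pk => [|k'] pk /=; first by lia.
  by rewrite take_nseq pmap_nseqN.
rewrite drop_nseq take_cat size_nseq.
have -> : (k < p - i) = false by lia.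
rewrite pmap_cat pmap_nseqN; have : 0 < k - (p - i) by lia.
by case: (k - _) => //= m _; rewrite take_nseq pmap_nseqN.
Qed.

Lemma window_past_core x1 x2 x3 x4 x5 : k - x1 - x2 - x3 - (x4 + k - 0) - x5 = 0.
Proof. by apply/eqP; rewrite subn0 -!subnDA subn_eq0; lia. Qed.

Lemma seg_windowE sg j : seg_ok sg -> j < seg_len sg ->
  pmap id (take k (drop (j * d) (template sg ++ nseq k None))) = seg_window sg j.
Proof.
have sd : s.-1 * d = s * d - d by case: (s) s_gt1 => // s' _; rewrite mulSnr addnK.
have sd2 : d.*2 <= s * d by rewrite -mul2n leq_mul2r s_gt1 orbT.
have d0 := d_gt0; have klo := k_lo; rewrite sd in klo.
case: sg => [a|a|h a c a'] /= => [_|_|/andP[h0 /eqP szc]] jl.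
- rewrite -catA /= -nseqD pmap_window1 // sd.
  have : j.+1 * d <= s * d by rewrite leq_mul2r jl orbT.
  by rewrite mulSn; lia.
- rewrite -catA /= -[nseq k _]/(nseq k _) pmap_window1 // sd.
  have : j.+2 * d <= s * d by rewrite leq_mul2r; apply/orP; right; lia.
  by rewrite !mulSn; lia.
have hd : h.-1 * d = h * d - d by case: (h) h0 => // h' _; rewrite mulSnr addnK.
rewrite hd in szc; have hd1 : d <= h * d by rewrite leq_pmull.
have jd : j.+1 * d <= (s + h + s) * d by rewrite leq_mul2r jl orbT.
rewrite !mulnDl mulSn in jd.
rewrite -(cat1s (Some a)) -(cat1s (Some a')) -!catA !drop_catE !take_catE !pmap_cat.
rewrite !pmap_take_drop1 !pmap_take_drop_some !drop_nseq !take_nseq !pmap_nseqN.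
rewrite !cats0 /= !(size_drop, size_cat, size_nseq, size_map) /= sd szc.
case: (ltnP j s) => js.
  have jsd : j.+1 * d <= s * d by rewrite leq_mul2r js orbT.
  rewrite mulSn in jsd; rewrite mulnBl.
  have -> : (j * d - (s * d - d) == 0) = true by lia.
  have -> : 0 < k - (s * d - d - j * d) by lia.
  have -> : j * d - (s * d - d) - 1 - d.-1 = 0 by lia.
  rewrite drop0 /=; congr (a :: _).
  by rewrite window_past_core /= cats0 -!subnDA; congr (take (_ - _) _); lia.
have jsd : s * d <= j * d by rewrite leq_mul2r js orbT.
have -> : (j * d - (s * d - d) == 0) = false by lia.
rewrite andbF /= mulnBl.
have -> : j * d - (s * d - d) - 1 - d.-1 = j * d - s * d by lia.
have -> : s * d - d - j * d = 0 by lia.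
have -> : 1 - (j * d - (s * d - d)) = 0 by lia.
have -> : d.-1 - (j * d - (s * d - d) - 1) = 0 by lia.
rewrite !subn0.
case: (ltnP j (s + h)) => jsh.
  have jshd : j.+1 * d <= (s + h) * d by rewrite leq_mul2r jsh orbT.
  rewrite mulSn mulnDl in jshd.
  set y := (X in if (_ < X) && _ then _ else _).
  have -> : y = 0 by rewrite /y {y}; lia.
  by rewrite /= cats0.
have jshd : (s + h) * d <= j * d by rewrite leq_mul2r jsh orbT.
rewrite mulnDl in jshd.
rewrite take_oversize ?size_drop ?szc; last lia.
rewrite -cats1; congr (_ ++ _).
by rewrite ifT //; apply/andP; split; lia.
Qed.

(** A window overhangs its segment by at most k - d < (s-1)d positions, and every template begins
    with (s-1)d - 1 free positions. So it sees no fixed vertex of the next segment, and segments can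
    be concatenated in any order. *)
Lemma seg_window_cat sg j X : seg_ok sg -> j < seg_len sg ->
  take (s.-1 * d).-1 X = nseq (s.-1 * d).-1 None ->
  pmap id (take k (drop (j * d) (template sg ++ X))) = seg_window sg j.
Proof.
move=> sgo jl HX; rewrite -seg_windowE //.
have jd : j * d < size (template sg) by rewrite size_template // ltn_mul2r d_gt0.
rewrite !drop_cat jd !take_cat; case: ifP => // kz; congr (pmap id (_ ++ _)).
set m := (k - _).
have mp : m <= (s.-1 * d).-1.
  rewrite /m size_drop size_template //; have := d_gt0; have := s_gt1.
  move: k_hi jl; case: (s) => [|[|s']] //= ; nia.
rewrite take_nseq (minn_idPl (leq_subr _ _)) -[LHS](take_takel _ mp) HX take_nseq.
by rewrite (minn_idPl mp).
Qed.

Lemma template_start sg X : take (s.-1 * d).-1 (template sg ++ X) = nseq (s.-1 * d).-1 None.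
Proof.
have := short_gt0 s_gt1 => sd0.
case: sg => [a|a|h a c a'] /=; rewrite -catA takel_cat ?size_nseq ?leq_pred //;
  by rewrite take_nseq ?minnn // (minn_idPl (leq_pred _)).
Qed.

Lemma windows_template_cat segs X : all seg_ok segs ->
  take (s.-1 * d).-1 X = nseq (s.-1 * d).-1 None ->
  [seq pmap id (take k (drop (i * d) (flatten (map template segs) ++ X)))
     | i <- iota 0 (sumn (map seg_len segs))] =
  flatten [seq map (seg_window sg) (iota 0 (seg_len sg)) | sg <- segs].
Proof.
move=> + HX; elim: segs => [|sg segs IH] //= /andP[sgo aok].
rewrite iotaD map_cat; congr (_ ++ _).
  apply/eq_in_map => j; rewrite mem_iota add0n => /= jl; rewrite -catA seg_window_cat //.
  by case: (segs) => //= *; rewrite -catA template_start.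
rewrite add0n -[X in iota X _]addn0 iotaDl -map_comp -IH //; apply: eq_map => i /=.
by rewrite -catA mulnDl -size_template // addnC -drop_drop drop_size_cat.
Qed.

(** Cyclic windows become linear ones in the doubled word, so the wrap-around is one more
    concatenation. *)
Lemma take_rot_drop (A : Type) (T : seq A) i : i <= size T -> k <= size T ->
  take k (rot i T) = take k (drop i (T ++ T)).
Proof.
move=> iT kT; rewrite /rot drop_cat; case: ltnP => [iT'|Ti]; last first.
  have -> : i = size T by lia.
  by rewrite drop_size take_size subnn drop0.
rewrite !take_cat size_drop; case: ifP => // kz; congr (_ ++ _).
by rewrite take_takel //; lia.
Qed.

Lemma size_templates segs : all seg_ok segs ->
  size (flatten (map template segs)) = sumn (map seg_len segs) * d.
Proof.
rewrite size_flatten /shape -map_comp.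
elim: segs => [|sg sgs IH] //= /andP[sgo /IH ->].
by rewrite size_template // mulnDl.
Qed.

Definition seg_vertices sg :=
  match sg with Full a | Short a => [:: a] | Gadget _ a c a' => a :: rcons c a' end.

Lemma pmap_templates segs :
  pmap id (flatten (map template segs)) = flatten (map seg_vertices segs).
Proof.
elim: segs => [|sg sgs IH] //=; rewrite pmap_cat IH; congr (_ ++ _).
case: sg => [a|a|h a c a'] /=; rewrite ?(pmap_cat, pmap_nseqN) //=.
  by rewrite pmap_nseqN.
rewrite !(pmap_cat, pmap_nseqN) /= !(pmap_cat, pmap_nseqN) /=.
rewrite -cats1; congr (_ :: _ ++ _).
by elim: c => //= x c ->.
Qed.

Lemma windows_template segs : all seg_ok segs ->
  let T := flatten (map template segs) in k <= size T ->
  [seq pmap id (take k (rot (i * d) T)) | i <- iota 0 (sumn (map seg_len segs))] =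
  flatten [seq map (seg_window sg) (iota 0 (seg_len sg)) | sg <- segs].
Proof.
move=> aok T kT; rewrite -(windows_template_cat (X := T) aok); last first.
  move: kT; rewrite /T; case: (segs) => [|sg sgs] kT; last exact: template_start.
  by have := leq_ltn_trans (leq0n _) k_lo; rewrite ltnNge kT.
apply/eq_in_map => i; rewrite mem_iota => /= iL; rewrite take_rot_drop //.
by rewrite size_templates // leq_mul2r ltnW ?orbT.
Qed.

Fixpoint fill T (ys : seq V) : seq V :=
  match T with
  | [::] => [::]
  | Some a :: T' => a :: fill T' ys
  | None :: T' => if ys is y :: ys' then y :: fill T' ys' else [::]
  end.

Definition matches (Y : {set V}) (o : option V) (x : V) :=
  if o is Some a then x == a else x \in Y.

Lemma fill_matches (Y : {set V}) T ys : all (mem Y) ys ->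
  count_mem None T = size ys -> all2 (matches Y) T (fill T ys).
Proof.
elim: T ys => [|[a|] T IH] ys //= ays; first by rewrite eqxx => /(IH _ ays).
case: ys ays => [|y ys] //= /andP[-> ays] /eqP; rewrite add1n eqSS.
by move=> /eqP/(IH _ ays).
Qed.

Lemma perm_fill T ys : count_mem None T = size ys ->
  perm_eq (fill T ys) (pmap id T ++ ys).
Proof.
elim: T ys => [|[a|] T IH] ys /=.
- by move=> /esym/size0nil ->.
- by rewrite perm_cons; apply: IH.
case: ys => [|y ys] //= /eqP; rewrite add1n eqSS => /eqP /IH; rewrite -(perm_cons y) => /permPl ->.
by rewrite perm_sym perm_catC /= perm_cons perm_catC.
Qed.

Lemma all2_take (A B : Type) (r : A -> B -> bool) n x y :
  all2 r x y -> all2 r (take n x) (take n y).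
Proof. by elim: n x y => [|n IH] [|a x] [|b y] //= /andP[-> /IH]. Qed.

Lemma all2_drop (A B : Type) (r : A -> B -> bool) n x y :
  all2 r x y -> all2 r (drop n x) (drop n y).
Proof. by elim: n x y => [|n IH] [|a x] [|b y] //= /andP[_ /IH]. Qed.

Lemma all2_cat_imply (A B : Type) (r : A -> B -> bool) x y x' y' :
  all2 r x y -> all2 r x' y' -> all2 r (x ++ x') (y ++ y').
Proof. by elim: x y => [|a x IH] [|b y] //= /andP[-> xy] xy'; rewrite IH. Qed.

Lemma fixed_part_matches (Y : {set V}) T w :
  {in Y, forall y, y \notin pmap id T} -> all2 (matches Y) T w -> fixed_part Y w = pmap id T.
Proof.
elim: T w => [|[a|] T IH] [|x w] //= HY /andP[].
- move=> /eqP -> m; have -> : a \notin Y.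
    by apply/negP => /HY; rewrite /= mem_head.
  by rewrite /= (IH w) // => y /HY; rewrite inE negb_or => /andP[].
- by move=> -> m; rewrite /= (IH w).
Qed.

End Template.

(** * Hamilton cycles from windows *)

Section HamiltonOfWindows.
Local Open Scope nat_scope.
Variables (k l : nat) (V : finType) (H : kgraph k V).

Definition edge (t : seq V) := [set:: t] \in edges H.

Lemma edge_perm t t' : perm_eq t t' -> edge t = edge t'.
Proof.
move=> /perm_mem tt; rewrite /edge; have -> // : [set:: t] = [set:: t'].
by apply/setP => x; rewrite !inE tt.
Qed.

Lemma edge_uniq t : size t = k -> edge t -> uniq t.
Proof.
move=> szt /edges_card; rewrite cardsE => ct.
by apply/card_uniqP; rewrite ct szt.
Qed.

Lemma nth_rot (x0 : V) (v : seq V) i j : i <= size v -> j < size v ->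
  nth x0 (rot i v) j = nth x0 v (if i + j < size v then i + j else i + j - size v).
Proof.
move=> iv jv; rewrite /rot nth_cat size_drop nth_drop.
have -> : (j < size v - i) = (i + j < size v) by lia.
case: ifP => // h; rewrite nth_take; last by lia.
by congr nth; lia.
Qed.

Lemma hamilton_of_windows (v : seq V) m : l < k -> 0 < m ->
  perm_eq v (enum V) -> size v = m * (k - l) -> k.*2 <= size v ->
  (forall i, i < m -> edge (take k (rot (i * (k - l)) v))) ->
  has_hamilton_lcycle l H.
Proof.
set d := k - l => lk m0 pv szv kv Hw.
have d0 : 0 < d by rewrite subn_gt0.
pose p := [seq i * d | i <- iota 0 m].
pose E := [set:: [seq window k v i | i <- p]].
have EH e : e \in E -> e \in edges H.
  rewrite inE => /mapP[i /mapP[j]]; rewrite mem_iota => /= jm -> ->.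
  exact: Hw.
have Ek e : e \in E -> #|e| = k by move=> /EH /edges_card.
have uv : uniq v by rewrite (perm_uniq pv) enum_uniq.
have inter i : i < m ->
  #|window k v (i * d) :&: window k v ((i.+1 %% m) * d)| = l.
  move=> im; set u := rot (i * d) v.
  have uu : uniq u by rewrite rot_uniq.
  have szu : size u = m * d by rewrite size_rot.
  have rotE : rot (i.+1 %% m * d) v = rot d u.
    rewrite /u -rotD -?mulSn ?szv ?leq_mul2r ?im ?orbT //.
    have [im1|mi] := ltnP i.+1 m; first by rewrite modn_small.
    have -> : i.+1 = m by lia.
    by rewrite modnn mul0n rot0 -szv rot_size.
  have dk : d <= k by rewrite leq_subr.
  have -> : window k v (i.+1 %% m * d) = [set:: take k (drop d u)].
    rewrite /window rotE /rot takel_cat // size_drop szu -szv; lia.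
  (* As k + d is at most the length of v, the two windows do not meet again around the cycle: only
     the overlap of k - d = l positions is common. *)
  have -> : window k v (i * d) :&: [set:: take k (drop d u)] = [set:: take l (drop d u)].
    have lE : l = k - d by rewrite /d subKn // ltnW.
    rewrite /window -/u; apply/setP => x; rewrite !inE.
    have -> : take k u = take d u ++ take l (drop d u).
      by rewrite lE -[X in take X u](subnK dk) addnC takeD.
    have -> : take k (drop d u) = take l (drop d u) ++ take d (drop l (drop d u)).
      by rewrite lE -[X in take X (drop d u)](subnK dk) takeD.
    rewrite !mem_cat; case xl: (x \in take l (drop d u)); rewrite /= ?orbT ?orbF //.
    apply/negP => /andP[x1 x2].
    have : x \in drop d u by rewrite (mem_drop (mem_take x2)).
    move: uu; rewrite -{1}[u](cat_take_drop d) cat_uniq => /and3P[_ /hasPn h _] /h.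
    by rewrite x1.
  rewrite cardsE (card_uniqP _) ?take_uniq ?drop_uniq //.
  by rewrite size_takel // size_drop szu -szv; rewrite /d in dk *; lia.
exists (KGraph Ek); split; first by apply/subsetP => e; apply: EH.
exists v, p; split=> //=.
- split.
    rewrite /p sorted_map; have sub : subrel ltn (relpre (fun i => i * d) ltn).
      by move=> i j ij /=; rewrite ltn_pmul2r.
    exact: (sub_sorted sub (iota_ltn_sorted 0 m)).
  apply/allP => _ /mapP[i im ->]; rewrite mem_iota in im.
  by rewrite szv ltn_pmul2r.
- have nthp i : i < m -> nth 0 p i = i * d by move=> im; rewrite (nth_map 0) ?size_iota ?nth_iota.
  have szp : size p = m by rewrite size_map size_iota.
  case Ep: p szp => [|x0 p'] //= szp'.
  apply/(pathP 0) => i; rewrite size_rcons => im.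
  have x0E : x0 = 0 by rewrite -[x0]/(nth 0 (x0 :: p') 0) -Ep nthp.
  have -> : nth 0 (x0 :: rcons p' x0) i = i * d.
    rewrite -rcons_cons nth_rcons /= im -Ep nthp //; lia.
  have -> : nth 0 (rcons p' x0) i = (i.+1 %% m) * d.
    rewrite nth_rcons; move: im; rewrite ltnS leq_eqVlt => /predU1P[ip|ip].
      by rewrite ip ltnn eqxx szp' modnn x0E.
    by rewrite ip -[nth _ _ _]/(nth 0 (x0 :: p') i.+1) -Ep nthp ?modn_small //; lia.
  by apply/eqP/inter; lia.
apply/setP => x; rewrite inE; apply/bigcupP.
have xv : x \in v by rewrite (perm_mem pv) mem_enum.
pose q := index x v; have qv : q < m * d by rewrite -szv index_mem.
have qm : q %/ d < m by rewrite ltn_divLR.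
(* The last window starting at or before x, where x has offset q mod d < d <= k. *)
exists (window k v (q %/ d * d)).
  by rewrite inE; apply/mapP; exists (q %/ d * d) => //; apply: map_f; rewrite mem_iota.
rewrite inE; have := divn_eq q d; have := ltn_pmod q d0 => r0 qE.
have -> : x = nth x (take k (rot (q %/ d * d) v)) (q %% d).
  rewrite nth_take; last by rewrite /d in r0 *; lia.
  rewrite nth_rot ?szv; [|lia|lia].
  by rewrite -qE qv nth_index.
apply: mem_nth; rewrite size_take size_rot szv.
by case: ifP => _; rewrite /d in r0 * ; lia.
Qed.

(** The offset of x inside a window determines the window, and there are k offsets. *)
Lemma windows_cover (v : seq V) m d x : uniq v -> size v = m * d -> 0 < d ->
  count (fun w => x \in w) [seq take k (rot (i * d) v) | i <- iota 0 m] <= k.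
Proof.
move=> uv szv d0; rewrite count_map -size_filter.
rewrite -(size_map (fun i => index x (rot (i * d) v))) -[leqRHS](size_iota 0).
apply: uniq_leq_size => [|_ /mapP[i im ->]]; last first.
  move: im; rewrite mem_filter mem_iota /= => /andP[xi _].
  rewrite mem_iota /= add0n -[rot _ _](cat_take_drop k) index_cat xi.
  by apply: leq_trans (_ : size (take k (rot (i * d) v)) <= _); rewrite ?index_mem // size_take_min geq_minl.
rewrite map_inj_in_uniq ?filter_uniq ?iota_uniq // => i j.
rewrite !mem_filter !mem_iota /= => /andP[xi im] /andP[xj jm] E.
have xv : x \in v by have := mem_take xi; rewrite mem_rot.
have lt t : index x (rot t v) < size v by rewrite -(size_rot t v) index_mem mem_rot.
have id' t : t < m -> t * d <= size v by move=> tm; rewrite szv leq_mul2r ltnW ?orbT.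
set q := index x (rot (i * d) v) in E.
have e1 : nth x (rot (i * d) v) q = x by apply: nth_index (mem_take xi).
have e2 : nth x (rot (j * d) v) q = x by rewrite E; apply: nth_index (mem_take xj).
have : nth x (rot (i * d) v) q == nth x (rot (j * d) v) q by rewrite e1 e2.
rewrite !nth_rot ?id' ?lt //.
have := lt (i * d); rewrite szv -/q => lti.
have id2 : i * d < m * d by rewrite ltn_pmul2r.
have jd2 : j * d < m * d by rewrite ltn_pmul2r.
rewrite nth_uniq ?szv //; [|case: ifP; lia|case: ifP; lia].
move=> /eqP e; apply/eqP; rewrite -(eqn_pmul2r d0); apply/eqP.
by move: e; case: ifP; case: ifP; lia.
Qed.

End HamiltonOfWindows.

(** * Typical sets *)

Section Typicality.
Variables (R : realFieldType) (k : nat) (V : finType) (H : kgraph k V).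
Variables (A1 B1 : {set V}).
Local Notation edge := (edge H).
Local Notation n := (#|V|%:R : R).
Implicit Types (a v : V) (w t : seq V).

(** Completions with repeated vertices count as missing too, at a cost of lower order. *)
Definition miss a w : R := cnt R B1 (k.-1 - size w) (fun t => ~~ edge (a :: w ++ t)).
Definition tot_miss w : R := \sum_(a in A1) miss a w.

Lemma miss_ge0 a w : 0 <= miss a w. Proof. exact: cnt_ge0. Qed.
Lemma miss_perm a w w' : perm_eq w w' -> miss a w = miss a w'.
Proof.
move=> ww'; rewrite /miss (perm_size ww'); apply: eq_cnt => t _ _.
by congr negb; apply: edge_perm; rewrite perm_cons perm_cat2r.
Qed.

Lemma sum_miss_cat a w i : (size w + i <= k.-1)%N ->
  \sum_(u <- seqs B1 i) miss a (w ++ u) = miss a w.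
Proof.
move=> wi; rewrite /miss; have -> : (k.-1 - size w = i + (k.-1 - (size w + i)))%N by lia.
rewrite cnt_cat !big_seq; apply: eq_bigr => u; rewrite mem_seqs => /andP[/eqP szu _].
by rewrite size_cat szu; apply: eq_cnt => t _ _; rewrite catA.
Qed.

Let n_ge0 : 0 <= n. Proof. exact: ler0n. Qed.
Let pow_ge0 j : 0 <= n ^+ j. Proof. exact/exprn_ge0/n_ge0. Qed.

Lemma sum_const_le (j : nat) (c : R) (U : {set V}) : 0 <= c ->
  \sum_(t <- seqs U j) c <= n ^+ j * c.
Proof.
move=> c0; rewrite big_const_seq count_predT size_seqs iter_addr_0 -[leLHS]mulr_natl.
rewrite ler_wpM2r // natrX lerXn2r ?nnegrE ?ler0n // ler_nat; exact: max_card.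
Qed.

Lemma sum_seqs_sub (F : seq V -> R) (U U' : {set V}) j :
  (forall t, 0 <= F t) -> U \subset U' ->
  \sum_(t <- seqs U j) F t <= \sum_(t <- seqs U' j) F t.
Proof.
move=> F0 sU; elim: j F F0 => [|j IH] F F0; first by rewrite !sum_seqs0.
rewrite !sum_seqsS [leRHS](big_setID U) /= (setIidPr sU) -[leLHS]addr0.
apply: lerD; first by apply: ler_sum => x _; apply: IH.
by apply: sumr_ge0 => x _; apply: sumr_ge0.
Qed.

Definition atypical (phi : R) a w := (phi * n ^+ (k.-1 - size w) < miss a w)%R.

Hypotheses (V_gt0 : (0 < #|V|)%N) (k_gt0 : (0 < k)%N).

Let n_gt0 : 0 < n. Proof. by rewrite ltr0n. Qed.

(** Markov's inequality at level phi, after [sum_miss_cat] has split the completions of w at length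
    i. *)
Lemma atypical_few w i (phi rho : R) : (size w + i <= k.-1)%N -> 0 < phi ->
  tot_miss w <= rho * n ^+ (k - size w) ->
  \sum_(a in A1) \sum_(u <- seqs B1 i) (atypical phi a (w ++ u))%:R
    <= rho / phi * n ^+ i.+1.
Proof.
move=> wi phi0 Hw; set e := (k.-1 - (size w + i))%N.
have M0 : 0 < phi * n ^+ e by rewrite mulr_gt0 ?exprn_gt0 ?n_gt0.
rewrite -(ler_pM2r M0); apply: le_trans (_ : tot_miss w <= _).
  rewrite mulr_suml; apply: ler_sum => a _; rewrite -(sum_miss_cat a wi).
  apply: le_trans (markov _ (phi * n ^+ e) (fun u => miss_ge0 a (w ++ u))).
  rewrite (ler_wpM2r (ltW M0)) // !big_seq; apply: ler_sum => u; rewrite mem_seqs => /andP[/eqP szu _].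
  by rewrite /atypical size_cat szu.
apply: (le_trans Hw); have -> : (k - size w = i.+1 + e)%N by rewrite /e; lia.
by rewrite exprD mulrACA divfK ?gt_eqF // mulrA.
Qed.

Lemma atypical_prefix w i M (phi rho : R) (A U : {set V}) :
  (i <= M)%N -> (size w + i <= k.-1)%N -> 0 < phi -> A \subset A1 -> U \subset B1 ->
  tot_miss w <= rho * n ^+ (k - size w) ->
  \sum_(a in A) \sum_(t <- seqs U M) (atypical phi a (w ++ take i t))%:R
  <= rho / phi * n ^+ M.+1.
Proof.
move=> iM wi phi0 AA UB Hw; have hf := atypical_few wi phi0 Hw.
apply: le_trans (_ : n ^+ (M - i) * (rho / phi * n ^+ i.+1) <= _); last first.
  by rewrite mulrCA -exprD addnS subnK.
apply: le_trans (ler_wpM2l (pow_ge0 _) hf); rewrite mulr_sumr.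
rewrite [leRHS](big_setID A) /= (setIidPr AA) -[leLHS]addr0.
apply: lerD; last first.
  by apply: sumr_ge0 => a _; rewrite mulr_ge0 ?pow_ge0 ?sumr_ge0 // => *; apply: ler0n.
apply: ler_sum => a _; apply: le_trans (sum_seqs_sub _ _ UB) _ => [t|]; first exact: ler0n.
have {1}-> : (M = i + (M - i))%N by lia.
rewrite sum_seqs_cat mulr_sumr !big_seq; apply: ler_sum => u; rewrite mem_seqs => /andP[/eqP szu _].
under eq_bigr do rewrite take_size_cat //.
by apply: sum_const_le; apply: ler0n.
Qed.

Lemma atypical_suffix w i M (phi rho : R) (A U : {set V}) :
  (i <= M)%N -> (size w + (M - i) <= k.-1)%N -> 0 < phi -> A \subset A1 -> U \subset B1 ->
  tot_miss w <= rho * n ^+ (k - size w) ->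
  \sum_(a in A) \sum_(t <- seqs U M) (atypical phi a (w ++ drop i t))%:R
  <= rho / phi * n ^+ M.+1.
Proof.
move=> iM wi phi0 AA UB Hw; have hf := atypical_few wi phi0 Hw.
apply: le_trans (_ : n ^+ i * (rho / phi * n ^+ (M - i).+1) <= _); last first.
  by rewrite mulrCA -exprD addnS subnKC.
apply: le_trans (ler_wpM2l (pow_ge0 _) hf); rewrite mulr_sumr.
rewrite [leRHS](big_setID A) /= (setIidPr AA) -[leLHS]addr0.
apply: lerD; last first.
  by apply: sumr_ge0 => a _; rewrite mulr_ge0 ?pow_ge0 ?sumr_ge0 // => *; apply: ler0n.
apply: ler_sum => a _; apply: le_trans (sum_seqs_sub _ _ UB) _ => [t|]; first exact: ler0n.
have {1}-> : (M = i + (M - i))%N by lia.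
rewrite sum_seqs_cat; apply: le_trans (_ : \sum_(u <- seqs B1 i)
   \sum_(t <- seqs B1 (M - i)) (atypical phi a (w ++ t))%:R <= _).
  rewrite big_seq [leRHS]big_seq; apply: ler_sum => u; rewrite mem_seqs => /andP[/eqP szu _].
  by apply: ler_sum => t _; rewrite drop_size_cat.
by apply: sum_const_le; apply: sumr_ge0 => *; apply: ler0n.
Qed.

Lemma sum_seq_le (I : eqType) (r : seq I) (F : I -> R) (C : R) :
  {in r, forall i, F i <= C} -> \sum_(i <- r) F i <= (size r)%:R * C.
Proof.
move=> FC; apply: le_trans (_ : \sum_(i <- r) C <= _).
  by rewrite big_seq [leRHS]big_seq; apply: ler_sum.
by rewrite big_const_seq count_predT iter_addr_0 [leRHS]mulr_natl.
Qed.

Lemma sum_set_le (A : {set V}) (F : V -> R) (C : R) : 0 <= C ->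
  {in A, forall i, F i <= C} -> \sum_(i in A) F i <= n * C.
Proof.
move=> C0 FC; apply: le_trans (_ : \sum_(i in A) C <= _); first exact: ler_sum.
by rewrite sumr_const -[leLHS]mulr_natl ler_wpM2r // ler_nat max_card.
Qed.

Lemma has_sum_gt0 (I : Type) (p : pred I) (r : seq I) :
  has p r -> (0 < \sum_(i <- r) (p i : nat))%N.
Proof.
elim: r => //= i r IH; by rewrite big_cons; case: (p i).
Qed.

(** Triples (a, a', T) are counted. At least (al - gam)^2 (c - M gam) n^(M+2) of them avoid Q and
    satisfy P; the coincidence a = a' spoils at most gam0 n^(M+2), and each typicality requirement
    at most (rho / phi) n^(M+2). The lists cs and cs' record, for each window beside the core, the
    prescribed vertices w it sees and where it cuts T. *)
Lemma choose_gadget M (P : pred (seq V)) (A2 Q : {set V})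
    (cs cs' : seq (seq V * nat)) (al c phi rho gam gam0 : R) :
  A2 \subset A1 -> c * n ^+ M <= cnt R B1 M P ->
  (forall w i, (w, i) \in cs -> [/\ (i <= M)%N, (size w + i <= k.-1)%N &
      tot_miss w <= rho * n ^+ (k - size w)]) ->
  (forall w i, (w, i) \in cs' -> [/\ (i <= M)%N, (size w + (M - i) <= k.-1)%N &
      tot_miss w <= rho * n ^+ (k - size w)]) ->
  #|Q|%:R <= gam * n -> al * n <= #|A2|%:R -> 1 <= gam0 * n ->
  0 < phi -> 0 <= rho -> gam <= al -> M%:R * gam <= c ->
  gam0 + (size cs + size cs')%:R * (rho / phi) < (al - gam) ^+ 2 * (c - M%:R * gam) ->
  exists T a a', [/\ size T = M /\ P T, all (mem (B1 :\: Q)) T,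
    [/\ a \in A2 :\: Q, a' \in A2 :\: Q & a != a'],
    forall w i, (w, i) \in cs -> ~~ atypical phi a (w ++ take i T) &
    forall w i, (w, i) \in cs' -> ~~ atypical phi a' (w ++ drop i T)].
Proof.
move=> A21 HP Hcs Hcs' HQ HA2 Hg0 phi0 rho0 gal gc Hineq.
set A3 := A2 :\: Q; set B := B1 :\: Q.
have A31 : A3 \subset A1 by apply: subset_trans A21; apply: subsetDl.
have BB1 : B \subset B1 by apply: subsetDl.
pose bad a a' T := (a == a') || has (fun q => atypical phi a (q.1 ++ take q.2 T)) cs
   || has (fun q => atypical phi a' (q.1 ++ drop q.2 T)) cs'.
have [/existsP[a /existsP[a' /andP[aA /andP[a'A /hasP[T TB /andP[PT nb]]]]]]|] :=
  boolP [exists a, exists a', (a \in A3) && ((a' \in A3) && has (fun T => P T && ~~ bad a a' T) (seqs B M))].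
  move: nb; rewrite !negb_or -andbA => /and3P[aa' /hasPn n1 /hasPn n2].
  move: TB; rewrite mem_seqs => /andP[/eqP szT TB].
  exists T, a, a'; split=> // w i.
    by move=> /n1.
  by move=> /n2.
move=> /existsPn nex; exfalso.
have A3n : (al - gam) * n <= #|A3|%:R.
  have : (#|A2| <= #|A2 :\: Q| + #|Q|)%N.
    apply: leq_trans (leq_card_setU _ _); apply/subset_leq_card/subsetP => x xA.
    by rewrite !inE xA; case: (x \in Q).
  by rewrite -(ler_nat R) natrD -/A3 => h; lra.
have Bn : (c - M%:R * gam) * n ^+ M <= cnt R B M P.
  have := @cnt_almost_sub R V B1 B M P #|V| gam (max_card _).
  have h : (B1 :\: B) \subset Q.
    by apply/subsetP => x; rewrite !inE; case: (x \in Q) => //=; case: (x \in B1).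
  have := subset_leq_card h; rewrite -(ler_nat R) => h1 /(_ (le_trans h1 HQ)); lra.
have low : (al - gam) ^+ 2 * (c - M%:R * gam) * n ^+ M.+2 <=
   \sum_(a in A3) \sum_(a' in A3) cnt R B M P.
  rewrite !sumr_const -mulrnA -[leRHS]mulr_natl natrM.
  have -> : (al - gam) ^+ 2 * (c - M%:R * gam) * n ^+ M.+2 =
    ((al - gam) * n * ((al - gam) * n)) * ((c - M%:R * gam) * n ^+ M) by rewrite !exprS; ring.
  have a0 : 0 <= (al - gam) * n by rewrite mulr_ge0 ?n_ge0 // subr_ge0.
  by apply: ler_pM => //; rewrite ?mulr_ge0 ?pow_ge0 ?subr_ge0 // ler_pM.
have up : \sum_(a in A3) \sum_(a' in A3) cnt R B M P <=
   \sum_(a in A3) \sum_(a' in A3) \sum_(T <- seqs B M) ((a == a')%:R +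
     \sum_(q <- cs) (atypical phi a (q.1 ++ take q.2 T))%:R +
     \sum_(q <- cs') (atypical phi a' (q.1 ++ drop q.2 T))%:R).
  apply: ler_sum => a aA; apply: ler_sum => a' a'A; rewrite /cnt !big_seq.
  apply: ler_sum => T TB; rewrite -!natr_sum -!natrD ler_nat.
  case PT : (P T) => //; have := nex a; rewrite negb_exists => /forallP/(_ a').
  rewrite aA a'A /= => /hasPn/(_ T TB); rewrite PT negbK /= /bad.
  case/orP => [/orP[->|/has_sum_gt0 h]|/has_sum_gt0 h]; rewrite -?addnA //.
    by apply: leq_trans h _; rewrite addnCA leq_addr.
  by apply: leq_trans h _; rewrite addnA leq_addl.
have bnd_ge0 (r : seq (seq V * nat)) : 0 <= (size r)%:R * (rho / phi * n ^+ M.+1).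
  by rewrite !mulr_ge0 ?pow_ge0 ?ler0n ?invr_ge0 ?(ltW phi0).
have up1 : \sum_(a in A3) \sum_(a' in A3) \sum_(T <- seqs B M) (a == a')%:R
   <= gam0 * n ^+ M.+2.
  have -> : gam0 * n ^+ M.+2 = gam0 * n * (n * n ^+ M) by rewrite !exprS; ring.
  apply: le_trans (_ : n * n ^+ M <= _); last first.
    by rewrite ler_peMl // mulr_ge0 ?n_ge0 ?pow_ge0.
  apply: sum_set_le (pow_ge0 _) _ => a aA; rewrite (bigD1 a) //= [X in _ + X]big1.
    by rewrite addr0 eqxx -[leRHS]mulr1 sum_const_le.
  by move=> a' /andP[_ /negbTE]; rewrite eq_sym => ->; rewrite big1.
have up2 : \sum_(a in A3) \sum_(a' in A3) \sum_(T <- seqs B M)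
   \sum_(q <- cs) (atypical phi a (q.1 ++ take q.2 T))%:R <=
   (size cs)%:R * (rho / phi) * n ^+ M.+2.
  rewrite exchange_big /=.
  have -> : (size cs)%:R * (rho / phi) * n ^+ M.+2 =
    n * ((size cs)%:R * (rho / phi * n ^+ M.+1)) by rewrite [n ^+ M.+2]exprS; ring.
  apply: sum_set_le => [|a' _]; first exact: bnd_ge0.
  under eq_bigr do rewrite exchange_big /=.
  rewrite exchange_big /=; apply: sum_seq_le => -[w i] /Hcs[iM wi Hw].
  exact: atypical_prefix.
have up3 : \sum_(a in A3) \sum_(a' in A3) \sum_(T <- seqs B M)
   \sum_(q <- cs') (atypical phi a' (q.1 ++ drop q.2 T))%:R <=
   (size cs')%:R * (rho / phi) * n ^+ M.+2.
  have -> : (size cs')%:R * (rho / phi) * n ^+ M.+2 =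
    n * ((size cs')%:R * (rho / phi * n ^+ M.+1)) by rewrite [n ^+ M.+2]exprS; ring.
  apply: sum_set_le => [|a _]; first exact: bnd_ge0.
  under eq_bigr do rewrite exchange_big /=.
  rewrite exchange_big /=; apply: sum_seq_le => -[w i] /Hcs'[iM wi Hw].
  exact: atypical_suffix.
have np : 0 < n ^+ M.+2 by rewrite exprn_gt0 ?n_gt0.
move: Hineq; rewrite -(ltr_pM2r np) natrD => Hineq.
move: up; under [leRHS]eq_bigr do under eq_bigr do rewrite !big_split /=.
under [leRHS]eq_bigr do rewrite !big_split /=.
rewrite !big_split /= => up.
lra.
Qed.

End Typicality.

(** * Tight walks *)

Section TightWalks.
Variables (R : realFieldType) (V : finType) (U : {set V}) (L : pred (seq V)) (q : nat).
Local Notation n := (#|V|%:R : R).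
Hypothesis L_perm : forall t t', perm_eq t t' -> L t = L t'.
Implicit Types (u t : seq V).

(** New vertices are prepended and u holds the q latest ones, so [catrev t u] lists the walk with
    its latest vertex first. *)
Fixpoint walk u t : bool :=
  if t is b :: t' then L (b :: u) && walk (take q (b :: u)) t' else true.

Lemma walk_window u z t j : size u = q -> walk u t -> (j < size t)%N ->
  L (take q.+1 (drop j (catrev t (u ++ z)))).
Proof.
elim: t u z j => [|b t IH] u z j //= szu /andP[Lbu wt] jt.
have [jt'|tj] := ltnP j (size t).
  have := IH (take q (b :: u)) (drop q (b :: u) ++ z) j; rewrite catA cat_take_drop.
  by apply=> //; rewrite size_takel //= szu.
have -> : j = size t by apply/eqP; rewrite eqn_leq tj -ltnS jt.
by rewrite catrevE -(size_rev t) drop_size_cat //= -szu take_size_cat.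
Qed.

Let W i u : R := cnt R U i (walk u).

Lemma cnt_walkS i u : W i.+1 u = \sum_(b in U) (L (b :: u))%:R * W i (take q (b :: u)).
Proof.
rewrite /W cntS; apply: eq_bigr => b _ /=; case: (L _); first by rewrite mul1r.
by rewrite mul0r /cnt big1.
Qed.

Variable (c : R).
Hypothesis c_ge0 : 0 <= c.
Let rich i u := (c * n) ^+ i <= W i u.

Let cn_ge0 : 0 <= c * n. Proof. by rewrite mulr_ge0 ?ler0n. Qed.

Lemma poor_step i u : ~~ rich i.+1 u ->
  \sum_(b in U) (L (b :: u))%:R <=
  c * n + \sum_(b in U) (L (b :: u) && ~~ rich i (take q (b :: u)))%:R.
Proof.
rewrite /rich -ltNge cnt_walkS => poor.
have h : (\sum_(b in U) (L (b :: u) && rich i (take q (b :: u)))%:R) * (c * n) ^+ i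
   <= \sum_(b in U) (L (b :: u))%:R * W i (take q (b :: u)).
  rewrite mulr_suml; apply: ler_sum => b _; case: (L _); rewrite ?mul0r //= mul1r.
  by case h : (rich i _); rewrite ?mul1r // mul0r cnt_ge0.
have := le_lt_trans h poor; rewrite exprS => h1.
have h2 : \sum_(b in U) (L (b :: u) && rich i (take q (b :: u)))%:R <= c * n.
  case: (ltP 0 ((c * n) ^+ i)) => p0; first by apply: ltW; rewrite -(ltr_pM2r p0).
  have z : (c * n) ^+ i = 0 by apply/le_anti; rewrite p0 exprn_ge0.
  by move: h1; rewrite z !mulr0 ltxx.
rewrite -(lerD2r (\sum_(b in U) (L (b :: u) && ~~ rich i (take q (b :: u)))%:R)) in h2.
apply: le_trans h2; rewrite -big_split /=.
apply: ler_sum => b _; rewrite -natrD ler_nat.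
by case: (L _) => //=; case: (rich _ _).
Qed.

Let poor_arcs i := \sum_(u <- seqs U q) \sum_(b in U) (L (b :: u) && ~~ rich i u)%:R : R.

(** A state poor for i + 1 steps has at most cn arcs into states rich for i, since each of these
    would contribute (cn)^i walks. Its other arcs enter states poor for i, and these are counted by
    induction. *)
Lemma poor_arcs_few i : poor_arcs i <= i%:R * c * n ^+ q.+1.
Proof.
elim: i => [|i IH].
  rewrite !mul0r /poor_arcs big1 // => u _; rewrite big1 // => b _.
  by rewrite /rich /W cnt0 expr0 lexx andbF.
have -> : i.+1%:R * c * n ^+ q.+1 = n ^+ q * (c * n) + i%:R * c * n ^+ q.+1.
  by rewrite -[i.+1%:R]natr1 exprS; ring.
(* Moving the last vertex to the front turns an arc entering a poor state into an arc leaving it,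
   and L is symmetric. *)
have E : \sum_(u <- seqs U q) \sum_(b in U) (L (b :: u) && ~~ rich i (take q (b :: u)))%:R
    = poor_arcs i.
  rewrite exchange_big /= -(sum_seqsS U q (fun t => (L t && ~~ rich i (take q t))%:R)).
  rewrite -addn1 sum_seqs_cat /poor_arcs !big_seq; apply: eq_bigr => u.
  rewrite mem_seqs => /andP[/eqP szu _]; rewrite sum_seqsS; apply: eq_bigr => b _.
  rewrite sum_seqs0 take_size_cat // (L_perm (t' := b :: u)) //.
  by rewrite perm_catC.
rewrite -(lerD2l (n ^+ q * (c * n))) in IH; apply: le_trans IH; rewrite -E.
apply: le_trans (_ : \sum_(u <- seqs U q) (c * n +
   \sum_(b in U) (L (b :: u) && ~~ rich i (take q (b :: u)))%:R) <= _).
  apply: ler_sum => u _; have [r|r] := boolP (rich i.+1 u).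
    rewrite big1 => [|b _]; last by rewrite andbF.
    by rewrite addr_ge0 ?sumr_ge0 // => *; apply: ler0n.
  by under eq_bigr do rewrite andbT; apply: poor_step.
rewrite big_split /= lerD2r big_const_seq count_predT size_seqs iter_addr_0.
rewrite -[leLHS]mulr_natl natrX ler_wpM2r //.
by rewrite lerXn2r ?nnegrE ?ler0n ?ler_nat ?max_card.
Qed.

Lemma walks_many i (eta : R) : (0 < #|V|)%N ->
  eta * n ^+ q.+1 <= cnt R U q.+1 L ->
  (eta - i%:R * c) * c ^+ i * n ^+ (q + i) <= \sum_(u <- seqs U q) W i u.
Proof.
move=> V0 HL; have n0 : 0 < n by rewrite ltr0n.
have h1 : (eta - i%:R * c) * n ^+ q <= \sum_(u <- seqs U q) (rich i u)%:R.
  rewrite -(ler_pM2r n0) -mulrA -exprSr mulrBl.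
  apply: le_trans (lerB HL (poor_arcs_few i)) _.
  rewrite /cnt sum_seqsS exchange_big /= /poor_arcs -sumrB mulr_suml.
  apply: ler_sum => u _; rewrite -sumrB.
  apply: le_trans (_ : \sum_(b in U) (rich i u)%:R <= _).
    apply: ler_sum => b _; rewrite lerBlDr -natrD ler_nat.
    by case: (L _); case: (rich i u).
  by rewrite sumr_const -[leLHS]mulr_natr ler_wpM2l ?ler0n ?ler_nat ?max_card.
have -> : (eta - i%:R * c) * c ^+ i * n ^+ (q + i) =
   (eta - i%:R * c) * n ^+ q * (c * n) ^+ i by rewrite exprMn exprD; ring.
apply: le_trans (ler_wpM2r (exprn_ge0 i cn_ge0) h1) _.
rewrite mulr_suml; apply: ler_sum => u _.
by case h : (rich i u); rewrite ?mul1r ?mul0r // cnt_ge0.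
Qed.

Lemma tight_walks_many i (eta : R) : (0 < #|V|)%N ->
  eta * n ^+ q.+1 <= cnt R U q.+1 L ->
  (eta - i%:R * c) * c ^+ i * n ^+ (i + q) <=
  cnt R U (i + q) (fun T => all (fun j => L (take q.+1 (drop j T))) (iota 0 i)).
Proof.
move=> V0 /(walks_many i V0); rewrite addnC => /le_trans; apply.
pose P T := all (fun j => L (take q.+1 (drop j T))) (iota 0 i).
rewrite cnt_cat -/P.
have -> : \sum_(t <- seqs U i) cnt R U q (fun u => P (t ++ u)) =
          \sum_(t <- seqs U i) cnt R U q (fun u => P (rev t ++ u)).
  rewrite -[RHS](big_map rev xpredT (fun t => cnt R U q (fun u => P (t ++ u)))).
  apply/perm_big/uniq_perm; rewrite ?(map_inj_uniq (can_inj revK)) ?uniq_seqs // => t.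
  rewrite -[X in _ = (X \in _)]revK (mem_map (can_inj revK)) !mem_seqs size_rev.
  by rewrite all_rev.
rewrite [leRHS]exchange_big /= big_seq [leRHS]big_seq; apply: ler_sum => u.
rewrite mem_seqs => /andP[/eqP szu _]; rewrite -/(cnt R U i (fun t => P (rev t ++ u))).
apply: cnt_le => t szt _ wt; apply/allP => j; rewrite mem_iota add0n /= => ji.
rewrite -catrevE -[u]cats0; apply: walk_window => //; by rewrite szt.
Qed.

End TightWalks.

(** * Gadgets *)

Section Link.
Variables (R : realFieldType) (k : nat) (V : finType) (H : kgraph k V).
Variables (A1 B1 : {set V}).
Local Notation edge := (edge H).
Local Notation n := (#|V|%:R : R).
Local Notation tmiss := (tot_miss R H A1 B1).
Let pow_ge0 j : 0 <= n ^+ j. Proof. exact/exprn_ge0/ler0n. Qed.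
Variable x : R.
Hypothesis codegree : forall S, size S = k.-1 -> uniq S -> all (mem B1) S ->
  \sum_(a in A1) (~~ edge (a :: S))%:R <= x + \sum_(b in B1) (edge (b :: S))%:R.
Hypothesis x_ge0 : 0 <= x.

Lemma tot_miss_link w : uniq w -> all (mem B1) w -> (size w < k)%N ->
  tmiss w <= (x + (k ^ 2)%:R) * n ^+ (k.-1 - size w)
     + cnt R B1 (k - size w) (fun t => edge (w ++ t)).
Proof.
move=> uw aw wk; set j := (k.-1 - size w)%N.
have -> : (k - size w = j.+1)%N by rewrite /j; lia.
rewrite /tot_miss /miss -/j /cnt exchange_big /=.
have h1 : \sum_(t <- seqs B1 j) \sum_(a in A1) (~~ edge (a :: w ++ t))%:R <=
  \sum_(t <- seqs B1 j) (x + \sum_(b in B1) (edge (b :: w ++ t))%:R + n * (~~ uniq (w ++ t))%:R).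
  rewrite big_seq [leRHS]big_seq; apply: ler_sum => t; rewrite mem_seqs => /andP[/eqP szt at_].
  have [u|u] := boolP (uniq (w ++ t)).
    rewrite mulr0 addr0; apply: codegree => //; last by rewrite all_cat aw.
    by rewrite size_cat szt subnKC // -ltnS prednK // (leq_ltn_trans _ wk).
  rewrite mulr1 -[leLHS]add0r lerD //.
    by rewrite addr_ge0 ?sumr_ge0 // => *; apply: ler0n.
  rewrite -[n]mulr1; apply: sum_set_le => // a _; by case: (edge _).
apply: (le_trans h1); rewrite !big_split /=.
have h2 : \sum_(t <- seqs B1 j) x <= x * n ^+ j by rewrite mulrC; apply: sum_const_le.
have h3 : \sum_(t <- seqs B1 j) \sum_(b in B1) (edge (b :: w ++ t))%:R =
   \sum_(t <- seqs B1 j.+1) (edge (w ++ t))%:R :> R.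
  rewrite sum_seqsS exchange_big /=; apply: eq_bigr => b _; apply: eq_bigr => t _.
  by congr (nat_of_bool _)%:R; apply/edge_perm/permPl/(perm_catCA [:: b] w t).
have h4 : \sum_(t <- seqs B1 j) n * (~~ uniq (w ++ t))%:R <= (k ^ 2)%:R * n ^+ j.
  rewrite -mulr_sumr; apply: le_trans (cnt_not_uniq R _ (max_card _) uw) _.
  rewrite ler_wpM2r // ler_nat -mulnn leq_mul //.
    by rewrite subnKC ?leq_pred // -ltnS prednK // (leq_ltn_trans _ wk).
  by rewrite (leq_trans (leq_subr _ _)) ?leq_pred.
rewrite h3; lra.
Qed.
End Link.

Section Gadgets.
Variables (R : realFieldType) (k d s : nat) (V : finType) (H : kgraph k V).
Variables (A1 B1 : {set V}).
Hypotheses (k_lo : (s.-1 * d < k)%N) (k_hi : (k < s * d)%N) (s_gt1 : (1 < s)%N).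
Hypotheses (V_gt0 : (0 < #|V|)%N) (AB : [disjoint A1 & B1]).
Local Notation edge := (edge H).
Local Notation n := (#|V|%:R : R).
Local Notation tmiss := (tot_miss R H A1 B1).
Local Notation atyp := (@atypical R k V H B1).
Implicit Types (a v : V) (w t : seq V).

Let k_gt0 : (0 < k)%N. Proof. exact: leq_ltn_trans (leq0n _) k_lo. Qed.
Let d_gt0 : (0 < d)%N. Proof. by case: d k_hi; rewrite // muln0. Qed.
Let pow_ge0 j : 0 <= n ^+ j. Proof. exact/exprn_ge0/ler0n. Qed.

(** Windows inside the core are edges already. A window that meets the core partially is only asked
    to be typical, so that few random completions spoil it. The value i = s is left out: that window
    misses the core, and there the typicality of a or a' alone is used. *)
Definition good_gadget phi h a c a' :=
  [/\ (0 < h)%N, size c = (h.-1 * d + k)%N, uniq (a :: rcons c a'),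
   forall i, (i < h)%N -> edge (take k (drop (i * d) c)) &
   forall i, (0 < i < s)%N -> ~~ atyp phi a (take (k - i * d) c) /\
      ~~ atyp phi a' (drop ((h.-1 + i) * d) c)].

Lemma atypical_perm phi a w w' : perm_eq w w' -> atyp phi a w = atyp phi a w'.
Proof. by move=> ww'; rewrite /atypical (miss_perm R H B1 a ww') (perm_size ww'). Qed.


(** * Gadgets whose core is an edge inside B1 *)

Section EdgeGadget.
Variables (A2 Q : {set V}) (phi kap al gam gam0 : R) (eps : nat -> R).
Hypotheses (A21 : A2 \subset A1) (HQ : #|Q|%:R <= gam * n) (HA2 : al * n <= #|A2|%:R).
Hypotheses (Hg0 : 1 <= gam0 * n) (phi0 : 0 < phi) (gal : gam <= al) (kap0 : 0 <= kap).
Hypothesis codegree0 : forall S, size S = k.-1 -> uniq S -> all (mem B1) S ->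
  \sum_(a in A1) (~~ edge (a :: S))%:R <= 0 + \sum_(b in B1) (edge (b :: S))%:R :> R.
Hypotheses (eps_gt0 : forall j, 0 < eps j).
Hypothesis eps_step : forall i j, (i < j <= k)%N -> eps i <= kap * eps j.
Hypothesis eps_k : eps k <= 2.
Hypothesis eps_n : forall j, (j < k)%N -> (k ^ 2)%:R <= eps j / 2 * n.
Hypothesis link_small : forall b, b \in B1 ->
  cnt R B1 k.-1 (fun t => edge (b :: t)) < eps 1 / 2 * n ^+ k.-1.
Hypothesis gam_eps : forall j, (j <= k)%N -> k%:R * gam <= eps j / 2.
Hypothesis choice_room : forall j, (j <= k)%N ->
  gam0 + (2 * s)%:R * (kap * eps j / phi) < (al - gam) ^+ 2 * (eps j / 2 - k%:R * gam).

Lemma bad_set_link w : uniq w -> all (mem B1) w -> (size w < k)%N ->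
  eps (size w) * n ^+ (k - size w) < tmiss w ->
  eps (size w) / 2 * n ^+ (k - size w) <= cnt R B1 (k - size w) (fun t => edge (w ++ t)).
Proof.
move=> uw aw wk; have := tot_miss_link codegree0 (lexx 0) uw aw wk.
have := ler_wpM2r (pow_ge0 (k.-1 - size w)) (eps_n wk).
have -> : eps (size w) / 2 * n * n ^+ (k.-1 - size w) = eps (size w) / 2 * n ^+ (k - size w).
  by rewrite -mulrA -exprS -subSn -1?ltnS prednK.
rewrite add0r; lra.
Qed.

(* A minimal set G that is an edge or misses many edges through A1 is completed
   to an edge inside B1 in many ways; with the vertices of G at the two ends of
   the core, all the other windows see only proper, hence harmless, subsets of G. *)
Lemma edge_gadget_of_link j G : size G = j -> (0 < j <= k)%N -> uniq G ->
  all (mem (B1 :\: Q)) G ->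
  eps j / 2 * n ^+ (k - j) <= cnt R B1 (k - j) (fun t => edge (G ++ t)) ->
  exists a c a', [/\ good_gadget phi 1 a c a', all (mem (B1 :\: Q)) c,
    a \in A2 :\: Q & a' \in A2 :\: Q].
Proof.
elim: {j}_.+1 {-2}j (ltnSn j) G => // m IH j jm G szG /andP[j0 jk] uG aG HG.
have aG1 : all (mem B1) G by apply: sub_all aG => y /=; rewrite inE => /andP[].
pose bad w := uniq w && (eps (size w) * n ^+ (k - size w) < tmiss w).
(* A bad proper subset inherits the hypothesis on completions through [bad_set_link] and replaces G.
   Otherwise every nonempty proper subset misses at most [kap * eps j], a factor kap below the
   threshold of G. *)
have [/hasP[w]|nbad] := boolP (has bad (flatten [seq seqs [set y in G] i | i <- iota 1 j.-1])).
  case/flatten_mapP => i; rewrite mem_iota mem_seqs => im /andP[/eqP szw /allP aw].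
  rewrite /bad => /andP[uw bw].
  have awG y : y \in w -> y \in G by move=> /aw; rewrite /= inE.
  have im' : (i < m)%N by clear -im jm; lia.
  have ik : (0 < i <= k)%N by clear -im jk; lia.
  apply: (IH i im' w szw ik uw); first by apply/allP => y /awG /(allP aG).
  rewrite -szw; apply: bad_set_link => //; last by rewrite szw; clear -im jk; lia.
  by apply/allP => y /awG /(allP aG1).
have good w : uniq w -> {subset w <= G} -> (0 < size w < j)%N ->
    tmiss w <= kap * eps j * n ^+ (k - size w).
  move=> uw wG szw; apply: le_trans (_ : eps (size w) * n ^+ (k - size w) <= _).
    rewrite leNgt; apply: contra nbad => b; apply/hasP; exists w; last by rewrite /bad uw.
    apply/flatten_mapP; exists (size w); first by rewrite mem_iota; clear -szw; lia.
    by rewrite mem_seqs eqxx; apply/allP => y /wG; rewrite /= inE.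
  by rewrite ler_wpM2r // eps_step //; clear -szw jk; lia.
case: G szG uG aG aG1 HG good {nbad bad} => [|g G] /= szG; first by rewrite -szG in j0.
case/andP=> gG uG /andP[gB aG] /andP[gB1 aG1] HG good.
(* By [link_small] a single vertex has too few edges inside B1 to satisfy HG. So G has a vertex for
   each end of the core, and every partial window meets G in a nonempty proper subset. *)
have [j1|j1] := leqP j 1%N.
  have := link_small gB1; have j1' : j = 1%N by clear -j1 j0; lia.
  have : G = [::] by apply/size0nil; move: szG; rewrite j1' => -[].
  by move=> G0; move: HG; rewrite j1' subn1 G0 => HG /(le_lt_trans HG); rewrite ltxx.
pose pre i := (k - i * d).-1; pose suf i := (i * d).-1; pose M := (k - j)%N.
have id_lo i : (0 < i < s)%N -> (d <= i * d < k)%N.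
  move=> /andP[i0 si]; rewrite leq_pmull //= (leq_ltn_trans _ k_lo) // leq_mul2r.
  by apply/orP; right; clear -si; lia.
(* The core is g :: T ++ G. A prefix of it consists of g, a prefix of T and the part of G reached
   after T; shorter than k, it misses the end of G. The suffixes in [cs'] miss g. *)
pose cs := [seq (g :: take (pre i - M) G, minn (pre i) M) | i <- iota 1 s.-1].
pose cs' := [seq (drop (suf i - M) G, minn (suf i) M) | i <- iota 1 s.-1].
have szG' : size G = j.-1 by rewrite -szG.
have := @choose_gadget R k V H A1 B1 V_gt0 k_gt0 M (fun T => edge (g :: G ++ T)) A2 Q cs cs'
  al (eps j / 2) phi (kap * eps j) gam gam0 A21 HG _ _ HQ HA2 Hg0 phi0 _ gal.
case=> //.
- move=> w i /mapP[t]; rewrite mem_iota => tm [-> ->].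
  have td : (d <= t * d < k)%N by apply: id_lo; clear -tm; lia.
  rewrite /= size_take szG'.
  have szt : (size (take (pre t - M) G) <= pre t - M)%N by rewrite size_take_min geq_minl.
  rewrite size_take szG' in szt.
  split; rewrite ?geq_minr //.
    by case: ifP szt; rewrite /pre /M; clear -td d_gt0 jk j1; lia.
  have := good (g :: take (pre t - M) G); rewrite /= size_take szG'; apply.
  + rewrite take_uniq // andbT; apply: contra gG; exact: mem_take.
  + by move=> y; rewrite !inE => /orP[->//|/mem_take ->]; rewrite orbT.
  + by case: ifP; rewrite /pre /M; clear -td d_gt0 jk j1; lia.
- move=> w i /mapP[t]; rewrite mem_iota => tm [-> ->].
  have td : (d <= t * d < k)%N by apply: id_lo; clear -tm; lia.
  rewrite size_drop szG'.
  split; rewrite ?geq_minr //; first by rewrite /suf /M; clear -td d_gt0 jk j1; lia.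
  have := good (drop (suf t - M) G); rewrite size_drop szG'; apply.
  + exact: drop_uniq.
  + by move=> y /mem_drop yG; rewrite inE yG orbT.
  + by rewrite /suf /M; clear -td d_gt0 jk j1; lia.
- by rewrite mulr_ge0 // ltW.
- apply: le_trans (gam_eps jk); rewrite ler_wpM2r ?ler_nat ?leq_subr //.
  by have := le_trans (ler0n R #|Q|) HQ; rewrite pmulr_lge0 // ltr0n.
- rewrite !size_map !size_iota; have s2 : (s.-1 + s.-1 <= 2 * s)%N by clear; lia.
  have r0 : 0 <= kap * eps j / phi by rewrite divr_ge0 ?mulr_ge0 // ltW.
  have g0 : 0 <= gam by have := le_trans (ler0n R #|Q|) HQ; rewrite pmulr_lge0 // ltr0n.
  have h1 : (s.-1 + s.-1)%:R * (kap * eps j / phi) <= (2 * s)%:R * (kap * eps j / phi).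
    by apply: ler_wpM2r; rewrite ?ler_nat.
  have h2 : (al - gam) ^+ 2 * (eps j / 2 - k%:R * gam) <= (al - gam) ^+ 2 * (eps j / 2 - M%:R * gam).
    rewrite ler_wpM2l ?sqr_ge0 // lerD2l lerN2; apply: ler_wpM2r => //.
    by rewrite ler_nat leq_subr.
  apply: le_lt_trans (lt_le_trans (choice_room jk) h2); rewrite lerD2l; exact: h1.
move=> T [a [a' [[szT eT] aT [aA a'A aa'] Hpre Hsuf]]].
have pc : perm_eq (g :: G ++ T) (g :: T ++ G) by rewrite perm_cons perm_catC.
exists a, (g :: T ++ G), a'; split=> //=; last by rewrite gB all_cat aT aG.
have ec : edge (g :: T ++ G) by rewrite -(edge_perm H pc).
have szc : size (g :: T ++ G) = k by rewrite /= size_cat szT szG' /M; clear -jk j1; lia.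
have cB y : y \in g :: T ++ G -> y \in B1.
  by rewrite inE mem_cat => /or3P[/eqP->|/(allP aT)|/(allP aG1)] //=; rewrite inE => /andP[].
have nA y : y \in A2 :\: Q -> y \notin g :: T ++ G.
  rewrite inE => /andP[_ /(subsetP A21) yA]; apply/negP => /cB yB.
  by have := disjointFr AB yA; rewrite yB.
split=> //.
- rewrite cons_uniq mem_rcons [a \in _ :: _]inE negb_or aa' nA // rcons_uniq nA //.
  exact: edge_uniq szc ec.
- by case=> // _; rewrite mul0n drop0 take_oversize ?szc.
move=> i im; have td := id_lo i im; have im' : (1 <= i < 1 + s.-1)%N by clear -im; lia.
  rewrite add0n; split.
  rewrite (@atypical_perm _ _ _ ((g :: take (pre i - M) G) ++ take (minn (pre i) M) T)).
    by apply: Hpre; apply/mapP; exists i; rewrite ?mem_iota.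
  have -> : (k - i * d = (pre i).+1)%N by rewrite /pre; clear -td; lia.
  rewrite /= perm_cons take_catE szT -/M perm_catC perm_cat2l.
  case: leqP => // h; by rewrite !(take_oversize (s := T)) ?szT ?(ltnW h).
rewrite (@atypical_perm _ _ _ (drop (suf i - M) G ++ drop (minn (suf i) M) T)).
  by apply: Hsuf; apply/mapP; exists i; rewrite ?mem_iota.
have -> : (i * d = (suf i).+1)%N by rewrite /suf; clear -td d_gt0; lia.
rewrite /= drop_catE szT -/M perm_catC perm_cat2l.
case: leqP => // h; by rewrite !(drop_oversize (s := T)) ?szT ?(ltnW h).
Qed.

(** There are at least q cu n^(k-1) ordered edges inside B1, and the vertices of Q meet at most k N
    eta n^(k-1) of them, so some edge avoids Q. This works even for q = 1 as long as N is of order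
    q. That edge is the first G: its one completion, the empty tuple, suffices because eps k <=
    2. *)
Lemma edge_gadget (q N : nat) (eta cu : R) :
  (forall S, size S = k.-1 -> uniq S -> all (mem B1) S ->
     q%:R <= \sum_(b in B1) (edge (b :: S))%:R :> R) ->
  (forall b, b \in B1 -> cnt R B1 k.-1 (fun t => edge (b :: t)) <= eta * n ^+ k.-1) ->
  cu * n ^+ k.-1 <= cnt R B1 k.-1 (fun t => uniq t) ->
  (#|Q :&: B1| <= N)%N -> 0 <= eta -> (k * N)%:R * eta < q%:R * cu ->
  exists a c a', [/\ good_gadget phi 1 a c a', all (mem (B1 :\: Q)) c,
    a \in A2 :\: Q & a' \in A2 :\: Q].
Proof.
move=> Hq Heta Hcu HN eta0 Hlt.
suff [e eB ee] : exists2 e, e \in seqs (B1 :\: Q) k & edge e.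
  move: eB; rewrite mem_seqs => /andP[/eqP sze aQ].
  apply: (edge_gadget_of_link sze) => //; first by rewrite k_gt0 leqnn.
    exact: edge_uniq sze ee.
  by rewrite subnn cnt0 cats0 ee expr0 mulr1 ler_pdivrMr // mul1r; apply: eps_k.
apply/hasP; apply/negPn/negP => /hasPn nex.
have np : 0 < n ^+ k.-1 by rewrite exprn_gt0 // ltr0n.
have low : q%:R * (cu * n ^+ k.-1) <= cnt R B1 k edge.
  apply: le_trans (ler_wpM2l (ler0n R q) Hcu) _.
  have -> : cnt R B1 k edge = cnt R B1 k.-1.+1 edge by rewrite prednK.
  rewrite cntS /cnt exchange_big /= mulr_sumr big_seq [leRHS]big_seq.
  apply: ler_sum => t; rewrite mem_seqs => /andP[/eqP szt at_].
  have [u|u] := boolP (uniq t); first by rewrite mulr1 Hq.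
  by rewrite mulr0 sumr_ge0 // => *; apply: ler0n.
have up : cnt R B1 k edge <= \sum_(y in Q :&: B1) cnt R B1 k (fun t => (y \in t) && edge t).
  rewrite /cnt exchange_big /= big_seq [leRHS]big_seq; apply: ler_sum => t tB.
  have [et|et] := boolP (edge t); last by rewrite sumr_ge0 // => *; apply: ler0n.
  have : ~~ all (mem (B1 :\: Q)) t.
    have := contraL (nex t) et; rewrite !mem_seqs; move: tB; rewrite mem_seqs => /andP[-> _].
    by move=> ->.
  case/allPn => y yt; move: tB; rewrite mem_seqs => /andP[_ /allP aB].
  have yB : y \in B1 := aB y yt; rewrite /= inE negb_and negbK yB orbF => yQ.
  rewrite (bigD1 y) /=; last by rewrite inE yQ.
  by rewrite yt lerDl sumr_ge0 // => *; apply: ler0n.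
have up2 : \sum_(y in Q :&: B1) cnt R B1 k (fun t => (y \in t) && edge t) <=
   \sum_(y in Q :&: B1) k%:R * (eta * n ^+ k.-1).
  apply: ler_sum => y; rewrite inE => /andP[_ yB].
  have := cnt_mem R B1 k.-1 y (@edge_perm _ _ H); rewrite prednK // => h.
  by apply: le_trans h _; rewrite ler_wpM2l ?ler0n // Heta.
rewrite sumr_const -[leRHS]mulr_natl in up2.
have up3 : #|Q :&: B1|%:R * (k%:R * (eta * n ^+ k.-1)) <= (k * N)%:R * eta * n ^+ k.-1.
  rewrite natrM !mulrA ler_wpM2r ?pow_ge0 // ler_wpM2r // mulrC ler_wpM2l ?ler0n //.
  by rewrite ler_nat.
move: Hlt; rewrite -(ltr_pM2r np) => Hlt; lra.
Qed.

End EdgeGadget.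

(** * Gadgets absorbing an atypical vertex of A1 *)

Section VertexGadget.
Variables (A2 Q : {set V}) (phi al gam gam0 eta cw tau : R) (v : V).
Hypotheses (A21 : A2 \subset A1) (HQ : #|Q|%:R <= gam * n) (HA2 : al * n <= #|A2|%:R).
Hypotheses (Hg0 : 1 <= gam0 * n) (phi0 : 0 < phi) (gal : gam <= al) (tau0 : 0 <= tau).
Hypotheses (k_gt1 : (1 < k)%N) (vA : v \in A1) (vA2 : v \notin A2).
Hypothesis Hmiss : tmiss [::] <= tau * n ^+ k.
Let M := (s.-1 * d + k.-1)%N.
Hypothesis Hv : eta * n ^+ k.-1 <= cnt R B1 k.-1 (fun t => edge (v :: t)).
Hypotheses (cw0 : 0 <= cw) (cw_eta : (s.-1 * d).+1%:R * cw <= eta / 2).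
Let cT : R := eta / 2 * cw ^+ (s.-1 * d).+1 / 2.
Hypotheses (n_cT : (M ^ 2)%:R <= cT * n) (gam_cT : M%:R * gam <= cT).
Hypothesis choice_room :
  gam0 + (2 * s)%:R * (tau / phi) < (al - gam) ^+ 2 * (cT - M%:R * gam).

Let m := (s.-1 * d)%N.
(** Offset (s-1)d is where the last core window starts, and it is less than k, so all s core windows
    contain v. Without v they are windows of T of length k - 1, which must lie in the link of v. *)
Let core T := take m T ++ v :: drop m T.
Let link_path T := uniq T && all (fun i => edge (take k (drop (i * d) (core T)))) (iota 0 s).

Let m_k : (k <= m + d.-1)%N.
Proof. by move: k_hi s_gt1 d_gt0; rewrite /m; clear; case: s => // s' /=; rewrite mulSn; lia. Qed.

Let core_window T i : size T = M -> (i < s)%N ->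
  perm_eq (take k (drop (i * d) (core T))) (v :: take k.-1 (drop (i * d) T)).
Proof.
move=> szT si; have im : (i * d <= m)%N by rewrite leq_mul2r; apply/orP; right; clear -si; lia.
have mM : (m <= M)%N by rewrite leq_addr.
have szm : size (take m T) = m by rewrite size_takel ?szT.
have mk : (m - i * d < k)%N by apply: leq_ltn_trans (leq_subr _ _) k_lo.
rewrite /core drop_catE take_catE size_drop szm (eqP im) drop0.
have -> : take k.-1 (drop (i * d) T) = drop (i * d) (take m T) ++ take (k.-1 - (m - i * d)) (drop m T).
  rewrite -{1}(cat_take_drop m T) drop_catE take_catE size_drop szm (eqP im) drop0.
  rewrite take_oversize // size_drop szm; clear -mk; lia.
rewrite take_oversize; last by rewrite size_drop szm ltnW.
have -> : (k - (m - i * d) = (k.-1 - (m - i * d)).+1)%N by clear -mk; lia.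
by rewrite /= perm_catC /= perm_cons perm_catC.
Qed.

(** Walks of (s-1)d + 1 steps with states of size k - 2 have M vertices. Half of eta is lost along
    the steps, and the final halving in cT pays for tuples with repetitions. *)
Let link_paths_many : cT * n ^+ M <= cnt R B1 M link_path.
Proof.
have q_k : (k.-2.+1 = k.-1)%N by clear -k_gt1; lia.
have := @tight_walks_many R V B1 (fun t => edge (v :: t)) k.-2 _ cw cw0 m.+1 eta V_gt0.
rewrite q_k => /(_ _ Hv); have -> : (m.+1 + k.-2 = M)%N by rewrite /M -q_k addSnnS.
set walkP := (X in cnt R B1 M X) => hw.
have {}hw : 2 * cT * n ^+ M <= cnt R B1 M walkP.
  apply: le_trans (hw _); last by move=> t t' tt'; apply: edge_perm; rewrite perm_cons.
  rewrite ler_wpM2r // /cT -/m mulrC divfK ?pnatr_eq0 // ler_wpM2r ?exprn_ge0 //.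
  by have := cw_eta; rewrite -/m; lra.
have hu : cnt R B1 M (fun t => ~~ uniq t) <= cT * n ^+ M.
  have := cnt_not_uniq R M (max_card _) (isT : uniq ([::] : seq V)) (U := B1).
  rewrite add0n mulnn => h; have n0 : 0 < n by rewrite ltr0n.
  rewrite -(ler_pM2l n0); apply: (le_trans h).
  by rewrite mulrA [n * _]mulrC ler_wpM2r.
have hs : cnt R B1 M walkP <= cnt R B1 M link_path + cnt R B1 M (fun t => ~~ uniq t).
  rewrite /cnt -big_split /= big_seq [leRHS]big_seq; apply: ler_sum => T.
  rewrite mem_seqs => /andP[/eqP szT _]; rewrite -natrD ler_nat /link_path.
  case: (uniq T) => /=; last by case: (walkP T).
  rewrite addn0; case wT : (walkP T) => //; rewrite lt0b; apply/allP => i.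
  rewrite mem_iota add0n => /= si; rewrite (edge_perm H (core_window szT si)).
  apply: (allP wT); rewrite mem_iota add0n /= ltnS /m leq_mul2r.
  by apply/orP; right; clear -si; lia.
lra.
Qed.

Lemma vertex_gadget : exists a c a', [/\ good_gadget phi s a c a',
    all (mem (v |: (B1 :\: Q))) c, v \in c, a \in A2 :\: Q & a' \in A2 :\: Q].
Proof.
have id_lo i : (0 < i < s)%N -> (d <= i * d < k)%N.
  move=> /andP[i0 si]; rewrite leq_pmull //= (leq_ltn_trans _ k_lo) // leq_mul2r.
  by apply/orP; right; clear -si; lia.
pose cs := [seq ([::] : seq V, (k - i * d)%N) | i <- iota 1 s.-1].
pose cs' := [seq ([::] : seq V, ((s.-1 + i) * d).-1) | i <- iota 1 s.-1].
have := @choose_gadget R k V H A1 B1 V_gt0 k_gt0 M link_path A2 Q cs cs'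
  al cT phi tau gam gam0 A21 link_paths_many _ _ HQ HA2 Hg0 phi0 tau0 gal gam_cT.
case=> //.
- move=> w i /mapP[t]; rewrite mem_iota => tm [-> ->].
  have td : (d <= t * d < k)%N by apply: id_lo; clear -tm; lia.
  rewrite /= subn0; split=> //; rewrite /M; clear -td m_k d_gt0; lia.
- move=> w i /mapP[t]; rewrite mem_iota => tm [-> ->].
  have td : (d <= t * d < k)%N by apply: id_lo; clear -tm; lia.
  rewrite /= subn0 mulnDl -/m /M; split=> //; clear -td m_k d_gt0; lia.
- apply: le_lt_trans choice_room; rewrite lerD2l !size_map !size_iota.
  apply: ler_wpM2r; first by rewrite divr_ge0 // ltW.
  by rewrite ler_nat; clear; lia.
move=> T [a [a' [[szT /andP[uT eT]] aT [aA a'A aa'] Hpre Hsuf]]].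
have szm : size (take m T) = m by rewrite size_takel // szT leq_addr.
have szc : size (core T) = (s.-1 * d + k)%N.
  by rewrite size_cat /= size_drop szm szT /M -/m; clear -k_gt0; lia.
have pcore : perm_eq (core T) (v :: T).
  by rewrite /core perm_catC /= perm_cons perm_catC cat_take_drop.
have aT1 : all (mem B1) T by apply: sub_all aT => y /=; rewrite inE => /andP[].
have vB : v \notin B1 by rewrite (disjointFr AB vA).
have nA y : y \in A2 :\: Q -> y \notin core T.
  rewrite inE => /andP[_ yA]; rewrite (perm_mem pcore) inE negb_or.
  apply/andP; split; first by apply: contraNneq vA2 => <-.
  apply/negP => /(allP aT1) yB; have := disjointFr AB (subsetP A21 _ yA).
  by rewrite (yB : y \in B1).
exists a, (core T), a'; split=> //; last by rewrite (perm_mem pcore) mem_head.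
  split=> //; first exact: ltnW.
  - rewrite cons_uniq mem_rcons [a \in _ :: _]inE negb_or aa' nA // rcons_uniq nA //.
    rewrite (perm_uniq pcore) /= uT andbT /=; apply: contra vB; exact: (allP aT1).
  - by move=> i si; apply: (allP eT); rewrite mem_iota.
  move=> i im; have td := id_lo i im; have im' : (1 <= i < 1 + s.-1)%N by clear -im; lia.
  split.
    have := Hpre [::] (k - i * d)%N; rewrite cat0s /core take_catE szm.
    have -> : (k - i * d - m = 0)%N by clear -td m_k d_gt0; lia.
    rewrite take0 cats0 take_takel; last by clear -td m_k d_gt0; lia.
    by apply; apply/mapP; exists i; rewrite ?mem_iota.
  have -> : drop ((s.-1 + i) * d) (core T) = drop ((s.-1 + i) * d).-1 T.
    rewrite /core drop_catE szm mulnDl -/m addKn drop_oversize ?szm ?leq_addr //.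
    have : (0 < i * d)%N by clear -td d_gt0; lia.
    by case: (i * d)%N => // e _; rewrite /= drop_drop addnS addnC.
  by have := Hsuf [::] ((s.-1 + i) * d).-1; apply; apply/mapP; exists i; rewrite ?mem_iota.
rewrite (perm_all _ pcore); apply/andP; split; first exact: setU11.
by apply: sub_all aT => y yB; apply: setU1r.
Qed.
End VertexGadget.

End Gadgets.

(** * The extremal partition *)

Section Partition.
Variables (R : realFieldType) (k : nat) (V : finType) (H : kgraph k V).
Hypotheses (k_gt1 : (1 < k)%N) (V_gt0 : (0 < #|V|)%N).
Local Notation edge := (edge H).
Local Notation n := (#|V|%:R : R).

Let pow_ge0 j : 0 <= n ^+ j. Proof. exact/exprn_ge0/ler0n. Qed.
Let pow_gt0 j : 0 < n ^+ j. Proof. by rewrite exprn_gt0 ?ltr0n. Qed.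
Let k_gt0 : (0 < k)%N. Proof. exact: ltnW. Qed.

Let nkE : n ^+ k = n * n ^+ k.-1. Proof. by rewrite -exprS prednK. Qed.

Variable delta : nat.
Hypothesis codegree : forall S : {set V}, #|S| = k.-1 -> (delta <= codeg H S)%N.

Lemma codeg_sum (S : seq V) : size S = k.-1 -> uniq S ->
  codeg H [set:: S] = (\sum_v edge (v :: S))%N.
Proof.
move=> szS uS; rewrite /codeg -sum1_card big_mkcond /=; apply: eq_bigr => v _.
rewrite !inE; have -> : (v |: [set:: S] \in edges H) = edge (v :: S).
  by congr (_ \in edges H); apply/setP => y; rewrite !inE.
case e : (edge (v :: S)); rewrite ?andbF // andbT.
have := edge_uniq _ e; rewrite /= szS prednK // => /(_ erefl) /andP[vS _].
by rewrite ?inE vS.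
Qed.

Lemma codegree_miss (A : {set V}) (x : R) (S : seq V) : #|A|%:R <= delta%:R + x ->
  size S = k.-1 -> uniq S ->
  \sum_(a in A) (~~ edge (a :: S))%:R <= x + \sum_(b in ~: A) (edge (b :: S))%:R.
Proof.
move=> Ax szS uS; have := codegree (S := [set:: S]).
rewrite cardsE (card_uniqP uS) => /(_ szS); rewrite codeg_sum // -(ler_nat R) natr_sum.
rewrite (bigID (mem A)) /= => hd.
have E : \sum_(a in A) (~~ edge (a :: S))%:R + \sum_(a in A) (edge (a :: S))%:R = #|A|%:R :> R.
  rewrite -big_split /= -sum1_card natr_sum; apply: eq_bigr => a _.
  by case: (edge _); rewrite /= ?addr0 ?add0r.
have E2 : \sum_(b in ~: A) (edge (b :: S))%:R = \sum_(i | i \notin A) (edge (i :: S))%:R :> R.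
  by apply: eq_bigl => b; rewrite inE.
rewrite E2; lra.
Qed.

Lemma cnt_edges_in (B : {set V}) : cnt R B k edge <= (k ^ k * num_edges_in H B)%:R.
Proof.
apply: le_trans (_ : \sum_(t <- seqs B k) \sum_(e in [set e in edges H | e \subset B])
  (t \in seqs e k)%:R <= _).
  rewrite /cnt big_seq [leRHS]big_seq; apply: ler_sum => t.
  rewrite mem_seqs => /andP[szt /allP aB].
  have [et|et] := boolP (edge t); last by rewrite sumr_ge0 // => *; apply: ler0n.
  rewrite (bigD1 [set:: t]) /=; last first.
    by rewrite inE [_ \in edges H]et; apply/subsetP => y; rewrite inE => /aB.
  rewrite mem_seqs szt; have -> : all (mem [set:: t]) t by apply/allP => y /=; rewrite inE.
  by rewrite lerDl sumr_ge0 // => *; apply: ler0n.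
rewrite exchange_big /=; apply: le_trans (_ : \sum_(e in [set e in edges H | e \subset B])
  (k ^ k)%:R <= _); last by rewrite sumr_const -[leLHS]mulr_natl mulnC natrM.
apply: ler_sum => e; rewrite inE => /andP[eH eB].
rewrite -natr_sum ler_nat -big_mkcond sum1_count -size_filter.
have -> : (k ^ k = size (seqs e k))%N by rewrite size_seqs (edges_card eH).
rewrite uniq_leq_size ?filter_uniq ?uniq_seqs //.
by move=> t; rewrite mem_filter => /andP[].
Qed.

Lemma cnt_true (U : {set V}) j P : cnt R U j P + cnt R U j (fun t => ~~ P t) = #|U|%:R ^+ j.
Proof.
rewrite /cnt -big_split /= -natrX -(size_seqs U j) -sum1_size natr_sum.
by apply: eq_bigr => t _; case: (P t); rewrite /= ?addr0 ?add0r.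
Qed.

Variables (B : {set V}) (eta xi Delta : R).
Hypotheses (Bdelta : (#|~: B| <= delta)%N) (B_half : n / 2 <= #|B|%:R).
Hypothesis HB : (num_edges_in H B)%:R <= Delta * n ^+ k.
Hypotheses (xi_gt0 : 0 < xi) (eta_gt0 : 0 < eta) (xi_eta : (k + 3)%:R * xi <= eta / 2).
Hypothesis n_big : (k ^ 2)%:R <= xi / 2 ^+ k / 2 * n.
Hypotheses (eta_small : eta <= 1 / 2 ^+ k).
Hypothesis (Delta_small : (k ^ k)%:R * Delta <= xi * eta / 2 ^+ k / 2).

(** The sides are redefined by degree because the given B may contain vertices of large degree, and
    its complement vertices of small degree. At most xi n vertices change side in each direction. *)
Definition highdeg : {set V} :=
  [set v | eta * n ^+ k.-1 <= cnt R B k.-1 (fun t => edge (v :: t))].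
Let A1 := highdeg.
Let B1 := ~: highdeg.
Let A := ~: B.

Let eta_le1 : eta <= 1 / 2.
Proof.
apply: le_trans eta_small _; rewrite !mul1r lef_pV2 ?posrE ?exprn_gt0 //.
by rewrite -{1}[2]expr1 ler_weXn2l // ler1n.
Qed.

Let two_k : 1 <= 2 ^+ k :> R. Proof. by rewrite exprn_ege1 // ler1n. Qed.

Let cntB : cnt R B k edge <= xi * eta / 2 ^+ k / 2 * n ^+ k.
Proof.
apply: le_trans (cnt_edges_in B) _; rewrite natrM.
apply: le_trans (ler_wpM2l (ler0n _ _) HB) _.
by rewrite mulrA ler_wpM2r.
Qed.

Lemma card_highdeg_in : #|A1 :&: B|%:R <= xi * n.
Proof.
have : #|A1 :&: B|%:R * (eta * n ^+ k.-1) <= cnt R B k edge.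
  have -> : cnt R B k edge = cnt R B k.-1.+1 edge by rewrite prednK.
  rewrite cntS (big_setID A1) /= setIC -[leLHS]addr0 lerD //.
    rewrite mulr_natl -sumr_const setIC; apply: ler_sum => v.
    by rewrite !inE => /andP[].
  by apply: sumr_ge0 => *; apply: cnt_ge0.
move=> h; have := le_trans h cntB; rewrite nkE.
have : xi * eta / 2 ^+ k / 2 * (n * n ^+ k.-1) <= xi * n * (eta * n ^+ k.-1).
  rewrite -!mulrA ler_wpM2l ?(ltW xi_gt0) // [leRHS]mulrCA ler_wpM2l ?(ltW eta_gt0) //.
  rewrite mulrA ler_piMl ?mulr_ge0 ?ler0n // -invfM invf_le1 ?mulr_gt0 ?exprn_gt0 //.
  by have := two_k; lra.
move=> h1 h2; have := le_trans h2 h1.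
by rewrite ler_pM2r // mulr_gt0.
Qed.

(** As |B| >= n / 2, a vertex of A of low degree misses at least n^(k-1) / 2^k tuples of B, whereas
    by the codegree condition A misses in total little more than the number of edges inside B. *)
Lemma card_lowdeg_out : #|A :&: B1|%:R <= xi * n.
Proof.
have codeg0 S : size S = k.-1 -> uniq S -> all (mem B) S ->
  \sum_(a in A) (~~ edge (a :: S))%:R <= 0 + \sum_(b in B) (edge (b :: S))%:R :> R.
  move=> szS uS _; have := @codegree_miss A 0 S _ szS uS.
  by rewrite setCK; apply; rewrite addr0 ler_nat.
have up := tot_miss_link codeg0 (lexx 0) (w := [::]) isT isT k_gt0.
have low : #|A :&: B1|%:R * (n ^+ k.-1 / 2 ^+ k) <= tot_miss R H A B [::].
  rewrite /tot_miss (big_setID B1) /= mulr_natl -sumr_const -[leLHS]addr0 lerD //; last first.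
    by apply: sumr_ge0 => *; apply: miss_ge0.
  apply: ler_sum => v; rewrite in_setI => /andP[_]; rewrite /B1 in_setC inE -ltNge => vl.
  rewrite /miss /= subn0; have := cnt_true B k.-1 (fun t => edge (v :: t)).
  have : (n / 2) ^+ k.-1 <= #|B|%:R ^+ k.-1 by rewrite lerXn2r ?nnegrE ?divr_ge0 ?ler0n.
  have : eta * n ^+ k.-1 <= n ^+ k.-1 / 2 ^+ k.
    by rewrite mulrC ler_wpM2l // -[_^-1]mul1r.
  have -> : (n / 2) ^+ k.-1 = 2 * (n ^+ k.-1 / 2 ^+ k).
    have -> : 2 ^+ k = 2 * 2 ^+ k.-1 :> R by rewrite -exprS prednK.
    by rewrite expr_div_n invfM mulrCA [2 * _]mulrA mulfV ?mul1r ?pnatr_eq0.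
  lra.
have := le_trans low up; rewrite /= !subn0 add0r => h.
have h1 : (k ^ 2)%:R * n ^+ k.-1 <= xi / 2 ^+ k / 2 * n ^+ k.
  by rewrite nkE [leRHS]mulrA ler_wpM2r.
have h2 : xi * eta / 2 ^+ k / 2 * n ^+ k <= xi / 2 ^+ k / 2 * n ^+ k.
  rewrite ler_wpM2r // -!mulrA ler_wpM2l ?(ltW xi_gt0) // ler_piMl //.
    by rewrite mulr_ge0 ?invr_ge0 ?exprn_ge0.
  by have := eta_le1; lra.
have h3 : #|A :&: B1|%:R * (n ^+ k.-1 / 2 ^+ k) <= xi * n * (n ^+ k.-1 / 2 ^+ k).
  apply: (le_trans h); apply: le_trans (lerD h1 (le_trans cntB h2)) _.
  by rewrite nkE; lra.
by move: h3; rewrite ler_pM2r // divr_gt0 // exprn_gt0.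
Qed.

Lemma card_highdeg_lo : #|A|%:R <= #|A1|%:R + xi * n.
Proof.
apply: le_trans (_ : #|A1|%:R + #|A :&: B1|%:R <= _); last by rewrite lerD2l card_lowdeg_out.
rewrite -natrD ler_nat -(cardsID B1 A) addnC leq_add2r.
by apply/subset_leq_card/subsetP => v; rewrite !inE negbK => /andP[].
Qed.

Lemma card_highdeg_hi : #|A1|%:R <= #|A|%:R + xi * n.
Proof.
apply: le_trans (_ : #|A|%:R + #|A1 :&: B|%:R <= _); last by rewrite lerD2l card_highdeg_in.
rewrite -natrD ler_nat -(cardsID B A1) addnC leq_add2r.
by apply/subset_leq_card/subsetP => v; rewrite !inE => /andP[].
Qed.

Let codegree1 S : size S = k.-1 -> uniq S -> all (mem B1) S ->
  \sum_(a in A1) (~~ edge (a :: S))%:R <= xi * n + \sum_(b in B1) (edge (b :: S))%:R.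
Proof.
move=> szS uS _; apply: codegree_miss => //; apply: le_trans card_highdeg_hi _.
by rewrite lerD2r ler_nat.
Qed.

Lemma lowdeg_degree b : b \in B1 ->
  cnt R B1 k.-1 (fun t => edge (b :: t)) <= 2 * eta * n ^+ k.-1.
Proof.
rewrite 2!inE -ltNge => bl.
have := @cnt_almost_sub R V B1 B k.-1 (fun t => edge (b :: t)) #|V| xi (max_card _).
have -> : B1 :\: B = A :&: B1 by apply/setP => y; rewrite !inE andbC.
move=> /(_ card_lowdeg_out) h; apply: (le_trans h).
have : k.-1%:R * xi * n ^+ k.-1 <= eta * n ^+ k.-1.
  rewrite ler_wpM2r //; apply: le_trans (_ : (k + 3)%:R * xi <= _).
    by rewrite (ler_wpM2r (ltW xi_gt0)) // ler_nat; clear; lia.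
  by have := eta_gt0; have := xi_eta; lra.
lra.
Qed.

Lemma highdeg_degree v : v \in A1 ->
  eta / 2 * n ^+ k.-1 <= cnt R B1 k.-1 (fun t => edge (v :: t)).
Proof.
rewrite inE => vh.
have := @cnt_almost_sub R V B B1 k.-1 (fun t => edge (v :: t)) #|V| xi (max_card _).
have -> : B :\: B1 = A1 :&: B by apply/setP => y; rewrite !inE negbK.
move=> /(_ card_highdeg_in) h.
have : k.-1%:R * xi * n ^+ k.-1 <= eta / 2 * n ^+ k.-1.
  rewrite ler_wpM2r //; apply: le_trans (_ : (k + 3)%:R * xi <= _) => //.
  by rewrite (ler_wpM2r (ltW xi_gt0)) // ler_nat; clear; lia.
lra.
Qed.

Let n_big' : (k ^ 2)%:R <= xi * n.
Proof.
apply: le_trans n_big _; rewrite ler_wpM2r ?ler0n //.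
have t1 : (2 ^+ k)^-1 <= 1 :> R by rewrite invf_le1 ?exprn_gt0 // two_k.
by have := ler_wpM2l (ltW xi_gt0) t1; have := xi_gt0; lra.
Qed.

(** This is what bounds the value conflicts in the local lemma: with few edges inside B1, b cannot
    miss many through A1. *)
Lemma lowdeg_tot_miss b : b \in B1 -> tot_miss R H A1 B1 [:: b] <= 4 * eta * n ^+ k.-1.
Proof.
move=> bB; have xin : 0 <= xi * n by rewrite mulr_ge0 ?ler0n ?ltW.
have := tot_miss_link codegree1 xin (w := [:: b]).
rewrite /= bB => /(_ isT isT k_gt1); rewrite !subn1 => /le_trans; apply.
have := lowdeg_degree bB.
have : (xi * n + (k ^ 2)%:R) * n ^+ k.-2 <= 2 * xi * n ^+ k.-1.
  apply: le_trans (ler_wpM2r (pow_ge0 k.-2) (lerD (lexx _) n_big')) _.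
  have -> : (k.-1 = k.-2.+1)%N by clear -k_gt1; lia.
  by rewrite exprS; have := pow_ge0 k.-2; lra.
have : 2 * xi * n ^+ k.-1 <= eta * n ^+ k.-1.
  rewrite ler_wpM2r //; apply: le_trans (_ : (k + 3)%:R * xi <= _).
    by rewrite (ler_wpM2r (ltW xi_gt0)) // (ler_nat R 2); clear; lia.
  by have := eta_gt0; have := xi_eta; lra.
by have := mulr_gt0 eta_gt0 (pow_gt0 k.-1); lra.
Qed.

(** The codegree error and the term k^2 give 2 xi, passing from B1 to B gives k xi, and the edges
    inside B at most xi. *)
Lemma tot_miss_nil : tot_miss R H A1 B1 [::] <= (k + 3)%:R * xi * n ^+ k.
Proof.
have xin : 0 <= xi * n by rewrite mulr_ge0 ?ler0n ?ltW.
have := tot_miss_link codegree1 xin (w := [::]).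
move=> /(_ isT isT k_gt0); rewrite /= !subn0 => /le_trans; apply.
have := @cnt_almost_sub R V B1 B k edge #|V| xi (max_card _).
have -> : B1 :\: B = A :&: B1 by apply/setP => y; rewrite !inE andbC.
move=> /(_ card_lowdeg_out) h.
have h1 : (xi * n + (k ^ 2)%:R) * n ^+ k.-1 <= 2 * xi * n ^+ k.
  apply: le_trans (ler_wpM2r (pow_ge0 k.-1) (lerD (lexx _) n_big')) _.
  by rewrite nkE; have := pow_ge0 k.-1; lra.
have h2 : xi * eta / 2 ^+ k / 2 * n ^+ k <= xi * n ^+ k.
  rewrite ler_wpM2r // -!mulrA ger_pMr //.
  have e1 := eta_le1; have t0 : 0 <= (2 ^+ k)^-1 :> R by rewrite invr_ge0 exprn_ge0.
  have t1 : (2 ^+ k)^-1 <= 1 :> R by rewrite invf_le1 ?exprn_gt0 // two_k.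
  have : eta * ((2 ^+ k)^-1 * 2^-1) <= 1 * (1 * 1) by rewrite !ler_pM ?mulr_ge0 ?(ltW eta_gt0) //; lra.
  by rewrite !mulr1.
rewrite natrD; have := cntB; lra.
Qed.

End Partition.

(** * Filling a template *)

Section Assembly.
Variables (R : realFieldType) (k l s : nat) (V : finType) (H : kgraph k V).
Variables (A1 A2 : {set V}).
Let B1 := ~: A1.
Let d := (k - l)%N.
Local Notation edge := (edge H).
Local Notation n := (#|V|%:R : R).
Local Notation atyp := (@atypical R k V H B1).
Hypotheses (k_lo : (s.-1 * d < k)%N) (k_hi : (k < s * d)%N) (s_gt1 : (1 < s)%N).
Hypotheses (l_k : (l < k)%N) (k_gt1 : (1 < k)%N) (V_gt0 : (0 < #|V|)%N).
Hypothesis A21 : A2 \subset A1.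
Variables (phi eps1 : R) (m : nat).
Variables (gs : seq (nat * (V * seq V * V))) (fs ss : seq V).
Hypotheses (phi_ge0 : 0 <= phi) (A2_typical : forall a, a \in A2 -> ~~ atyp phi a [::]).
Hypothesis low_miss : forall y, y \in B1 -> tot_miss R H A1 B1 [:: y] <= eps1 * n ^+ k.-1.

Definition gadget_seg (g : nat * (V * seq V * V)) := Gadget g.1 g.2.1.1 g.2.1.2 g.2.2.

Let segs := map gadget_seg gs ++ map (@Full V) fs ++ map (@Short V) ss.
Let vs := flatten (map (@seg_vertices V) segs).

Hypothesis gs_good : forall g, g \in gs ->
  [/\ good_gadget d s H B1 phi g.1 g.2.1.1 g.2.1.2 g.2.2, (g.1 <= s)%N,
      g.2.1.1 \in A2 & g.2.2 \in A2].
Hypotheses (fsA : {subset fs <= A2}) (ssA : {subset ss <= A2}).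
Hypotheses (u_vs : uniq vs) (A1_vs : {subset A1 <= vs}).
Hypotheses (m_gt0 : (0 < m)%N) (nE : #|V| = (m * d)%N) (lenE : sumn (map (seg_len s) segs) = m).
Hypotheses (n_big : (4 * k <= #|V|)%N) (free_half : (#|V| <= 2 * (#|V| - size vs))%N).
Hypothesis psi_small : k%:R * k%:R * (4 ^+ k * phi) <= 1 / 8.
Hypothesis value_small :
  k%:R * ((3 * s * size gs)%:R * (k%:R * 4 ^+ k) + s%:R * k%:R * 4 ^+ k * eps1 * n) <= 1 / 8 * n.

Let Y := [set y | y \notin vs].
Let d_gt0 : (0 < d)%N. Proof. by rewrite subn_gt0. Qed.
Let n_gt0 : 0 < n. Proof. by rewrite ltr0n. Qed.
Let pow_gt0 j : 0 < n ^+ j. Proof. by rewrite exprn_gt0. Qed.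

Let YB : Y \subset B1.
Proof. by apply/subsetP => y; rewrite !inE; apply: contra; apply: A1_vs. Qed.

Let cardY : #|Y| = (#|V| - size vs)%N.
Proof.
rewrite -(card_uniqP u_vs) -(cardC (mem vs)) addKn.
by apply: eq_card => y; rewrite !inE.
Qed.

(** At least n / 2 vertices are free and n >= 4k, so each factor of the falling factorial is at
    least n / 4. All powers of 4 below come from here. *)
Let ffact_lower j : (j <= k)%N -> n ^+ j <= 4 ^+ k * (#|Y| ^_ j)%:R.
Proof.
move=> jk; apply: le_trans (_ : 4 ^+ j * (#|Y| ^_ j)%:R <= _); last first.
  by rewrite ler_wpM2r ?ler0n // ler_weXn2l // ler1n.
elim: j jk => [|j IH] jk; first by rewrite !expr0 mul1r ffactn0.
have h4 : n <= 4 * (#|Y| - j)%:R.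
  by rewrite -natrM ler_nat cardY; move: free_half n_big jk; clear; lia.
rewrite 2!exprSr ffactnSr natrM mulrACA; apply: ler_pM => //; last exact: IH (ltnW jk).
exact: ltW (pow_gt0 j).
Qed.

Let segs_ok : all (seg_ok k d) segs.
Proof.
rewrite all_cat all_cat !all_map; apply/and3P; split; try by apply/allP.
apply/allP => g /gs_good[[h0 szc _ _ _] _ _ _] /=.
by rewrite h0 szc eqxx.
Qed.

Let T := flatten (map (@template V k d s) segs).
Let sizeT : size T = #|V|.
Proof. by rewrite /T (size_templates k_lo k_hi s_gt1 segs_ok) lenE nE. Qed.
Let v0 := fill T (enum Y).

Let pmapT : pmap id T = vs. Proof. exact: pmap_templates. Qed.

Let noneT : count_mem None T = size (enum Y).
Proof.
rewrite -cardE cardY -pmapT -sizeT size_pmap -(count_predC isSome T) addKn.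
by apply: eq_count => -[].
Qed.

Let v0_perm : perm_eq v0 (enum V).
Proof.
apply: perm_trans (perm_fill noneT) _; rewrite pmapT.
apply: uniq_perm; rewrite ?enum_uniq //.
  rewrite cat_uniq u_vs enum_uniq andbT /=; apply/hasPn => y.
  by rewrite mem_enum inE.
by move=> y; rewrite mem_cat !mem_enum !inE; case: (y \in vs).
Qed.

Let v0_matches : all2 (matches Y) T v0.
Proof. by apply: fill_matches => //; apply/allP => y; rewrite mem_enum. Qed.

Let W := [seq take k (rot (i * d) v0) | i <- iota 0 m].
Let szv0 : size v0 = (m * d)%N. Proof. by rewrite (perm_size v0_perm) -cardE. Qed.

Let fixed_windows := flatten [seq map (seg_window k d s sg) (iota 0 (seg_len s sg)) | sg <- segs].

Let fixed_W : map (fixed_part Y) W = fixed_windows.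
Proof.
rewrite /fixed_windows -(windows_template k_lo k_hi s_gt1 segs_ok); last first.
  by rewrite -/T sizeT; move: n_big; clear; lia.
rewrite lenE -map_comp; apply: eq_map => i /=; rewrite -/T.
apply: fixed_part_matches; last first.
  by apply: all2_take; apply: all2_cat_imply; [apply: all2_drop|apply: all2_take].
move=> y; rewrite inE -pmapT; apply: contra.
have sub (r r' : seq (option V)) : {subset r <= r'} -> {subset pmap id r <= pmap id r'}.
  by move=> rr x; rewrite !mem_pmap => /mapP[o /rr o' ->]; apply: map_f.
apply: sub => o /mem_take; by rewrite mem_rot.
Qed.

Let fix_ok (f : seq V) := (size f = k /\ edge f) \/
  exists a w, [/\ perm_eq f (a :: w), a \in A2, (size w < k)%N & ~~ atyp phi a w].

Let fix_ok1 a : a \in A2 -> fix_ok [:: a].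
Proof. by move=> aA; right; exists a, [::]; rewrite A2_typical // (ltnW k_gt1). Qed.

Let gadget_fix_ok g j : g \in gs -> (j < s + g.1 + s)%N ->
  fix_ok (seg_window k d s (gadget_seg g) j).
Proof.
case: g => h [[a c] a'] /gs_good[/= [h0 szc uc ec tc] hs aA a'A] jl.
case: ltnP => js.
  case: (posnP j) => [->|j0].
    by rewrite subn0 (eqP (ltnW k_hi)) take0; apply: fix_ok1.
  right; exists a, (take (k - (s - j) * d) c); split=> //.
    have := d_gt0; rewrite size_take_min => d0; apply: leq_ltn_trans (geq_minl _ _) _.
    have : (0 < (s - j) * d)%N by rewrite muln_gt0 subn_gt0 js.
    by have := k_gt1; clear; lia.
  have ij : (0 < s - j < s)%N by clear -j0 js; lia.
  by have [] := tc _ ij.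
case: ltnP => jh.
  left; split; last by apply: ec; clear -js jh; lia.
  rewrite size_takel // size_drop szc.
  have : ((j - s) * d <= h.-1 * d)%N by rewrite leq_mul2r; apply/orP; right; clear -js jh; lia.
  by clear; lia.
have [jE|jl'] := eqVneq (j - s)%N (h.-1 + s)%N.
  rewrite drop_oversize; first exact: fix_ok1.
  by rewrite szc jE mulnDl leq_add2l ltnW.
have jE : (j - s = h.-1 + (j - s - h.-1))%N by clear -js jh h0; lia.
have ji : (0 < j - s - h.-1 < s)%N by clear -js jh h0 jl jl'; lia.
right; exists a', (drop ((j - s) * d) c); split=> //.
- by rewrite -cats1 perm_catC.
- rewrite size_drop szc jE mulnDl; have : (0 < (j - s - h.-1) * d)%N.
    by rewrite muln_gt0 d_gt0; case/andP: ji => ->.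
  by have := k_gt1; clear; lia.
by rewrite jE; have [_] := tc _ ji.
Qed.

Let W_fix_ok w : w \in W -> fix_ok (fixed_part Y w).
Proof.
move=> /(map_f (fixed_part Y)); rewrite fixed_W /fixed_windows /segs !map_cat -!map_comp.
rewrite !flatten_cat !mem_cat => /or3P[] /flattenP[_ /mapP[g gin ->]] /mapP[j].
- by rewrite mem_iota add0n => /= jl ->; apply: gadget_fix_ok.
- by move=> _ ->; apply/fix_ok1/fsA.
- by move=> _ ->; apply/fix_ok1/ssA.
Qed.

Let size_W w : w \in W -> size w = k.
Proof.
case/mapP => i _ ->; rewrite size_takel // size_rot szv0 -nE.
by move: n_big; clear; lia.
Qed.

Let uniq_W w : w \in W -> uniq w.
Proof.
by case/mapP => i _ ->; rewrite take_uniq // rot_uniq (perm_uniq v0_perm) enum_uniq.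
Qed.

Let size_free w : w \in W -> size (free_part Y w) = (k - size (fixed_part Y w))%N.
Proof.
by move=> /size_W <-; rewrite !size_filter -(count_predC (mem Y) w) addnK.
Qed.

Let bad_few f : fix_ok f -> (size f < k)%N ->
  cnt R Y (k - size f) (fun t => ~~ edge (f ++ t)) <=
    4 ^+ k * phi * (#|Y| ^_ (k - size f))%:R.
Proof.
case=> [[-> _]|[a [w [pf aA wk nat]]] fk]; first by rewrite ltnn.
rewrite (perm_size pf) /=; have -> : (k - (size w).+1 = k.-1 - size w)%N.
  by rewrite -subn1 subnAC subn1 -subnS.
apply: le_trans (_ : cnt R B1 (k.-1 - size w) (fun t => ~~ edge (a :: w ++ t)) <= _).
  apply: le_trans (cnt_sub _ _ _ YB) _; apply: cnt_le => t _ _.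
  rewrite (@edge_perm _ _ H (f ++ t) (a :: w ++ t)) //.
  by rewrite -cat_cons perm_cat2r.
move: nat; rewrite /atypical -leNgt => /le_trans; apply.
rewrite [4 ^+ k * phi]mulrC -mulrA; apply: ler_wpM2l => //; apply: ffact_lower.
by rewrite (leq_trans (leq_subr _ _)) ?leq_pred.
Qed.

(** A bound for the probability that a window with fixed part f receives y and becomes a non-edge. A
    window without free vertices carries no event, whence the default 0. *)
Let val_weight y f : R := if (size f < k)%N then
  cnt R Y (k - size f) (fun t => (y \in t) && ~~ edge (f ++ t)) / (#|Y| ^_ (k - size f))%:R
  else 0.

Let val_weight_ge0 y f : 0 <= val_weight y f.
Proof. by rewrite /val_weight; case: ifP => // _; rewrite divr_ge0 ?cnt_ge0 ?ler0n. Qed.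

Let val_weight_step y f j c : (size f < k)%N -> (k - size f = j.+1)%N ->
  cnt R Y j (fun t => ~~ edge (f ++ y :: t)) <= c ->
  val_weight y f <= k%:R * 4 ^+ k * c / n ^+ j.+1.
Proof.
move=> fk jE cc; rewrite /val_weight fk jE.
have c0 : 0 <= c by apply: le_trans cc; apply: cnt_ge0.
have jk : (j.+1 <= k)%N by rewrite -jE leq_subr.
have lo := ffact_lower jk.
have fp : 0 < (#|Y| ^_ j.+1)%:R :> R.
  by have := lt_le_trans (pow_gt0 j.+1) lo; rewrite pmulr_rgt0 // exprn_gt0.
rewrite ler_pdivrMr // mulrAC ler_pdivlMr //.
have h : cnt R Y j.+1 (fun t => (y \in t) && ~~ edge (f ++ t)) <= k%:R * c.
  have Pp t t' : perm_eq t t' -> ~~ edge (f ++ t) = ~~ edge (f ++ t').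
    by move=> tt'; congr negb; apply: edge_perm; rewrite perm_cat2l.
  apply: le_trans (cnt_mem R Y j y Pp) _.
  by apply: ler_pM; rewrite ?ler0n ?cnt_ge0 // ler_nat.
have -> : k%:R * 4 ^+ k * c * (#|Y| ^_ j.+1)%:R =
   k%:R * c * (4 ^+ k * (#|Y| ^_ j.+1)%:R) by ring.
by apply: ler_pM; rewrite ?cnt_ge0 ?exprn_ge0 ?ler0n.
Qed.

Let val_weight_any y f : val_weight y f <= k%:R * 4 ^+ k / n.
Proof.
have [fk|kf] := ltnP (size f) k; last first.
  rewrite /val_weight ltnNge kf /=.
  by rewrite divr_ge0 ?mulr_ge0 ?exprn_ge0 ?ler0n.
have jE : (k - size f = (k - size f).-1.+1)%N by rewrite prednK // subn_gt0.
have h : cnt R Y (k - size f).-1 (fun t => ~~ edge (f ++ y :: t)) <= n ^+ (k - size f).-1.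
  exact/cnt_pow/max_card.
apply: le_trans (val_weight_step fk jE h) _.
rewrite exprS invfM -!mulrA ler_wpM2l ?ler0n // ler_wpM2l ?exprn_ge0 ?ler0n //.
by rewrite mulrCA mulfV ?gt_eqF ?mulr1.
Qed.

Let val_weight_A y a : val_weight y [:: a] <= k%:R * 4 ^+ k * miss R H B1 a [:: y] / n ^+ k.-1.
Proof.
have k1E : (k.-1 = k.-2.+1)%N by move: k_gt1; clear; lia.
rewrite k1E; apply: val_weight_step => //=; first by rewrite subn1 -k1E.
by rewrite /miss /= subn1; apply: cnt_sub.
Qed.

(** Gadget windows are few, so the trivial weight of order 1 / n is enough for them. Every other
    fixed part is a single vertex of A1, repeated at most s times, and these weights add up to the
    edges missed through y. *)
Let sum_val_weight y : y \in Y -> k%:R * \sum_(f <- fixed_windows) val_weight y f <= 1 / 8.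
Proof.
move=> yY; rewrite /fixed_windows /segs !map_cat !flatten_cat !big_cat /=.
have hA (r : seq V) (F : V -> segment V) s' : uniq r -> {subset r <= A2} -> (s' <= s)%N ->
   (forall a j, seg_window k d s (F a) j = [:: a]) -> (forall a, seg_len s (F a) = s') ->
   \sum_(f <- flatten [seq map (seg_window k d s sg) (iota 0 (seg_len s sg)) | sg <- map F r]) val_weight y f
   <= s%:R * (k%:R * 4 ^+ k / n ^+ k.-1) * \sum_(a <- r) miss R H B1 a [:: y].
  move=> ur rA ss' Fw Fl; rewrite big_flatten big_map big_map mulr_sumr; apply: ler_sum => a _.
  rewrite big_map Fl; under eq_bigr do rewrite Fw.
  rewrite big_const_seq count_predT size_iota iter_addr_0 -[leLHS]mulr_natl -mulrA.
  apply: le_trans (_ : s%:R * val_weight y [:: a] <= _).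
    by rewrite ler_wpM2r ?ler_nat.
  rewrite ler_wpM2l ?ler0n //; apply: le_trans (val_weight_A y a) _.
  by rewrite mulrAC.
have ufs : uniq (fs ++ ss).
  move: u_vs; rewrite /vs /segs !map_cat !flatten_cat cat_uniq => /and3P[_ _].
  by rewrite -!map_comp /= !flatten_map1 !map_id.
have [uf _ us] := and3P (etrans (esym (cat_uniq fs ss)) ufs).
have hF := hA fs (@Full V) s uf fsA (leqnn s) (fun _ _ => erefl) (fun _ => erefl).
have hS := hA ss (@Short V) s.-1 us ssA (leq_pred s) (fun _ _ => erefl) (fun _ => erefl).
have hG : \sum_(f <- flatten [seq map (seg_window k d s sg) (iota 0 (seg_len s sg)) | sg <- map gadget_seg gs]) val_weight y f
   <= (3 * s * size gs)%:R * (k%:R * 4 ^+ k / n).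
  rewrite big_flatten big_map big_map mulnC natrM -mulrA; apply: sum_seq_le => g gin /=.
  rewrite big_map; apply: le_trans (sum_seq_le (fun _ _ => val_weight_any y _)) _.
  have b0 : 0 <= k%:R * 4 ^+ k / n by rewrite divr_ge0 ?mulr_ge0 ?exprn_ge0 ?ler0n.
  apply: ler_wpM2r => //; rewrite ler_nat size_iota.
  have [_ h _ _] := gs_good gin; move: h; rewrite /=; move: (g.1) => h; clear; lia.
have hT : \sum_(a <- fs) miss R H B1 a [:: y] + \sum_(a <- ss) miss R H B1 a [:: y] <= eps1 * n ^+ k.-1.
  apply: le_trans (low_miss (subsetP YB _ yY)); rewrite -big_cat /= big_uniq //= /tot_miss.
  rewrite [leRHS](big_setID [set a in fs ++ ss]) /= -[leLHS]addr0 lerD //; last first.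
    by apply: sumr_ge0 => *; apply: miss_ge0.
  rewrite le_eqVlt; apply/orP; left; apply/eqP; apply: eq_bigl => a; rewrite !inE.
  case aF : (a \in fs ++ ss); rewrite ?andbF // andbT; apply/esym/(subsetP A21).
  by move: aF; rewrite mem_cat => /orP[/fsA|/ssA].
have c0 : 0 <= s%:R * (k%:R * 4 ^+ k / n ^+ k.-1).
  by rewrite mulr_ge0 ?ler0n // divr_ge0 ?mulr_ge0 ?exprn_ge0 ?ler0n.
have hT' := ler_wpM2l c0 hT.
apply: le_trans (_ : k%:R * ((3 * s * size gs)%:R * (k%:R * 4 ^+ k / n) +
    s%:R * (k%:R * 4 ^+ k / n ^+ k.-1) * (eps1 * n ^+ k.-1)) <= _).
  rewrite ler_wpM2l ?ler0n //; apply: lerD hG _; apply: le_trans hT'.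
  by rewrite mulrDr lerD.
rewrite -(ler_pM2r n_gt0); apply: le_trans value_small.
have np := pow_gt0 k.-1.
rewrite le_eqVlt; apply/orP; left; apply/eqP.
by field; rewrite !gt_eqF.
Qed.

Lemma hamilton_of_segments : has_hamilton_lcycle l H.
Proof.
have [||||||||s0 [sY sW]] := @fill_windows R V Y edge W k k (4 ^+ k * phi) (@edge_perm _ _ H).
- by apply/allP => w /uniq_W.
- by apply/allP => w /size_W ->.
- move=> w wW f0; have := W_fix_ok wW; have := size_free wW; rewrite f0 /= => /esym/eqP.
  rewrite subn_eq0 => kf [[_ ef]|[a [u [pf aA uk nt]]]].
    have pw : perm_eq w (fixed_part Y w).
      by rewrite -[X in perm_eq _ X]cats0 -f0 perm_sym perm_catC perm_filterC.
    by rewrite (edge_perm H pw).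
  have szf : size (fixed_part Y w) = k.
    apply/eqP; rewrite eqn_leq kf andbT -(size_W wW) size_filter; exact: count_size.
  have pw : perm_eq w (a :: u).
    apply: perm_trans pf; rewrite -[X in perm_eq _ X]cats0 -f0 perm_sym perm_catC.
    by rewrite perm_filterC.
  have szu : (k.-1 = size u)%N by rewrite -szf (perm_size pf).
  (* No free vertex is left, so [miss] is 0 or 1; as phi < 1, typical means edge. *)
  rewrite (edge_perm H pw); apply: contraR nt => ne.
  rewrite /atypical /miss szu subnn cnt0 cats0 ne expr0 mulr1 /=.
  have kk : 1 <= k%:R * k%:R * 4 ^+ k :> R.
    by rewrite mulr_ege1 ?exprn_ege1 ?mulr_ege1 // ler1n // ltnW.
  by have := ler_wpM2r phi_ge0 kk; have := psi_small; rewrite mul1r mulrA => h1 h2; lra.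
- move=> w wW fw; rewrite (size_free wW); apply: bad_few (W_fix_ok wW) _.
  by rewrite -subn_gt0 -(size_free wW) lt0n size_eq0.
- move=> x xY; apply: windows_cover => //; by rewrite (perm_uniq v0_perm) enum_uniq.
- by rewrite mulr_ge0 ?exprn_ge0.
- exact: psi_small.
- move=> y yY; apply: le_trans (sum_val_weight yY); rewrite ler_wpM2l ?ler0n //.
  rewrite -fixed_W [leRHS](big_map (fixed_part Y)) [leLHS]big_mkcond /= big_seq [leRHS]big_seq; apply: ler_sum => w wW.
  case: ifP => [fw|_]; last exact: val_weight_ge0.
  rewrite /val_weight (size_free wW) -subn_gt0 -(size_free wW) lt0n size_eq0.
  by rewrite fw.
have v0u : uniq v0 by rewrite (perm_uniq v0_perm) enum_uniq.
apply: (@hamilton_of_windows k l V H (map s0 v0) m) => //.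
- apply: uniq_perm; rewrite ?enum_uniq ?map_inj_uniq //; first exact: perm_inj.
  move=> x; rewrite mem_enum inE -[x](permKV s0) map_f //.
  by rewrite (perm_mem v0_perm) mem_enum.
- by rewrite size_map szv0.
- rewrite size_map szv0 -nE; move: n_big; clear; lia.
by move=> i im; rewrite -map_rot -map_take; apply/sW/map_f; rewrite mem_iota.
Qed.

End Assembly.

(** * The extremal case *)

Section Extremal.
Variables (R : realFieldType) (k l s m delta : nat) (V : finType) (H : kgraph k V).
Let d := (k - l)%N.
Local Notation edge := (edge H).
Local Notation n := (#|V|%:R : R).
Hypotheses (k_lo : (s.-1 * d < k)%N) (k_hi : (k < s * d)%N) (s_gt1 : (1 < s)%N).
Hypotheses (l_k : (l < k)%N) (k_ge3 : (3 <= k)%N) (m_gt0 : (0 < m)%N).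
Hypotheses (nE : #|V| = (m * d)%N) (V_gt0 : (0 < #|V|)%N).
Hypothesis codegree : forall S : {set V}, #|S| = k.-1 -> (delta <= codeg H S)%N.
Variables (B : {set V}) (phi kap eta gam xi Delta : R).
Let A := ~: B.
Hypotheses (A_delta : (#|A| <= delta)%N) (m_A : (m <= s * #|A|)%N) (A_m : (s * #|A| <= m + s)%N).
Hypothesis HB : (num_edges_in H B)%:R <= Delta * n ^+ k.

Let eps j := phi * kap ^+ (k - j).
Let cw := eta / (4 * k%:R).
Let cT := eta / 2 / 2 * cw ^+ (s.-1 * d).+1 / 2.
Let tau := (k + 3)%:R * xi.
Hypotheses (phi_gt0 : 0 < phi) (phi_small : k%:R * k%:R * (4 ^+ k * phi) <= 1 / 8).
Hypotheses (kap_gt0 : 0 < kap) (kap_le1 : kap <= 1).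
Hypothesis kap_small : (2 * s)%:R * (kap / phi) <= 1 / (1024 * k%:R ^+ 2).
Hypotheses (eta_gt0 : 0 < eta) (eta_eps : 4 * eta < eps 1) (eta_pow : eta <= 1 / 2 ^+ k).
Hypothesis eta_match : (k * (k + 2) * s)%:R * (2 * eta) < 1 / 2 ^+ k.
Hypothesis eta_value : (k * s * k)%:R * 4 ^+ k * (4 * eta) <= 1 / 16.
Hypotheses (gam_gt0 : 0 < gam) (gam_k : gam <= 1 / (32 * k%:R)).
Hypotheses (gam_eps : k%:R * gam <= eps 0 / 4) (gam_eps2 : gam <= eps 0 / (1024 * k%:R ^+ 2)).
Hypotheses (gam_cT : (2 * k)%:R * gam <= cT / 2) (gam_cT2 : (1 + 2 * s)%:R * gam <= cT / (512 * k%:R ^+ 2)).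
Hypothesis gam_value : (3 * s * k * k)%:R * 4 ^+ k * gam <= 1 / 16.
Hypotheses (xi_gt0 : 0 < xi) (xi_eta : tau <= eta / 2).
Hypothesis xi_gam : (2 * k + 2)%:R * (s%:R * xi + tau / phi) <= gam.
Hypothesis Delta_small : (k ^ k)%:R * Delta <= xi * eta / 2 ^+ k / 2.
Hypotheses (n_xi : (k ^ 2)%:R <= xi / 2 ^+ k / 2 * n) (n_gam : 1 <= gam * n).
Hypotheses (n_eps : (k ^ 2)%:R <= eps 0 / 2 * n) (n_cT : ((2 * k) ^ 2)%:R <= cT * n).
Hypotheses (n_pow : (k ^ 2)%:R <= 1 / 2 ^+ k * n) (n_s : (16 * k * s <= #|V|)%N).

Let A1 := highdeg (R := R) H B eta.
Let B1 := ~: A1.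
(** These vertices have large degree into B1 but miss too many edges for a segment of their own;
    each is absorbed in a core. *)
Let V0 := [set a in A1 | @atypical R k V H B1 phi a [::]].
Let A2 := A1 :\: V0.

Let k_gt0 : (0 < k)%N. Proof. exact: leq_trans k_ge3. Qed.
Let k_gt1 : (1 < k)%N. Proof. exact: leq_trans k_ge3. Qed.
Let s_gt0 : (0 < s)%N. Proof. exact: ltnW. Qed.
Let n_gt0 : 0 < n. Proof. by rewrite ltr0n. Qed.
Let kR_gt0 : 0 < k%:R :> R. Proof. by rewrite ltr0n. Qed.
Let k_ge1 : 1 <= k%:R :> R. Proof. by rewrite ler1n. Qed.
Let tau_ge0 : 0 <= tau. Proof. by rewrite mulr_ge0 ?ler0n // ltW. Qed.
Let tau_phi_ge0 : 0 <= tau / phi. Proof. by rewrite divr_ge0 // ltW. Qed.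
Let s_xi_ge0 : 0 <= s%:R * xi. Proof. by rewrite mulr_ge0 ?ler0n // ltW. Qed.
Let AB1 : [disjoint A1 & B1]. Proof. by rewrite -setI_eq0 setICr. Qed.
Let A21 : A2 \subset A1. Proof. exact: subsetDl. Qed.

Let xi_gam1 : s%:R * xi + tau / phi <= gam.
Proof.
apply: le_trans xi_gam; rewrite ler_peMl ?addr_ge0 // ler1n.
by rewrite addn2.
Qed.

Let gam_le : gam <= 1 / 32.
Proof.
apply: le_trans gam_k _; rewrite !mul1r lef_pV2 ?posrE ?mulr_gt0 //.
by rewrite ler_peMr.
Qed.

Let xi_le_gam : xi <= gam.
Proof.
have : xi <= s%:R * xi by rewrite ler_peMl ?(ltW xi_gt0) // ler1n.
by have := xi_gam1; have := tau_phi_ge0; lra.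
Qed.

(** This bounds |A| by about n / 4, which leaves at least half of V in B and, later, free in the
    template. *)
Let sd_lo : (4 <= s * d)%N. Proof. exact: leq_ltn_trans k_ge3 k_hi. Qed.
Let sd_hi : (s * d <= 2 * k)%N.
Proof.
move: k_lo; have : (d <= k)%N by rewrite leq_subr.
by case: (s) s_gt0 => // s' _ /=; rewrite mulSn; clear; lia.
Qed.

Let A_hi : #|A|%:R <= n / 4 + 1.
Proof.
have : (4 * #|A| <= #|V| + 4)%N; last first.
  by rewrite -(ler_nat R) natrM natrD; lra.
have h : (s * d * #|A| <= #|V| + s * d)%N.
  by rewrite nE mulnAC -mulnDl leq_mul2r A_m orbT.
have [AV|AV] := leqP #|A| 1%N; first by clear -AV; lia.
suff : (4 * (#|A| - 1) <= #|V|)%N by clear; lia.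
apply: leq_trans (_ : s * d * (#|A| - 1) <= _)%N; first by rewrite leq_mul2r sd_lo orbT.
by rewrite mulnBr muln1; clear -h; lia.
Qed.

Let A_lo : n / (2 * k%:R) <= #|A|%:R.
Proof.
rewrite ler_pdivrMr ?mulr_gt0 // -natrM -natrM ler_nat nE.
apply: leq_trans (_ : s * #|A| * d <= _)%N; first by rewrite leq_mul2r m_A orbT.
by rewrite mulnAC mulnC leq_mul2l sd_hi orbT.
Qed.

Let n_ge16 : (16 <= #|V|)%N.
Proof. by apply: leq_trans n_s; rewrite -mulnA leq_pmulr // muln_gt0 k_gt0. Qed.

Let B_half : n / 2 <= #|B|%:R.
Proof.
have := A_hi; have : n = #|B|%:R + #|A|%:R by rewrite -natrD cardsC.
have : 16 <= n by rewrite (ler_nat R 16).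
by lra.
Qed.

Let alpha_lo : #|A|%:R <= #|A1|%:R + xi * n.
Proof. exact: (card_highdeg_lo k_gt1 V_gt0 codegree A_delta B_half HB). Qed.
Let alpha_hi : #|A1|%:R <= #|A|%:R + xi * n.
Proof. by apply: (card_highdeg_hi k_gt1 V_gt0 HB). Qed.

Let Hmiss : tot_miss R H A1 B1 [::] <= tau * n ^+ k.
Proof. exact: (tot_miss_nil k_gt1 V_gt0 codegree A_delta B_half HB). Qed.

Let V0_few : #|V0|%:R <= tau / phi * n.
Proof.
have Hm : tot_miss R H A1 B1 [::] <= tau * n ^+ (k - size ([::] : seq V)) by rewrite subn0.
have := @atypical_few R k V H A1 B1 V_gt0 k_gt0 [::] 0 phi tau _ phi_gt0 Hm.
rewrite expr1 => /(_ isT); apply: le_trans.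
under eq_bigr do rewrite sum_seqs0.
rewrite -natr_sum ler_nat -big_mkcondr sum1_card; apply: subset_leq_card.
by apply/subsetP => a; rewrite [a \in V0]in_set.
Qed.

Let alpha_split : #|A1| = (#|A2| + #|V0|)%N.
Proof.
have sub : V0 \subset A1 by apply/subsetP => a; rewrite [a \in V0]in_set => /andP[].
by rewrite -(cardsID V0 A1) (setIidPr sub) addnC.
Qed.

(** From sd <= 2k, |A| is at least n / (2k); exchanged and atypical vertices cost at most half of
    this. *)
Let A2_lo : 1 / (4 * k%:R) * n <= #|A2|%:R.
Proof.
have := alpha_split => /(congr1 (fun x => x%:R : R)); rewrite natrD => E.
have h : n / (2 * k%:R) = 2 * (1 / (4 * k%:R) * n) by field; rewrite gt_eqF.
have h2 : gam * n <= 1 / (4 * k%:R) * n.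
  rewrite ler_wpM2r ?(ltW n_gt0) //; apply: le_trans gam_k _.
  by rewrite !mul1r lef_pV2 ?posrE ?mulr_gt0 // ler_pM2r // ler_nat.
have h3 : (xi + tau / phi) * n <= gam * n.
  rewrite ler_wpM2r ?(ltW n_gt0) //; apply: le_trans xi_gam1.
  by rewrite lerD2r ler_peMl ?(ltW xi_gt0) // ler1n.
have := A_lo; have := alpha_lo; have := V0_few; rewrite h.
move: h2 h3 E; rewrite mulrDl; lra.
Qed.

(** With s windows for each vertex of A1, g windows would be lacking or y would be in excess. Each
    edge gadget adds one window and each short segment saves one. The deficit q bounds from below
    the codegree into B1. *)
Let g := (m - s * #|A1|)%N.
Let y := (s * #|A1| - m)%N.
Let q := (delta - #|A1|)%N.

Let g_few : g%:R <= s%:R * xi * n.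
Proof.
have : (g + s * #|A1| <= s * #|A| \/ g = 0)%N.
  by rewrite /g; move: m_A; clear; lia.
case=> [|->]; last by rewrite mulr_ge0 ?ler0n.
rewrite -(ler_nat R) natrD !natrM; have := ler_wpM2l (ler0n R s) alpha_lo.
by rewrite mulrDr mulrA; lra.
Qed.

Let y_few : y%:R <= s%:R * xi * n + s%:R.
Proof.
have : (y + s * #|A| <= s * #|A1| + s \/ y = 0)%N.
  by rewrite /y; move: A_m; clear; lia.
case=> [|->]; last by apply: addr_ge0; [apply: mulr_ge0 | apply: ler0n].
rewrite -(ler_nat R) !natrD !natrM; have := ler_wpM2l (ler0n R s) alpha_hi.
by rewrite mulrDr mulrA; lra.
Qed.

Let g_q : (g <= s * q)%N.
Proof.
have : (m <= s * delta)%N by apply: leq_trans m_A _; rewrite leq_mul2l A_delta orbT.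
by rewrite /g /q mulnBr; clear; lia.
Qed.

Definition gadget_vertices (p : nat * (V * seq V * V)) := p.2.1.1 :: rcons p.2.1.2 p.2.2.

Local Notation flat gs := (flatten (map gadget_vertices gs)).

(** Here r lists the vertices of V0 absorbed so far. The third clause keeps the rest of V0
    untouched, and the fourth makes the final count of windows exact. *)
Let inv (r : seq V) (gs : seq (nat * (V * seq V * V))) :=
  [/\ uniq (flat gs),
      forall p, p \in gs -> [/\ good_gadget d s H B1 phi p.1 p.2.1.1 p.2.1.2 p.2.2,
         (p.1 <= s)%N, p.2.1.1 \in A2 & p.2.2 \in A2],
      forall x, x \in flat gs -> [|| x \in r, x \in A2 | x \in B1] &
      count (mem A2) (flat gs) = (2 * size gs)%N].

Let inv_cons r r' gs h a c a' :
  inv r gs -> {subset r <= r'} -> good_gadget d s H B1 phi h a c a' -> (h <= s)%N ->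
  a \in A2 :\: [set x in flat gs] -> a' \in A2 :\: [set x in flat gs] ->
  (forall x, x \in c -> [/\ x \notin flat gs, x \notin A2 & (x \in r') || (x \in B1)]) ->
  inv r' ((h, (a, c, a')) :: gs).
Proof.
move=> [ugs ggs sgs cgs] rr' gg hs /setDP[aA aQ] /setDP[a'A a'Q] cP.
rewrite in_set in aQ; rewrite in_set in a'Q.
have [_ _ uc _ _] := gg.
split.
- rewrite [flat _]/= -cat_cons cat_uniq uc ugs andbT /=; apply/hasPn => x xgs.
  rewrite inE mem_rcons inE; apply/negP => /or3P[/eqP E|/eqP E|/cP[]].
  + by rewrite -E xgs in aQ.
  + by rewrite -E xgs in a'Q.
  + by rewrite xgs.
- move=> p; rewrite in_cons => /orP[/eqP->|/ggs //].
  split; [exact: gg|exact: hs|exact: aA|exact: a'A].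
- move=> x; rewrite [flat _]/= -cat_cons mem_cat => /orP[|/sgs]; last first.
    by case/or3P => [/rr' xx|xx|xx]; apply/or3P; [apply: Or31|apply: Or32|apply: Or33].
  rewrite inE mem_rcons inE => /or3P[/eqP->|/eqP->|/cP[_ _ /orP[->|->]]] //;
    by rewrite ?aA ?a'A ?orbT.
rewrite [flat _]/= -cat_cons count_cat cgs /= -cats1 count_cat /= aA a'A.
rewrite (_ : count _ c = 0%N); first by clear; lia.
apply/eqP; rewrite -leqn0 leqNgt -has_count; apply/hasPn => x /cP[_ xA _].
exact: xA.
Qed.

Let size_flat r gs : inv r gs -> (size (flat gs) <= size gs * (2 * k + 2))%N.
Proof.
case=> _ ggs _ _; rewrite size_flatten /shape -map_comp.
elim: gs ggs => [|p gs IH] //= ggs; rewrite mulSn leq_add ?IH //; last first.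
  by move=> p' p'gs; apply: ggs; rewrite inE p'gs orbT.
have [[_ szc _ _ _] ps _ _] := ggs p (mem_head _ _).
rewrite size_rcons szc; have : (p.1.-1 * d <= s.-1 * d)%N.
  by rewrite leq_mul2r; apply/orP; right; case: (p.1) ps; case: (s); clear=> //=; lia.
by move: k_lo; move: (p.1.-1 * d)%N (s.-1 * d)%N; clear; lia.
Qed.

Let flat_few r gs : inv r gs -> (size gs <= g + #|V0|)%N ->
  #|[set x in flat gs]|%:R <= gam * n.
Proof.
move=> igs szgs; apply: le_trans (_ : (size gs * (2 * k + 2))%:R <= _).
  by rewrite ler_nat cardsE (leq_trans (card_size _)) // (size_flat igs).
rewrite natrM; apply: le_trans (_ : (s%:R * xi + tau / phi) * n * (2 * k + 2)%:R <= _).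
  rewrite ler_wpM2r ?ler0n // mulrDl; apply: le_trans (_ : (g + #|V0|)%:R <= _).
    by rewrite ler_nat.
  by rewrite natrD lerD // g_few.
by rewrite mulrC mulrA ler_wpM2r ?(ltW n_gt0).
Qed.

Let eps_gt0 j : 0 < eps j. Proof. by rewrite mulr_gt0 // exprn_gt0. Qed.

Let eps_min j : eps 0 <= eps j.
Proof.
rewrite /eps ler_wpM2l ?(ltW phi_gt0) // ler_wiXn2l ?(ltW kap_gt0) //.
by rewrite subn0 leq_subr.
Qed.

Let u := (k%:R ^+ 2)^-1 : R.
Let u_gt0 : 0 < u. Proof. by rewrite invr_gt0 exprn_gt0. Qed.

Let gam_al : gam <= 1 / (4 * k%:R).
Proof.
apply: le_trans gam_k _; rewrite !mul1r lef_pV2 ?posrE ?mulr_gt0 //.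
by rewrite ler_pM2r // ler_nat.
Qed.

Let al_gam : u / 64 <= (1 / (4 * k%:R) - gam) ^+ 2.
Proof.
have -> : u / 64 = (1 / (8 * k%:R)) ^+ 2 by rewrite /u; field; rewrite gt_eqF.
have E : 1 / (4 * k%:R) - 1 / (8 * k%:R) = 4 * (1 / (32 * k%:R)) :> R by field; rewrite gt_eqF.
have p : 0 < 1 / (8 * k%:R) :> R by rewrite divr_gt0 // mulr_gt0.
have p2 : 0 < 1 / (32 * k%:R) :> R by rewrite divr_gt0 // mulr_gt0.
have le : 1 / (8 * k%:R) <= 1 / (4 * k%:R) - gam by move: gam_k E p2; lra.
by rewrite lerXn2r ?nnegrE // ?(ltW p) // (le_trans (ltW p) le).
Qed.

Let cw_ge0 : 0 <= cw. Proof. by rewrite divr_ge0 ?mulr_ge0 ?ler0n // ltW. Qed.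

Let cT_gt0 : 0 < cT.
Proof.
rewrite /cT !divr_gt0 // mulr_gt0 ?divr_gt0 // exprn_gt0 // divr_gt0 //.
by rewrite mulr_gt0.
Qed.

(** The right side is at least eps j / (256 k^2), from 1 / (64 k^2) times eps j / 4; each term on
    the left is at most eps j / (1024 k^2). *)
Let edge_room j : gam + (2 * s)%:R * (kap * eps j / phi) <
  (1 / (4 * k%:R) - gam) ^+ 2 * (eps j / 2 - k%:R * gam).
Proof.
have e0 := eps_gt0 j; have em := eps_min j.
have h1 : gam <= eps j * u / 1024.
  apply: le_trans gam_eps2 _.
  have -> : eps 0 / (1024 * k%:R ^+ 2) = eps 0 * (u / 1024) by rewrite /u; field; rewrite gt_eqF.
  by rewrite -[leRHS]mulrA ler_wpM2r // divr_ge0 // ltW.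
have h2 : (2 * s)%:R * (kap * eps j / phi) <= eps j * u / 1024.
  have -> : (2 * s)%:R * (kap * eps j / phi) = eps j * ((2 * s)%:R * (kap / phi)) by ring.
  rewrite -[leRHS]mulrA ler_wpM2l ?(ltW e0) //; apply: le_trans kap_small _.
  by rewrite le_eqVlt; apply/orP; left; apply/eqP; rewrite /u; field; rewrite gt_eqF.
have h3 : eps j / 4 <= eps j / 2 - k%:R * gam by move: gam_eps em e0; lra.
have h4 : u / 64 * (eps j / 4) <= (1 / (4 * k%:R) - gam) ^+ 2 * (eps j / 2 - k%:R * gam).
  apply: ler_pM => //; first by rewrite divr_ge0 // ltW.
  by rewrite divr_ge0 // ltW.
have p : 0 < eps j * u by rewrite mulr_gt0.
move: h1 h2 h4 p; lra.
Qed.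

Let M := (s.-1 * d + k.-1)%N.
Let M_hi : (M <= 2 * k)%N. Proof. by rewrite /M; move: k_lo; clear; lia. Qed.

Let Mgam : M%:R * gam <= cT / 2.
Proof.
apply: le_trans gam_cT; rewrite ler_wpM2r ?(ltW gam_gt0) // ler_nat; exact: M_hi.
Qed.

Let vertex_room : gam + (2 * s)%:R * (tau / phi) <
  (1 / (4 * k%:R) - gam) ^+ 2 * (cT - M%:R * gam).
Proof.
have h1 : (2 * s)%:R * (tau / phi) <= (2 * s)%:R * gam.
  by rewrite ler_wpM2l ?ler0n //; move: xi_gam1 s_xi_ge0; lra.
have h2 : gam + (2 * s)%:R * gam <= cT * u / 512.
  have -> : gam + (2 * s)%:R * gam = (1 + 2 * s)%:R * gam by rewrite natrD mulrDl mul1r.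
  apply: le_trans gam_cT2 _.
  by rewrite le_eqVlt; apply/orP; left; apply/eqP; rewrite /u; field; rewrite gt_eqF.
have h3 : u / 64 * (cT / 2) <= (1 / (4 * k%:R) - gam) ^+ 2 * (cT - M%:R * gam).
  apply: ler_pM => //; [by rewrite divr_ge0 // ltW|by rewrite divr_ge0 // ltW|].
  by move: Mgam; lra.
have p : 0 < cT * u by rewrite mulr_gt0.
move: h1 h2 h3 p; lra.
Qed.

Let B1_half : n / 2 <= #|B1|%:R.
Proof.
have := alpha_hi; have := A_hi; have : n = #|A1|%:R + #|B1|%:R by rewrite -natrD cardsC.
have h : xi * n <= 1 / 32 * n.
  by rewrite ler_wpM2r ?(ltW n_gt0) // (le_trans xi_le_gam).
have : 16 <= n by rewrite (ler_nat R 16).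
move: h; lra.
Qed.

Let uniq_many : 1 / 2 ^+ k * n ^+ k.-1 <= cnt R B1 k.-1 (fun t => uniq t).
Proof.
have := cnt_true R B1 k.-1 (fun t => uniq t); set X := (n / 2) ^+ k.-1.
have h1 : X <= #|B1|%:R ^+ k.-1 by rewrite lerXn2r ?nnegrE ?divr_ge0 ?ler0n.
have E : 1 / 2 ^+ k * n ^+ k.-1 = X / 2.
  have -> : 2 ^+ k = 2 * 2 ^+ k.-1 :> R by rewrite -exprS prednK.
  by rewrite /X expr_div_n; field; rewrite gt_eqF ?exprn_gt0.
have h2 : cnt R B1 k.-1 (fun t => ~~ uniq t) <= X / 2.
  rewrite -E -(ler_pM2l n_gt0).
  have h := cnt_not_uniq R k.-1 (max_card (mem B1)) (isT : uniq ([::] : seq V)).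
  apply: le_trans h _.
  rewrite mulrA [n * _]mulrC ler_wpM2r ?exprn_ge0 ?ler0n // add0n.
  by apply: le_trans n_pow; rewrite ler_nat -mulnn leq_mul // leq_pred.
rewrite E; lra.
Qed.

(** Edge gadgets precede vertex gadgets: they can only avoid a number of used vertices of order q,
    while V0 may have size linear in n. This is why the exact size of [flat gs] is tracked. *)
Let edge_stage i : (i <= g)%N ->
  exists gs, [/\ inv [::] gs, size gs = i, sumn (map fst gs) = i &
    size (flat gs) = ((k + 2) * i)%N].
Proof.
elim: i => [|i IH] ig; first by exists [::]; rewrite muln0; split.
have [gs [igs szgs hgs szf]] := IH (ltnW ig).
have q_gt0 : (0 < q)%N.
  by rewrite lt0n; apply: contraTneq (leq_trans ig g_q) => ->; rewrite muln0.
have alpha_delta : (#|A1| <= delta)%N by move: q_gt0; rewrite /q; clear; lia.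
have HQ : #|[set x in flat gs]|%:R <= gam * n.
  by apply: (flat_few igs); rewrite szgs (leq_trans (ltnW ig)) // leq_addr.
have codeg0 S : size S = k.-1 -> uniq S -> all (mem B1) S ->
    \sum_(a in A1) (~~ edge (a :: S))%:R <= 0 + \sum_(b in B1) (edge (b :: S))%:R :> R.
  by move=> szS uS _; apply: (codegree_miss k_gt1 codegree) => //; rewrite addr0 ler_nat.
have codegq S : size S = k.-1 -> uniq S -> all (mem B1) S ->
    q%:R <= \sum_(b in B1) (edge (b :: S))%:R :> R.
  move=> szS uS _.
  have := @codegree_miss R k V H k_gt1 delta codegree A1 (#|A1|%:R - delta%:R) S _ szS uS.
  have : 0 <= \sum_(a in A1) (~~ edge (a :: S))%:R :> R.
    by apply: sumr_ge0 => *; apply: ler0n.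
  have le : #|A1|%:R <= delta%:R + (#|A1|%:R - delta%:R) :> R by rewrite addrC subrK.
  by rewrite /q natrB // => h0 /(_ le)/(le_trans h0) h1; lra.
have eps_step i' j : (i' < j <= k)%N -> eps i' <= kap * eps j.
  move=> /andP[ij jk]; rewrite /eps mulrCA -exprS ler_wpM2l ?(ltW phi_gt0) //.
  by rewrite ler_wiXn2l ?(ltW kap_gt0) //; clear -ij jk; lia.
have eps_k : eps k <= 2.
  rewrite /eps subnn expr0 mulr1.
  have p4 : 1 <= k%:R * k%:R * 4 ^+ k :> R.
    by rewrite mulr_ege1 ?exprn_ege1 ?mulr_ege1 // ler1n.
  have := ler_wpM2r (ltW phi_gt0) p4; move: phi_small; rewrite mul1r !mulrA; lra.
have eps_n j : (j < k)%N -> (k ^ 2)%:R <= eps j / 2 * n.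
  move=> _; apply: le_trans n_eps _; rewrite ler_wpM2r ?(ltW n_gt0) //.
  by have := eps_min j; lra.
have link_small b : b \in B1 ->
    cnt R B1 k.-1 (fun t => edge (b :: t)) < eps 1 / 2 * n ^+ k.-1.
  move=> bB; apply: le_lt_trans (lowdeg_degree k_gt1 V_gt0 codegree A_delta B_half HB
    xi_gt0 eta_gt0 xi_eta n_xi eta_pow Delta_small bB) _.
  by rewrite ltr_pM2r ?exprn_gt0 //; move: eta_eps; lra.
have gam_eps' j : (j <= k)%N -> k%:R * gam <= eps j / 2.
  by move=> _; have := eps_min j; have := eps_gt0 0; move: gam_eps; lra.
have HN : (#|[set x in flat gs] :&: B1| <= (k + 2) * g)%N.
  apply: leq_trans (subset_leq_card (subsetIl _ _)) _.
  by rewrite cardsE (leq_trans (card_size _)) // szf leq_mul2l (ltnW ig) orbT.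
(* By g <= s q, the factor q cancels and [eta_match] compares constants only. *)
have Hlt : (k * ((k + 2) * g))%:R * (2 * eta) < q%:R * (1 / 2 ^+ k).
  apply: le_lt_trans (_ : q%:R * ((k * (k + 2) * s)%:R * (2 * eta)) < _); last first.
    by rewrite ltr_pM2l // ltr0n.
  rewrite [leRHS]mulrA -natrM ler_wpM2r ?mulr_ge0 ?(ltW eta_gt0) // ler_nat.
  rewrite mulnA [leqRHS]mulnC -[leqRHS]mulnA; apply: leq_mul => //; exact: g_q.
have [a [c [a' [gg cB aA a'A]]]] := @edge_gadget R k d s V H A1 B1 k_lo k_hi V_gt0 AB1
  A2 [set x in flat gs] phi kap (1 / (4 * k%:R)) gam gam eps A21 HQ A2_lo n_gam phi_gt0 gam_al
  (ltW kap_gt0) codeg0 eps_gt0 eps_step eps_k eps_n link_small gam_eps' (fun j _ => edge_room j)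
  q ((k + 2) * g)%N (2 * eta) (1 / 2 ^+ k) codegq
  (fun b bB => lowdeg_degree k_gt1 V_gt0 codegree A_delta B_half HB
    xi_gt0 eta_gt0 xi_eta n_xi eta_pow Delta_small bB) uniq_many HN
  (mulr_ge0 (ler0n _ 2) (ltW eta_gt0)) Hlt.
exists ((1%N, (a, c, a')) :: gs); split; rewrite /= ?szgs ?hgs //.
  apply: (inv_cons igs) => // x /(allP cB) /setDP[xB xQ]; split.
  - by rewrite in_set in xQ.
  - by apply: contraL xB => /(subsetP A21) xA; rewrite in_setC xA.
  - by rewrite xB orbT.
have [_ szc _ _ _] := gg.
by rewrite size_cat size_rcons szc szf mulnS; clear; lia.
Qed.

(** A link of positive density leaves room to avoid gam n used vertices. With h = s such a gadget
    carries 3s windows for three vertices of A1, so the balance between m and s |A1| is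
    unchanged. *)
Let vertex_stage r : uniq r -> {subset r <= V0} ->
  exists gs, [/\ inv r gs, size gs = (size r + g)%N, {subset r <= flat gs} &
    sumn (map fst gs) = (s * size r + g)%N].
Proof.
elim: r => [|v r IH] ur rV.
  have [gs [igs szgs hgs _]] := edge_stage (leqnn g).
  by exists gs; split; rewrite ?szgs ?hgs ?muln0.
move: ur => /= /andP[vr ur].
have rV' : {subset r <= V0} by move=> x xr; apply: rV; rewrite inE xr orbT.
have [gs [igs szgs rgs hgs]] := IH ur rV'.
have vV : v \in V0 by apply: rV; rewrite mem_head.
have vA : v \in A1 by move: vV; rewrite in_set => /andP[].
have vA2 : v \notin A2 by rewrite in_setD vV.
have szV0 : (size (v :: r) <= #|V0|)%N.
  rewrite -(card_uniqP _) /= ?vr //; exact/subset_leq_card/subsetP.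
have HQ : #|[set x in flat gs]|%:R <= gam * n.
  apply: (flat_few igs); rewrite szgs addnC leq_add2l; exact: ltnW.
have [ugs ggs sgs cgs] := igs.
have cw_eta : (s.-1 * d).+1%:R * cw <= eta / 2 / 2.
  apply: le_trans (_ : k%:R * cw <= _); first by rewrite ler_wpM2r // ler_nat.
  by rewrite le_eqVlt; apply/orP; left; apply/eqP; rewrite /cw; field; rewrite gt_eqF.
have n_cT' : (M ^ 2)%:R <= cT * n by apply: le_trans n_cT; rewrite ler_nat leq_exp2r.
have MgT : M%:R * gam <= cT by move: Mgam cT_gt0; lra.
have [a [c [a' [gg cB vc aA a'A]]]] := @vertex_gadget R k d s V H A1 B1 k_lo k_hi s_gt1 V_gt0 AB1
  A2 [set x in flat gs] phi (1 / (4 * k%:R)) gam gam (eta / 2) cw tau v A21 HQ A2_lo n_gam phi_gt0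
  gam_al tau_ge0 k_gt1 vA vA2 Hmiss
  (highdeg_degree k_gt1 V_gt0 HB xi_gt0 eta_gt0 xi_eta Delta_small vA)
  cw_ge0 cw_eta n_cT' MgT vertex_room.
have vQ : v \notin flat gs.
  apply/negP => /sgs; rewrite (negbTE vr) (negbTE vA2) /=.
  by rewrite in_setC vA.
exists ((s, (a, c, a')) :: gs); split; rewrite /= ?szgs ?hgs //.
- apply: (inv_cons igs) => //.
    by move=> x xr; rewrite inE xr orbT.
  move=> x /(allP cB) /= /setU1P[->|/setDP[xB xQ]].
    by rewrite mem_head.
  split; first by rewrite in_set in xQ.
    by apply: contraL xB => /(subsetP A21) xA; rewrite in_setC xA.
  by rewrite xB orbT.
- move=> x; rewrite inE => /predU1P[->|/rgs xx].
    by rewrite inE mem_cat mem_rcons inE vc !orbT.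
  by rewrite inE mem_cat xx !orbT.
by rewrite mulnS addnA.
Qed.

Lemma hamilton_of_extremal : has_hamilton_lcycle l H.
Proof.
have [gs [igs szgs Vgs hgs]] := vertex_stage (enum_uniq V0) (fun x => etrans (esym (mem_enum V0 x))).
have [ugs ggs sgs cgs] := igs; rewrite -cardE in szgs hgs.
pose rest := [seq a <- enum A2 | a \notin flat gs].
have urest : uniq rest by rewrite filter_uniq ?enum_uniq.
have gs_few : (size gs)%:R <= gam * n.
  rewrite szgs natrD; have := ler_wpM2r (ltW n_gt0) xi_gam1; rewrite mulrDl.
  by have := V0_few; have := g_few; lra.
have size_rest : (size rest + 2 * size gs = #|A2|)%N.
  rewrite -cgs -size_filter addnC cardE -(count_predC (mem (flat gs)) (enum A2)).
  rewrite -!size_filter; congr (_ + _)%N; apply/perm_size/uniq_perm.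
  - exact: filter_uniq.
  - by rewrite filter_uniq ?enum_uniq.
  by move=> x; rewrite [LHS]mem_filter [RHS]mem_filter mem_enum andbC.
have y_rest : (y <= size rest)%N.
  suff : (y + 2 * size gs <= #|A2|)%N by move: size_rest; clear; lia.
  rewrite -(ler_nat R) natrD natrM.
  have h1 : s%:R <= 1 / (16 * k%:R) * n.
    by rewrite mul1r ler_pdivlMl ?mulr_gt0 // -!natrM ler_nat.
  have h2 : gam * n <= 1 / (32 * k%:R) * n by rewrite ler_wpM2r ?(ltW n_gt0).
  have h3 : s%:R * xi * n <= gam * n.
    by rewrite ler_wpM2r ?(ltW n_gt0) //; move: xi_gam1 tau_phi_ge0; lra.
  have E1 : 1 / (16 * k%:R) * n = 2 * (1 / (32 * k%:R) * n) by field; rewrite gt_eqF.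
  have E2 : 1 / (4 * k%:R) * n = 8 * (1 / (32 * k%:R) * n) by field; rewrite gt_eqF.
  have := A2_lo; have := y_few; rewrite E2; rewrite E1 in h1.
  have p : 0 <= 1 / (32 * k%:R) * n by rewrite mulr_ge0 ?divr_ge0 ?mulr_ge0 ?ler0n.
  move: gs_few h1 h2 h3 p; lra.
have restA x : x \in rest -> x \in A2.
  by rewrite /rest mem_filter => /andP[_]; rewrite mem_enum.
have vsE : flatten (map (@seg_vertices V) (map (@gadget_seg V) gs ++
    map (@Full V) (drop y rest) ++ map (@Short V) (take y rest))) =
    flat gs ++ (drop y rest ++ take y rest).
  rewrite !map_cat !flatten_cat -!map_comp; congr (_ ++ (_ ++ _)).
    by rewrite flatten_map1 map_id.
  by rewrite flatten_map1 map_id.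
have pvs : perm_eq (flat gs ++ (drop y rest ++ take y rest)) (flat gs ++ rest).
  by rewrite perm_cat2l perm_catC cat_take_drop.
have szvs : size (flat gs ++ (drop y rest ++ take y rest)) = (size (flat gs) + size rest)%N.
  by rewrite (perm_size pvs) size_cat.
apply: (@hamilton_of_segments R k l s V H A1 A2 k_lo k_hi s_gt1 l_k k_gt1 V_gt0 A21 phi (4 * eta) m
  gs (drop y rest) (take y rest)) => //.
- exact: ltW.
- by move=> a /setDP[aA aV]; apply: contra aV => at_; rewrite in_set aA.
- move=> b bB; exact: (lowdeg_tot_miss k_gt1 V_gt0 codegree A_delta B_half HB xi_gt0 eta_gt0 xi_eta n_xi eta_pow Delta_small bB).
- by move=> x /mem_drop /restA.
- by move=> x /mem_take /restA.
- rewrite vsE (perm_uniq pvs) cat_uniq ugs urest andbT; apply/hasPn => x.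
  by rewrite mem_filter => /andP[].
- rewrite vsE => x xA; rewrite (perm_mem pvs) mem_cat.
  have [//|xf] := boolP (x \in flat gs); rewrite mem_filter xf mem_enum in_setD xA andbT.
  by apply: contra xf => xV; apply: Vgs; rewrite mem_enum.
- rewrite !map_cat !sumn_cat -!map_comp.
  have -> : sumn (map (seg_len s \o @Full V) (drop y rest)) = (s * (size rest - y))%N.
    rewrite -size_drop mulnC; elim: (drop y rest) => //= x r ->; by rewrite mulSn.
  have -> : sumn (map (seg_len s \o @Short V) (take y rest)) = (s.-1 * y)%N.
    rewrite -[in RHS](size_takel y_rest) mulnC; elim: (take y rest) => //= x r ->.
    by rewrite mulSn.
  have -> : sumn (map (seg_len s \o @gadget_seg V) gs) = (2 * s * size gs + sumn (map fst gs))%N.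
    by elim: (gs) => [|p ps IH] /=; rewrite ?muln0 // IH mulnS; clear; lia.
  (* Gadgets carry 2s windows each, plus s per vertex of V0, plus g; the other segments carry s *
     size rest - y. The total is s |A1| + g - y = m. *)
  rewrite hgs; have E : (s * #|A1| = s * size rest + 2 * s * size gs + s * #|V0|)%N.
    by rewrite alpha_split -size_rest !mulnDr; clear; lia.
  have sy : (s * y = s.-1 * y + y)%N by rewrite -mulSnr prednK.
  have sr : (s * y <= s * size rest)%N by rewrite leq_mul2l y_rest orbT.
  rewrite mulnBr; move: E sy sr; rewrite /g /y.
  move: (s * #|A1|)%N (s * size rest)%N (s * #|V0|)%N => x1 x2 x3.
  clear; lia.
- apply: leq_trans n_s; apply: leq_trans (leq_pmulr (16 * k) s_gt0).
  by rewrite leq_mul2r orbT.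
- rewrite vsE szvs; suff : (2 * (size (flat gs) + size rest) <= #|V|)%N by clear; lia.
  have f1 : (size (flat gs))%:R <= gam * n.
    have := flat_few igs; rewrite szgs addnC leqnn cardsE (card_uniqP ugs); exact.
  have f2 : (size rest)%:R <= #|A1|%:R :> R.
    by rewrite ler_nat alpha_split -size_rest; clear; lia.
  rewrite -(ler_nat R) natrM natrD.
  have g1 : gam * n <= 1 / 32 * n by rewrite ler_wpM2r ?(ltW n_gt0).
  have g2 : xi * n <= gam * n by rewrite ler_wpM2r ?(ltW n_gt0).
  have : 16 <= n by rewrite (ler_nat R 16).
  move: alpha_hi A_hi f1 f2 g1 g2; lra.
have h1 : k%:R * ((3 * s * size gs)%:R * (k%:R * 4 ^+ k)) <= 1 / 16 * n.
  apply: le_trans (_ : (3 * s * k * k)%:R * 4 ^+ k * gam * n <= _); last by rewrite ler_wpM2r ?(ltW n_gt0).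
  have -> : k%:R * ((3 * s * size gs)%:R * (k%:R * 4 ^+ k)) = (3 * s * k * k)%:R * 4 ^+ k * (size gs)%:R :> R.
    by rewrite !natrM; ring.
  by rewrite -[leRHS]mulrA ler_wpM2l // mulr_ge0 ?exprn_ge0 ?ler0n.
have h2 : k%:R * (s%:R * k%:R * 4 ^+ k * (4 * eta) * n) <= 1 / 16 * n.
  apply: le_trans (_ : (k * s * k)%:R * 4 ^+ k * (4 * eta) * n <= _); last by rewrite ler_wpM2r ?(ltW n_gt0).
  by rewrite !natrM le_eqVlt; apply/orP; left; apply/eqP; ring.
rewrite mulrDr; move: h1 h2; lra.
Qed.

End Extremal.

Unset Implicit Arguments.
Set Strict Implicit.
Set Printing Implicit Defensive.

(** * Choice of the constants *)

(** Each constant is taken below finitely many linear bounds, listed at once; a + 1 in the proof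
    covers the coefficient a = 0. *)
Lemma exists_small (R : realFieldType) (cs : seq (R * R)) :
  all (fun c => (0 <= c.1) && (0 < c.2)) cs ->
  exists2 x : R, 0 < x & all (fun c => c.1 * x <= c.2) cs.
Proof.
elim: cs => [|[a b] cs IH] /=; first by exists 1.
case/andP=> /andP[a0 b0] acs; have [x x0 xcs] := IH acs.
have a1 : 0 < a + 1 by lra.
set z := Num.min x (b / (a + 1)).
have z0 : 0 < z by rewrite lt_min x0 divr_gt0.
have zx : z <= x by rewrite ge_min lexx.
have zb : (a + 1) * z <= b by rewrite -ler_pdivlMl // mulrC ge_min lexx orbT.
exists z => //; apply/andP; split; first by lra.
apply/allP => c cin; have /andP[c0 _] := allP acs c cin.
by apply: le_trans (allP xcs c cin); rewrite ler_wpM2l.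
Qed.

Lemma exists_large (R : realType) (cs : seq (R * R)) :
  all (fun c => 0 < c.2) cs ->
  exists n0 : nat, forall n, (n0 <= n)%N -> all (fun c => c.1 <= c.2 * n%:R) cs.
Proof.
elim: cs => [|[a b] cs IH] /=; first by exists 0%N.
case/andP=> b0 /IH[n0 Hn0]; exists (maxn n0 (Num.bound (`|a| / b))) => n.
rewrite geq_max => /andP[n0n bn]; rewrite Hn0 // andbT.
apply: le_trans (ler_norm _) _; rewrite -ler_pdivrMl // mulrC.
apply: le_trans (ltW (archi_boundP _)) _; first by rewrite divr_ge0 // ltW.
by rewrite ler_nat.
Qed.

Lemma s_paramE (k l : nat) : (l < k)%N -> ~~ (k - l %| k)%N ->
  s_param k l = (k %/ (k - l)).+1.
Proof.
move=> lk nd; set d := (k - l)%N; have d0 : (0 < d)%N by rewrite subn_gt0.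
have r0 : (0 < k %% d)%N by rewrite lt0n.
have r1 := ltn_pmod k d0; have kE := divn_eq k d.
rewrite /s_param -/d (@ceil_def _ _ ((k %/ d).+1%:Z)) //.
have dR : 0 < d%:R :> rat by rewrite ltr0n.
apply/andP; split.
  rewrite -addn1 PoszD addrK ltr_pdivlMr // -[_%:~R]/((k %/ d)%:R) -natrM ltr_nat.
  by move: r0 kE; clear; lia.
rewrite ler_pdivrMr // -[_%:~R]/((k %/ d).+1%:R) -natrM ler_nat.
by move: r1 kE; rewrite mulSn; clear; lia.
Qed.

Lemma min_codeg_le (k : nat) (V : finType) (H : kgraph k V) (S : {set V}) :
  #|S| = k.-1 -> (min_codeg H <= codeg H S)%N.
Proof.
move=> cS; rewrite /min_codeg; have := mem_index_enum S.
elim: (index_enum _) => // S' r IH; rewrite inE big_cons => /predU1P[<-|/IH h].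
  by rewrite cS eqxx geq_minl.
by case: ifP => // _; rewrite (leq_trans (geq_minr _ _) h).
Qed.

Theorem theorem1p7 (R : realType) (k l : nat)
    (k_ge3 : (3 <= k)%N) (l_gt : (k < 2 * l)%N) (l_lt : (l < k)%N)
    (ndvd : ~~ (k - l %| k)%N) :
  exists2 Delta : R, 0 < Delta &
  exists n0 : nat, forall n : nat, (n0 <= n)%N -> (k - l %| n)%N ->
  forall (V : finType) (H : kgraph k V), #|V| = n ->
    extremal l Delta H ->
    ((k%:R / 2 < l%:R :> R /\ l%:R < 3 * k%:R / 4 :> R) /\
       n%:R / (s_param k l * (k - l))%:R <= (min_codeg H)%:R :> R
     \/
     (k%:R / 2 < l%:R :> R /\ (l < k)%N) /\
       n%:R / (s_param k l * (k - l))%:R + k%:R ^+ 2 / 2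
         <= (min_codeg H)%:R :> R) ->
    has_hamilton_lcycle l H.
Proof.
have sE := s_paramE k l l_lt ndvd.
set d := (k - l)%N in ndvd sE *; set s := s_param k l in sE *.
have d0 : (0 < d)%N by rewrite subn_gt0.
have dk : (d <= k)%N by rewrite leq_subr.
have k_lo : (s.-1 * d < k)%N.
  rewrite sE /=; have := divn_eq k d; have : (0 < k %% d)%N by rewrite lt0n.
  by clear; lia.
have k_hi : (k < s * d)%N by rewrite sE ltn_ceil.
have s_gt1 : (1 < s)%N by rewrite sE ltnS divn_gt0.
have k0 : 0 < k%:R :> R by rewrite ltr0n (leq_trans _ k_ge3).
have s0 : 0 < s%:R :> R by rewrite ltr0n ltnW.
have p2 : 0 < 1 / 2 ^+ k :> R by rewrite divr_gt0 // exprn_gt0.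
have p4 : 0 < 4 ^+ k :> R by rewrite exprn_gt0.
pose phi : R := 1 / (8 * k%:R ^+ 2 * 4 ^+ k).
have phi0 : 0 < phi by rewrite divr_gt0 // !mulr_gt0 // exprn_gt0.
have k1024 : 0 < 1 / (1024 * k%:R ^+ 2) :> R by rewrite divr_gt0 // mulr_gt0 // exprn_gt0.
have [|kap kap0 /and3P[kap1 kap2 _]] :=
  exists_small R [:: (1, 1); ((2 * s)%:R / phi, 1 / (1024 * k%:R ^+ 2) : R)].
  by rewrite /= ler01 ltr01 k1024 divr_ge0 ?ler0n // ltW.
pose eps j := phi * kap ^+ (k - j).
have eps0 j : 0 < eps j by rewrite mulr_gt0 // exprn_gt0.
have [|eta eta0 /and5P[eta1 eta2 eta3 eta4 _]] :=
  exists_small R [:: (8, eps 1); (1, 1 / 2 ^+ k);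
    ((k * (k + 2) * s)%:R * 4, 1 / 2 ^+ k); ((k * s * k)%:R * 4 ^+ k * 4, 1 / 16 : R)].
  by rewrite /= eps0 p2 ler01 ler0n !mulr_ge0 ?ler0n // ?ltW //= divr_gt0.
pose cw := eta / (4 * k%:R); pose cT := eta / 2 / 2 * cw ^+ (s.-1 * d).+1 / 2.
have cw0 : 0 < cw by rewrite divr_gt0 // mulr_gt0.
have cT0 : 0 < cT by rewrite !(divr_gt0, mulr_gt0) // exprn_gt0.
have [|gam gam0 /and4P[gam1 gam2 gam3 /and4P[gam4 gam5 gam6 _]]] :=
  exists_small R [:: (1, 1 / (32 * k%:R)); (k%:R, eps 0 / 4); (1, eps 0 / (1024 * k%:R ^+ 2));
    ((2 * k)%:R, cT / 2); ((1 + 2 * s)%:R, cT / (512 * k%:R ^+ 2));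
    ((3 * s * k * k)%:R * 4 ^+ k, 1 / 16 : R)].
  rewrite /=; do ?[apply/andP; split]; do ?[by [] | exact: ler0n | exact: ltW p4 |
    apply: divr_gt0 | apply: mulr_gt0 | apply: exprn_gt0 | apply: mulr_ge0 | apply: eps0].
have [|xi xi0 /and3P[xi1 xi2 _]] :=
  exists_small R [:: ((k + 3)%:R, eta / 2); ((2 * k + 2)%:R * (s%:R + (k + 3)%:R / phi), gam)].
  rewrite /=; do ?[apply/andP; split]; do ?[by [] | exact: ler0n | exact: ltW phi0 |
    apply: divr_gt0 | apply: divr_ge0 | apply: addr_ge0 | apply: mulr_ge0].
have xi_pos : 0 < xi / 2 ^+ k / 2 by rewrite !divr_gt0 // exprn_gt0.
have kk0 : 0 < (k ^ k)%:R :> R by rewrite ltr0n expn_gt0 (leq_trans _ k_ge3).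
(* The factor k^k passes from edges in B to ordered tuples. *)
exists (xi * eta / 2 ^+ k / 2 / (k ^ k)%:R).
  by rewrite !divr_gt0 ?exprn_gt0 // mulr_gt0.
have [|n0 Hn0] := exists_large R [:: ((k ^ 2)%:R, xi / 2 ^+ k / 2); (1, gam);
   ((k ^ 2)%:R, eps 0 / 2); (((2 * k) ^ 2)%:R, cT); ((k ^ 2)%:R, 1 / 2 ^+ k);
   ((16 * k * s)%:R, 1); (1, 1)].
  by rewrite /= xi_pos gam0 cT0 p2 ltr01 divr_gt0.
exists n0 => n /Hn0 /and4P[n1 n2 n3 /and5P[n4 n5 n6 n7 _]] dn V H cV [B [cB eB]] hdeg.
have V_gt0 : (0 < #|V|)%N by rewrite cV -(ltr_nat R) (lt_le_trans ltr01) // -[n%:R]mul1r.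
case/dvdnP: dn => m nE; rewrite nE in cV.
have m0 : (0 < m)%N by move: V_gt0; rewrite cV muln_gt0 => /andP[].
have sd0 : 0 < (s * d)%:R :> R by rewrite ltr0n muln_gt0 d0 ltnW.
have deg : n%:R / (s * d)%:R <= (min_codeg H)%:R :> R.
  case: hdeg => [[_ //]|[_]]; apply: le_trans.
  by rewrite lerDl divr_ge0 // exprn_ge0.
have [Alo Ahi Adel] : [/\ (m <= s * #|~: B|)%N, (s * #|~: B| <= m + s)%N & (#|~: B| <= min_codeg H)%N].
  have deg' : (m <= s * min_codeg H)%N.
    move: deg; rewrite nE ler_pdivrMr // -natrM ler_nat mulnA leq_pmul2r //.
    by rewrite mulnC.
  have mE : (m%:R : R) = s%:R * (1 / (s * d)%:R * #|V|%:R).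
    by rewrite cV !natrM; field; rewrite !gt_eqF // ltr0n.
  have VE : #|V|%:R = #|B|%:R + #|~: B|%:R :> R by rewrite -natrD cardsC.
  have fB : (Num.floor ((1 - 1 / (s * d)%:R) * #|V|%:R : R))%:~R = #|B|%:R :> R by rewrite -cB.
  have := floor_le ((1 - 1 / (s * d)%:R) * #|V|%:R : R).
  have := floorD1_gt ((1 - 1 / (s * d)%:R) * #|V|%:R : R).
  rewrite intrD fB mulrBl [1 * #|V|%:R]mul1r; set z := 1 / _ * _ in mE * => f1 f2.
  have h1 : (m <= s * #|~: B|)%N.
    by rewrite -(ler_nat R) natrM mE ler_wpM2l ?ler0n //; move: f2 VE; clear; lra.
  (* |B| is a floor, so |A| < m / s + 1 strictly. With m <= s delta this yields |A| <= delta without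
     any error term. *)
  have h2 : (s * #|~: B| < m + s)%N.
    have : #|~: B|%:R < z + 1 by move: f1 VE; clear; lra.
    by rewrite -(ltr_pM2l s0) mulrDr mulr1 -mE -natrM -natrD ltr_nat.
  split=> //; first exact: ltnW.
  rewrite -ltnS -(ltn_pmul2l (ltnW s_gt1)); apply: leq_trans h2 _.
  by rewrite mulnS addnC leq_add2l.
apply: (@hamilton_of_extremal R k l s m (min_codeg H) V H k_lo k_hi s_gt1 l_lt k_ge3 m0 cV V_gt0
  (@min_codeg_le k V H) B phi kap eta gam xi _ Adel Alo Ahi eB) => //.
- rewrite /phi le_eqVlt; apply/orP; left; apply/eqP; field.
  by rewrite !gt_eqF.
- by move: kap1; rewrite /= mul1r.
- by apply: le_trans kap2; rewrite /= mulrA mulrAC.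
- by apply: lt_le_trans eta1; rewrite ltr_pM2r // ltr_nat.
- by move: eta2; rewrite /= mul1r.
- have : 0 < (k * (k + 2) * s)%:R * (2 * eta).
    by rewrite !mulr_gt0 // ltr0n !muln_gt0 addn2 (ltnW s_gt1) (leq_trans _ k_ge3).
  by move: eta3 => /=; clear; lra.
- by move: eta4; rewrite /= !mulrA.
- by move: gam1; rewrite /= mul1r.
- by move: gam3; rewrite /= mul1r.
- move: xi2; rewrite /=; apply: le_trans.
  by rewrite le_eqVlt; apply/orP; left; apply/eqP; field; rewrite gt_eqF.
- by rewrite mulrC divfK ?gt_eqF.
- by rewrite cV -nE.
- by rewrite cV -nE.
- by rewrite cV -nE.
- by rewrite cV -nE.
- by rewrite cV -nE.
by move: n6; rewrite /= mul1r ler_nat nE -cV.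
Qed.
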